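(* Let $\mathbb{H}=\{\tau\in\mathbb{C}:\operatorname{Im}\tau>0\}$. Suppose $f,g:\mathbb{H}\to\mathbb{C}$ are holomorphic and connected via the relation $$g(\tau)=\lambda(\tau)^{-\omega_1}\lambda(-1/\tau)^{-\omega_2}f(\tau)$$ for some $\omega_1,\omega_2\in\mathbb{R}$. Then, if $g$ has a hyperbolic Fourier series expansion $$g(\tau)=\tilde a_0+g_1(\tau)+g_2(-1/\tau),\qquad g_1(\tau)=\sum_{n=1}^{\infty}\tilde a_n\,e^{i\pi n\tau},\quad g_2(\tau)=\sum_{n=1}^{\infty}\tilde b_n\,e^{i\pi n\tau},$$ it follows that $f$ has an exponentially skewed hyperbolic Fourier expansion $$f(\tau)=e^{i\pi\omega_1\tau}\big(a_0+f_1(\tau)\big)+e^{-i\pi\omega_2/\tau}f_2(-1/\tau),\qquad f_1(\tau)=\sum_{n=1}^{\infty}a_n\,e^{i\pi n\tau},\quad f_2(\tau)=\sum_{n=1}^{\infty}b_n\,e^{i\pi n\tau},$$ and vice versa. Here, the coefficient sequences $a_n,b_n$ and $\tilde a_n,\tilde b_n$ meet the subexponential growth bound $$\forall\epsilon>0:\quad|a_n|,|b_n|=O(e^{\epsilon n})\quad\text{as }n\to+\infty$$ (respectively the same bound for $|\tilde a_n|,|\tilde b_n|$) simultaneously. Moreover, the relationship between the two expansions is given by $$a_0+f_1(\tau)=\big(e^{-i\pi\omega_1\tau}\lambda(\tau)^{\omega_1}\big)(1-\lambda(\tau))^{\omega_2}\big(\tilde a_0+g_1(\tau)\big)$$ and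 $$f_2(\tau)=\big(e^{-i\pi\omega_2\tau}\lambda(\tau)^{\omega_2}\big)(1-\lambda(\tau))^{\omega_1}g_2(\tau).$$ In particular, the constants are related via $a_0=16^{\omega_1}\tilde a_0$.
   Context: The modular lambda function is $\lambda(\tau)=\vartheta_{10}(\tau)^4/\vartheta_{00}(\tau)^4$, with $\vartheta_{10}(\tau)=\sum_{n\in\mathbb{Z}}e^{i\pi(n+\frac12)^2\tau}$, $\vartheta_{00}(\tau)=\sum_{n\in\mathbb{Z}}e^{i\pi n^2\tau}$. It has an expansion $\lambda(\tau)=\sum_{n\ge1}\hat\lambda(n)e^{i\pi n\tau}$ with $\hat\lambda(1)=16$, omits the values $0$ and $1$ on $\mathbb{H}$, and satisfies $\lambda(-1/\tau)=1-\lambda(\tau)$. For real $\alpha$ the power is $\lambda(\tau)^\alpha=16^\alpha e^{i\pi\alpha\tau}\big(1+\tfrac1{16}\sum_{n\ge1}\hat\lambda(n+1)e^{i\pi n\tau}\big)^\alpha$, where the last power is given by the binomial series $(1+z)^\alpha=1+\binom{\alpha}{1}z+\cdots$ for large $\operatorname{Im}\tau$ and is continued holomorphically to $\mathbb{H}$; $\lambda(-1/\tau)^\alpha$ is this function evaluated at $-1/\tau$. Likewise $(1-\lambda(\tau))^\alpha$ is defined by the binomial series for large $\operatorname{Im}\tau$ and continued holomorphically to $\mathbb{H}$. The series $\sum_{n\ge1}c_ne^{i\pi n\tau}$ converges on $\mathbb{H}$ exactly when $c_n=O(e^{\epsilon n})$ for every $\epsilon>0$. *)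

(* Defs.v *)
From Stdlib Require Export Reals ZArith ClassicalEpsilon.
From Coquelicot Require Export Coquelicot.

Open Scope C_scope.

Definition HH (tau : C) : Prop := (0 < Im tau)%R.

Definition holomorphic_on_HH (F : C -> C) : Prop :=
  forall tau, HH tau -> ex_derive F tau.

Definition Cexp (z : C) : C :=
  ((exp (Re z) * cos (Im z))%R, (exp (Re z) * sin (Im z))%R).

(* exp (i pi z) *)
Definition expipi (z : C) : C := Cexp (Ci * PI * z).

(* Sum of a series of complex numbers; like [Series], it is total, and it is
   meaningful only when [ex_series u] holds. *)
Definition CSeries (u : nat -> C) : C :=
  (Series (fun n => Re (u n)), Series (fun n => Im (u n))).

(* Sum over Z, as the sum over n >= 0 plus the sum over n <= -1. *)
Definition CSeriesZ (u : Z -> C) : C :=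
  CSeries (fun n => u (Z.of_nat n)) + CSeries (fun n => u (- Z.of_nat (S n))%Z).

(* The series sum_{n >= 1} c_n exp (i pi n tau); the value [c 0] is not used. *)
Definition qterm (c : nat -> C) (tau : C) (n : nat) : C :=
  c (S n) * expipi (INR (S n) * tau).
Definition qseries (c : nat -> C) (tau : C) : C := CSeries (qterm c tau).
Definition qseries_converges (c : nat -> C) : Prop :=
  forall tau, HH tau -> ex_series (qterm c tau).

(* c_n = O(exp (eps n)) for every eps > 0. *)
Definition subexponential (c : nat -> C) : Prop :=
  forall eps : R, (0 < eps)%R ->
  exists (M : R) (N : nat), forall n : nat, (N <= n)%nat ->
    (Cmod (c n) <= M * exp (eps * INR n))%R.

Definition theta00 (tau : C) : C :=
  CSeriesZ (fun n => expipi (IZR n ^ 2 * tau)).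
Definition theta10 (tau : C) : C :=
  CSeriesZ (fun n => expipi ((IZR n + / 2) ^ 2 * tau)).

Definition lambda (tau : C) : C := theta10 tau ^ 4 / theta00 tau ^ 4.

(* The coefficients (n >= 1) of lambda as a series in exp (i pi tau) on HH. *)
Definition lambda_hat : nat -> C :=
  epsilon (inhabits (fun _ : nat => RtoC 0))
    (fun c => forall tau, HH tau -> is_series (qterm c tau) (lambda tau)).

(* The binomial coefficient alpha (alpha - 1) ... (alpha - k + 1) / k! *)
Fixpoint gbinom (alpha : R) (k : nat) : R :=
  match k with
  | O => 1
  | S j => gbinom alpha j * (alpha - INR j) / INR (S j)
  end.

(* (1 + z)^alpha for |z| < 1. *)
Definition binomial_series (alpha : R) (z : C) : C :=
  CSeries (fun k => gbinom alpha k * z ^ k).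

(* The holomorphic function on HH that equals F for all sufficiently large
   Im tau; by the identity theorem there is at most one.  Its values outside HH
   are irrelevant. *)
Definition continuation (F : C -> C) : C -> C :=
  epsilon (inhabits (fun _ : C => RtoC 0))
    (fun G => holomorphic_on_HH G /\
       exists y0 : R, forall tau, HH tau -> (y0 < Im tau)%R -> G tau = F tau).

(* lambda^alpha = 16^alpha exp (i pi alpha tau)
     (1 + 1/16 sum_{n >= 1} lambda_hat(n+1) exp (i pi n tau))^alpha. *)
Definition lambda_pow (alpha : R) (tau : C) : C :=
  Rpower 16 alpha * expipi (alpha * tau) *
  continuation (fun t =>
    binomial_series alpha (/ 16 * qseries (fun n => lambda_hat (S n)) t)) tau.

(* (1 - lambda)^alpha. *)
Definition one_sub_lambda_pow (alpha : R) : C -> C :=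
  continuation (fun t => binomial_series alpha (- lambda t)).

(* In both expansions the constant term is [a 0], and [b 0] is not used. *)
Definition hyperbolic_expansion (g : C -> C) (a b : nat -> C) : Prop :=
  qseries_converges a /\ qseries_converges b /\
  forall tau, HH tau ->
    g tau = a O + qseries a tau + qseries b (- (1) / tau).

Definition skewed_hyperbolic_expansion (w1 w2 : R) (f : C -> C)
    (a b : nat -> C) : Prop :=
  qseries_converges a /\ qseries_converges b /\
  forall tau, HH tau ->
    f tau = expipi (w1 * tau) * (a O + qseries a tau) +
            expipi (- (w2 / tau)) * qseries b (- (1) / tau).

(* (a, b) belongs to the skewed expansion, (ta, tb) to the ordinary one. *)
Definition expansions_related (w1 w2 : R) (a b ta tb : nat -> C) : Prop :=
  (forall tau, HH tau ->
     a O + qseries a tau =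
     (expipi (- (w1 * tau)) * lambda_pow w1 tau) * one_sub_lambda_pow w2 tau *
     (ta O + qseries ta tau)) /\
  (forall tau, HH tau ->
     qseries b tau =
     (expipi (- (w2 * tau)) * lambda_pow w2 tau) * one_sub_lambda_pow w1 tau *
     qseries tb tau) /\
  a O = Rpower 16 w1 * ta O.

(* Main.v *)
Require Import Defs.
From Stdlib Require Import Lra Lia Psatz.

(** By the modular relation [lambda (-1/tau) = 1 - lambda tau], multiplication by
    [lambda(tau)^w1 lambda(-1/tau)^w2] multiplies [ta_0 + g_1(tau)] by
    [lambda^w1 (1-lambda)^w2 (tau)] and [g_2] by [lambda^w2 (1-lambda)^w1], evaluated at
    [-1/tau].  Apart from the factor [exp (i pi w tau)] these are 2-periodic holomorphic
    functions with a limit at [i oo], and such functions are exactly the power series in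
    [exp (i pi tau)] with subexponential coefficients.

    That last fact comes from Goursat's theorem on rectangles: the Fourier coefficients of a
    periodic holomorphic function do not depend on the height, and Chernoff's argument
    (divide [F - F z0] by [exp (2 i pi (z - z0)) - 1]; then the Fourier sums telescope, and
    Bessel's inequality finishes) shows that the Fourier series converges to the function.
    A Cayley transform deduces the identity theorem, hence the uniqueness of
    [continuation].

    The Fourier coefficients of an entire function with the quasi-periods of a theta function
    satisfy a recursion, so such functions form spaces of dimension 1 or 2.  Dimension 1 gives
    [exp (i pi tau z^2) Theta(tau z, tau) = c Theta(z, -1/tau)] and so the inversion of
    [lambda]; dimension 2, applied to [Theta^2], gives duplication formulas up to a common
    factor, and these imply Jacobi's identity [theta00^4 = theta01^4 + theta10^4] and, by
    passing from [2 tau] to [tau], that the theta constants do not vanish.  Hence [lambda] and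
    [1 - lambda] have holomorphic logarithms that are real on the imaginary axis, and these
    are exchanged by [tau -> -1/tau]. *)

(** * The complex exponential *)

(** [continuation] is a choice made by [epsilon], so the powers are known only near [i oo], through
    a binomial series. Statements about them have to pass through a closed form [exp (w L)] with [L]
    holomorphic on all of [HH]; this is why the theta constants must be shown nonvanishing
    everywhere and not just near [i oo]. For real [w] the branch matters: the relation
    [lambda (-1/tau) = 1 - lambda tau] fixes the logarithms only up to [2 i pi k], and a wrong [k]
    would multiply a power by [exp (2 i pi k w)]. The fixed point [i] of [tau -> -1/tau] decides,
    because both logarithms are real there.

    The multipliers produced by the dimension arguments are never computed. They cancel in the
    quotient [lambda], and in Jacobi's identity both sides carry the same product of them; so
    neither Poisson summation nor an infinite product is needed. The expansion theorem applies alike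
    to products with the factors for [(w1, w2)] and for [(-w1, -w2)], which makes the two directions
    of the equivalence one computation. *)

Lemma C_eq (z w : C) : Re z = Re w -> Im z = Im w -> z = w.
Proof. destruct z, w; simpl; intros -> ->; reflexivity. Qed.

Lemma Re_plus z w : Re (z + w) = (Re z + Re w)%R. Proof. reflexivity. Qed.
Lemma Im_plus z w : Im (z + w) = (Im z + Im w)%R. Proof. reflexivity. Qed.
Lemma Re_opp z : Re (- z) = (- Re z)%R. Proof. reflexivity. Qed.
Lemma Im_opp z : Im (- z) = (- Im z)%R. Proof. reflexivity. Qed.
Lemma Re_minus z w : Re (z - w) = (Re z - Re w)%R. Proof. reflexivity. Qed.
Lemma Im_minus z w : Im (z - w) = (Im z - Im w)%R. Proof. reflexivity. Qed.
Lemma Re_mult z w : Re (z * w) = (Re z * Re w - Im z * Im w)%R. Proof. reflexivity. Qed.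
Lemma Im_mult z w : Im (z * w) = (Re z * Im w + Im z * Re w)%R. Proof. reflexivity. Qed.
Lemma Re_RtoC r : Re (RtoC r) = r. Proof. reflexivity. Qed.
Lemma Im_RtoC r : Im (RtoC r) = 0%R. Proof. reflexivity. Qed.
Lemma Re_Ci : Re Ci = 0%R. Proof. reflexivity. Qed.
Lemma Im_Ci : Im Ci = 1%R. Proof. reflexivity. Qed.
Lemma Re_pair a b : Re (a, b) = a. Proof. reflexivity. Qed.
Lemma Im_pair a b : Im (a, b) = b. Proof. reflexivity. Qed.

Ltac ReIm := repeat rewrite ?Re_plus, ?Im_plus, ?Re_opp, ?Im_opp, ?Re_minus,
  ?Im_minus, ?Re_mult, ?Im_mult, ?Re_RtoC, ?Im_RtoC, ?Re_Ci, ?Im_Ci, ?Re_pair, ?Im_pair.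

Lemma Cmod_le_Re_Im z : (Cmod z <= Rabs (Re z) + Rabs (Im z))%R.
Proof.
  replace z with (RtoC (Re z) + Ci * RtoC (Im z)) at 1
    by (apply C_eq; ReIm; ring).
  eapply Rle_trans; [apply Cmod_triangle|].
  rewrite Cmod_mult, Cmod_Ci, !Cmod_R; lra.
Qed.

Lemma Re_le_Cmod z : (Rabs (Re z) <= Cmod z)%R.
Proof. apply re_le_Cmod. Qed.

Lemma Im_le_Cmod z : (Rabs (Im z) <= Cmod z)%R.
Proof. eapply Rle_trans; [apply Rmax_r|apply (Rmax_Cmod z)]. Qed.

Lemma Cmod_triangle_minus z w : (Cmod (z - w) <= Cmod z + Cmod w)%R.
Proof. rewrite <- (Cmod_opp w); apply Cmod_triangle. Qed.

Lemma Cmod_triangle_rev z w : (Cmod z - Cmod w <= Cmod (z + w))%R.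
Proof.
  pose proof (Cmod_triangle_minus (z + w) w) as H.
  replace (z + w - w) with z in H by ring; lra.
Qed.

Lemma Cmod_eq0_small z : (forall eps, 0 < eps -> Cmod z <= eps)%R -> z = 0.
Proof.
  intros H; apply Cmod_eq_0.
  destruct (Cmod_ge_0 z) as [Hp|]; [|easy].
  specialize (H (Cmod z / 2)%R ltac:(lra)); lra.
Qed.

Lemma Cmod_minus_diag z : Cmod (z - z) = 0%R.
Proof. replace (z - z) with (RtoC 0) by ring. apply Cmod_0. Qed.

Lemma Cexp_plus z w : Cexp (z + w) = Cexp z * Cexp w.
Proof.
  unfold Cexp; apply C_eq; ReIm;
  rewrite exp_plus, ?cos_plus, ?sin_plus; ring.
Qed.

Lemma Cexp_0 : Cexp 0 = 1.
Proof. unfold Cexp; apply C_eq; ReIm; rewrite exp_0, ?cos_0, ?sin_0; ring. Qed.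

Lemma Cexp_opp_l z : Cexp (- z) * Cexp z = 1.
Proof. rewrite <- Cexp_plus, <- Cexp_0; f_equal; ring. Qed.

Lemma Cexp_neq_0 z : Cexp z <> 0.
Proof.
  intros H; generalize (Cexp_opp_l z); rewrite H, Cmult_0_r.
  intros E; apply C1_nz; auto.
Qed.

Lemma Cexp_opp z : Cexp (- z) = / Cexp z.
Proof.
  rewrite <- (Cmult_1_r (/ Cexp z)), <- (Cexp_opp_l z), (Cmult_comm (Cexp (- z))), Cmult_assoc, Cinv_l
    by apply Cexp_neq_0.
  ring.
Qed.

Lemma Cexp_minus z w : Cexp (z - w) = Cexp z / Cexp w.
Proof. unfold Cminus; rewrite Cexp_plus, Cexp_opp; reflexivity. Qed.

Lemma Cmod_Cexp z : Cmod (Cexp z) = exp (Re z).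
Proof.
  unfold Cexp, Cmod; simpl fst; simpl snd.
  replace (_ + _)%R with ((exp (Re z)) ^ 2)%R.
  - apply sqrt_pow2, Rlt_le, exp_pos.
  - transitivity ((exp (Re z)) ^ 2 * (Rsqr (sin (Im z)) + Rsqr (cos (Im z))))%R.
    + rewrite sin2_cos2; ring.
    + unfold Rsqr; ring.
Qed.

Lemma Cexp_R (x : R) : Cexp x = RtoC (exp x).
Proof. unfold Cexp; apply C_eq; ReIm; rewrite ?cos_0, ?sin_0; ring. Qed.

Lemma Cexp_INR n z : Cexp (INR n * z) = Cexp z ^ n.
Proof.
  induction n.
  - simpl; rewrite Cmult_0_l; apply Cexp_0.
  - rewrite S_INR, RtoC_plus, Cmult_plus_distr_r, Cexp_plus, IHn, Cmult_1_l, Cpow_S; ring.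
Qed.

Lemma Cexp_2PI : Cexp (2 * PI * Ci) = 1.
Proof.
  unfold Cexp; apply C_eq; ReIm;
  replace (_ - _)%R with 0%R by ring;
  replace (_ + _)%R with (2 * PI)%R by ring;
  rewrite exp_0, ?cos_2PI, ?sin_2PI; ring.
Qed.

Lemma Cexp_PI : Cexp (PI * Ci) = - RtoC 1.
Proof.
  unfold Cexp; apply C_eq; ReIm;
  replace (_ - _)%R with 0%R by ring;
  replace (_ + _)%R with PI by ring;
  rewrite exp_0, ?cos_PI, ?sin_PI; ring.
Qed.

(** Polar form: [acos (Re w / |w|)] is an argument when [Im w >= 0], and its opposite is one when
    [Im w < 0]. *)
Lemma Cexp_surj (w : C) : w <> 0 -> exists z, Cexp z = w.
Proof.
  intros Hw0. assert (Hw := proj1 (Cmod_gt_0 w) Hw0). set (m := Cmod w) in *.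
  assert (Hm : (Re w ^ 2 + Im w ^ 2 = m ^ 2)%R) by (unfold m; rewrite Cmod2_alt; ring).
  assert (Hu : (-1 <= Re w / m <= 1)%R).
  { pose proof (Re_le_Cmod w) as H; fold m in H.
    apply Rabs_le_between in H. split.
    - apply Rmult_le_reg_r with m; auto; field_simplify; lra.
    - apply Rmult_le_reg_r with m; auto; field_simplify; lra. }
  assert (Hs : (sqrt (1 - Rsqr (Re w / m)) = Rabs (Im w) / m)%R).
  { replace (1 - Rsqr (Re w / m))%R with (Rsqr (Rabs (Im w) / m)).
    - apply sqrt_Rsqr. apply Rdiv_le_0_compat; auto. apply Rabs_pos.
    - rewrite Rsqr_div', <- Rsqr_abs. unfold Rsqr.
      replace 1%R with ((Re w ^ 2 + Im w ^ 2) / (m * m))%R by (rewrite Hm; field; lra).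
      field; lra. }
  set (t := acos (Re w / m)).
  assert (Hc : cos t = (Re w / m)%R) by (apply cos_acos; auto).
  assert (Hsn : sin t = (Rabs (Im w) / m)%R) by (unfold t; rewrite sin_acos; auto).
  destruct (Rle_dec 0 (Im w)) as [Hi|Hi].
  - exists (ln m, t). unfold Cexp; apply C_eq; ReIm; rewrite exp_ln by auto;
    rewrite ?Hc, ?Hsn, ?Rabs_pos_eq by auto; field; lra.
  - exists (ln m, - t)%R. unfold Cexp; apply C_eq; ReIm; rewrite exp_ln by auto;
    rewrite ?cos_neg, ?sin_neg, ?Hc, ?Hsn, ?(Rabs_left (Im w)) by lra; field; lra.
Qed.

Lemma Rabs_between_0 c y : (Rmin 0 y <= c <= Rmax 0 y)%R -> (Rabs c <= Rabs y)%R.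
Proof.
  intros H; apply Rabs_le; revert H; unfold Rmin, Rmax, Rabs.
  destruct Rle_dec, Rcase_abs; lra.
Qed.

Lemma exp_le (x y : R) : (x <= y)%R -> (exp x <= exp y)%R.
Proof. intros [H| ->]; [left; apply exp_increasing, H|lra]. Qed.

Lemma MVT_from_0 f df y : (forall x, is_derive f x (df x)) ->
  exists c, (Rmin 0 y <= c <= Rmax 0 y)%R /\ (f y - f 0 = df c * y)%R.
Proof.
  intros H. destruct (MVT_gen f 0 y df) as [c [Hc E]].
  - intros x _; apply H.
  - intros x _. apply continuity_pt_filterlim, (ex_derive_continuous (V := R_NormedModule)).
    eexists; apply H.
  - exists c. rewrite Rminus_0_r in E. auto.
Qed.

Lemma is_derive_cos_opp x : is_derive cos x (- sin x)%R.
Proof. auto_derive; auto; ring. Qed.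

Lemma exp_sub_1_bounds (x : R) : (0 <= exp x - 1 - x <= x ^ 2 * exp (Rabs x))%R.
Proof.
  split; [pose proof (exp_ineq1_le x); lra|].
  destruct (MVT_from_0 exp exp x is_derive_exp) as [c [Hc E]].
  destruct (MVT_from_0 exp exp c is_derive_exp) as [d [Hd E2]].
  rewrite exp_0 in *.
  replace (exp x - 1 - x)%R with (x * (exp c - 1))%R by lra.
  rewrite E2.
  assert (Hde : (exp d <= exp (Rabs x))%R).
  { pose proof (Rabs_between_0 _ _ Hc). pose proof (Rabs_between_0 _ _ Hd).
    pose proof (Rle_abs d). apply exp_le; lra. }
  assert (Hcx : (0 <= x * c <= x ^ 2)%R).
  { unfold Rmin, Rmax in *; repeat destruct Rle_dec; nra. }
  pose proof (exp_pos d). nra.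
Qed.

Lemma one_sub_cos_bounds y : (0 <= 1 - cos y <= y ^ 2)%R.
Proof.
  split; [pose proof (COS_bound y); lra|].
  destruct (MVT_from_0 cos _ y is_derive_cos_opp) as [c [Hc E]].
  destruct (MVT_from_0 sin _ c is_derive_sin) as [d [Hd E2]].
  rewrite cos_0, sin_0 in *.
  replace (1 - cos y)%R with (sin c * y)%R by lra.
  replace (sin c) with (cos d * c)%R by lra.
  assert (Hcx : (0 <= y * c <= y ^ 2)%R).
  { unfold Rmin, Rmax in *; repeat destruct Rle_dec; nra. }
  pose proof (COS_bound d). nra.
Qed.

Lemma sin_sub_id_bound y : (Rabs (sin y - y) <= y ^ 2)%R.
Proof.
  destruct (MVT_from_0 (fun t => sin t - t)%R (fun t => cos t - 1)%R y) as [c [Hc E]].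
  { intros; auto_derive; auto; ring. }
  rewrite sin_0 in E.
  replace (sin y - y)%R with ((cos c - 1) * y)%R by lra.
  destruct (MVT_from_0 cos _ c is_derive_cos_opp) as [d [Hd E2]].
  rewrite cos_0 in E2. rewrite E2, !Rabs_mult, Rabs_Ropp.
  assert (Rabs (sin d) <= 1)%R by (apply Rabs_le, SIN_bound).
  pose proof (Rabs_between_0 _ _ Hc).
  pose proof (Rabs_pos c). pose proof (Rabs_pos (sin d)). pose proof (Rabs_pos y).
  rewrite <- (pow2_abs y).
  assert (Rabs (sin d) * Rabs c <= 1 * Rabs y)%R by (apply Rmult_le_compat; auto).
  nra.
Qed.

(** A second order remainder with an explicit bound for every [h] gives the derivative of [Cexp]
    and, summed over frequencies, termwise differentiation. The constant is not sharp: real and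
    imaginary part contribute 2 each. *)
Lemma Cexp_taylor h : (Cmod (Cexp h - 1 - h) <= 5 * Cmod h ^ 2 * exp (Cmod h))%R.
Proof.
  set (x := Re h). set (y := Im h).
  assert (Hx : (exp (Rabs x) <= exp (Cmod h))%R).
  { apply exp_le, Re_le_Cmod. }
  assert (Hx2 : (Rabs x <= Cmod h)%R) by apply Re_le_Cmod.
  assert (Hy2 : (Rabs y <= Cmod h)%R) by apply Im_le_Cmod.
  pose proof (Rabs_pos x) as Px. pose proof (Rabs_pos y) as Py.
  assert (He1 : (1 <= exp (Cmod h))%R).
  { rewrite <- exp_0. apply exp_le, Cmod_ge_0. }
  set (E := exp (Cmod h)) in *. set (m := Cmod h) in *.
  assert (Sx : (x ^ 2 <= m ^ 2)%R) by (rewrite <- (pow2_abs x); nra).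
  assert (Sy : (y ^ 2 <= m ^ 2)%R) by (rewrite <- (pow2_abs y); nra).
  pose proof (exp_sub_1_bounds x) as B1.
  pose proof (one_sub_cos_bounds y) as B2.
  pose proof (sin_sub_id_bound y) as B3.
  pose proof (exp_le _ _ (Rle_abs x)) as B5. pose proof (exp_pos x) as B6.
  assert (B4 : (Rabs (exp x - 1) <= m * E)%R).
  { destruct (MVT_from_0 exp exp x is_derive_exp) as [c [Hc Ec]]. rewrite exp_0 in Ec. rewrite Ec, Rabs_mult, (Rabs_pos_eq (exp c)) by (left; apply exp_pos).
    assert (exp c <= E)%R.
    { assert (c <= m)%R.
      { pose proof (Rabs_between_0 _ _ Hc). pose proof (Rle_abs c). lra. }
      apply exp_le, H. }
    pose proof (exp_pos c). nra. }
  eapply Rle_trans; [apply Cmod_le_Re_Im|].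
  unfold Cexp; ReIm. fold x y.
  replace (exp x * cos y - 1 - x)%R with ((exp x - 1 - x) - exp x * (1 - cos y))%R by ring.
  replace (exp x * sin y - 0 - y)%R with (exp x * (sin y - y) + (exp x - 1) * y)%R by ring.
  assert (Rabs (exp x - 1 - x - exp x * (1 - cos y)) <= 2 * m ^ 2 * E)%R.
  { eapply Rle_trans; [apply Rabs_triang|].
    rewrite Rabs_Ropp, (Rabs_pos_eq (exp x - 1 - x)), Rabs_pos_eq; try nra. }
  assert (Rabs (exp x * (sin y - y) + (exp x - 1) * y) <= 2 * m ^ 2 * E)%R.
  { eapply Rle_trans; [apply Rabs_triang|].
    rewrite !Rabs_mult, (Rabs_pos_eq (exp x)) by lra.
    pose proof (Rabs_pos (exp x - 1)). pose proof (Rabs_pos (sin y - y)).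
    assert (exp x * Rabs (sin y - y) <= E * m ^ 2)%R by (apply Rmult_le_compat; lra).
    assert (Rabs (exp x - 1) * Rabs y <= (m * E) * m)%R by (apply Rmult_le_compat; lra).
    nra. }
  nra.
Qed.

(** * Complex derivatives and integrals along segments *)

Definition Cderiv (f : C -> C) (z l : C) : Prop :=
  @is_derive C_AbsRing C_NormedModule f z l.

Lemma Cderiv_iff (f : C -> C) (z l : C) : Cderiv f z l <->
  forall eps : R, (0 < eps)%R -> exists d : R, (0 < d)%R /\
    forall w : C, (Cmod (w - z) < d)%R ->
    (Cmod (f w - f z - l * (w - z)) <= eps * Cmod (w - z))%R.
Proof.
  split.
  - intros [_ H] eps He.
    specialize (H z (fun P HP => HP) (mkposreal eps He)).
    destruct H as [d Hd]. exists d; split; [apply cond_pos|].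
    intros w Hw. specialize (Hd w Hw). rewrite (Cmult_comm l). exact Hd.
  - intros H; split; [apply is_linear_scal_l|].
    intros x Hx. apply (@is_filter_lim_locally_unique C_AbsRing (AbsRing_NormedModule C_AbsRing)) in Hx. subst x.
    intros eps. destruct (H eps (cond_pos eps)) as [d [Hd0 Hd]].
    exists (mkposreal d Hd0).
    intros w Hw. specialize (Hd w Hw). rewrite (Cmult_comm l) in Hd. exact Hd.
Qed.

(* Coquelicot's product and chain rules are stated over
   [AbsRing_NormedModule C_AbsRing], which is not convertible to [C_NormedModule]. *)
Lemma Cderiv_AbsRing (f : C -> C) (z l : C) :
  @is_derive C_AbsRing (AbsRing_NormedModule C_AbsRing) f z l <-> Cderiv f z l.
Proof.
  split; intros [_ H]; (split; [apply is_linear_scal_l|]); exact H.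
Qed.

Lemma Cderiv_const (c z : C) : Cderiv (fun _ => c) z 0.
Proof. exact (is_derive_const c z). Qed.

Lemma Cderiv_id (z : C) : Cderiv (fun w => w) z 1.
Proof. apply Cderiv_AbsRing; exact (is_derive_id (K := C_AbsRing) z). Qed.

Lemma Cderiv_plus f g (z a b : C) : Cderiv f z a -> Cderiv g z b ->
  Cderiv (fun w => f w + g w) z (a + b).
Proof. exact (is_derive_plus f g z a b). Qed.

Lemma Cderiv_eq f (z a b : C) : Cderiv f z a -> a = b -> Cderiv f z b.
Proof. intros H <-; exact H. Qed.

Lemma Cderiv_mult f g (z a b : C) : Cderiv f z a -> Cderiv g z b ->
  Cderiv (fun w => f w * g w) z (a * g z + f z * b).
Proof.
  intros Hf Hg; apply Cderiv_AbsRing.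
  apply Cderiv_AbsRing in Hf; apply Cderiv_AbsRing in Hg.
  exact (is_derive_mult f g z a b Hf Hg Cmult_comm).
 Qed.

Lemma Cderiv_comp f g (z a b : C) : Cderiv f (g z) a -> Cderiv g z b ->
  Cderiv (fun w => f (g w)) z (a * b).
Proof.
  intros Hf Hg. rewrite Cmult_comm. apply Cderiv_AbsRing in Hg.
  exact (is_derive_comp f g z a b Hf Hg).
 Qed.

Lemma Cderiv_scal f (c z a : C) : Cderiv f z a -> Cderiv (fun w => c * f w) z (c * a).
Proof.
  intros H; eapply Cderiv_eq; [apply Cderiv_mult; [apply Cderiv_const|exact H]|]; cbv beta; ring.
Qed.

Lemma Cderiv_opp f (z a : C) : Cderiv f z a -> Cderiv (fun w => - f w) z (- a).
Proof. exact (is_derive_opp f z a). Qed.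

Lemma Cderiv_minus f g (z a b : C) : Cderiv f z a -> Cderiv g z b ->
  Cderiv (fun w => f w - g w) z (a - b).
Proof. intros; apply Cderiv_plus; [|apply Cderiv_opp]; assumption. Qed.

Lemma Cderiv_ext_loc f g (z a : C) (d : R) : (0 < d)%R ->
  (forall w, (Cmod (w - z) < d)%R -> f w = g w) -> Cderiv f z a -> Cderiv g z a.
Proof.
  intros Hd E H; apply Cderiv_iff; intros eps He.
  destruct (proj1 (Cderiv_iff f z a) H eps He) as [d' [Hd' H']].
  exists (Rmin d d'); split; [apply Rmin_pos; auto|].
  intros w Hw. rewrite <- !E.
  - apply H'. eapply Rlt_le_trans; [exact Hw|apply Rmin_r].
  - rewrite Cmod_minus_diag; auto.
  - eapply Rlt_le_trans; [exact Hw|apply Rmin_l].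
Qed.

Lemma Cderiv_ext f g (z a : C) : (forall w, f w = g w) -> Cderiv f z a -> Cderiv g z a.
Proof. intros E; apply Cderiv_ext_loc with 1%R; [lra|auto]. Qed.

Lemma Cderiv_inv_id (z : C) : z <> 0 -> Cderiv Cinv z (- / (z * z)).
Proof.
  intros Hz. apply Cderiv_iff; intros eps He.
  pose proof (proj1 (Cmod_gt_0 z) Hz) as Hm. set (m := Cmod z) in *.
  (* The first radius keeps [|w| > m / 2]; the second then makes the remainder [(w - z)^2 / (z^2 w)]
     at most [eps |w - z|]. *)
  exists (Rmin (m / 2) (eps * m ^ 3 / 2)); split.
  { apply Rmin_pos; [lra|]. apply Rdiv_lt_0_compat; [|lra].
    apply Rmult_lt_0_compat; auto. apply pow_lt; auto. }
  intros w Hw.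
  destruct (Rmin_Rgt_l _ _ _ Hw) as [H1 H2].
  assert (Hwm : (m / 2 < Cmod w)%R).
  { pose proof (Cmod_triangle_rev z (w - z)) as T. replace (z + (w - z)) with w in T by ring.
    fold m in T; lra. }
  assert (Hw0 : w <> 0) by (apply Cmod_gt_0; lra).
  replace (/ w - / z - - / (z * z) * (w - z)) with ((w - z) * (w - z) / (z * z * w)) by (field; auto).
  rewrite Cmod_div, !Cmod_mult by (repeat apply Cmult_neq_0; auto). fold m.
  set (t := Cmod (w - z)) in *. assert (0 <= t)%R by apply Cmod_ge_0.
  apply Rle_trans with (t * ((eps * m ^ 3 / 2) / (m * m * (m / 2))))%R.
  - unfold Rdiv at 1. rewrite Rmult_assoc. apply Rmult_le_compat_l; auto.
    assert (Hmm : (0 < m * m)%R) by (apply Rmult_lt_0_compat; lra).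
    apply Rmult_le_compat; auto; [left; apply Rinv_0_lt_compat, Rmult_lt_0_compat; lra|lra|].
    apply Rinv_le_contravar; [apply Rmult_lt_0_compat; lra|apply Rmult_le_compat_l; lra].
  - right; field; lra.
Qed.

Lemma Cderiv_inv f (z a : C) : Cderiv f z a -> f z <> 0 ->
  Cderiv (fun w => / f w) z (- a / (f z * f z)).
Proof.
  intros H Hn. eapply Cderiv_eq.
  - apply (Cderiv_comp Cinv f z _ _ (Cderiv_inv_id _ Hn) H).
  - field; auto.
Qed.

Lemma Cderiv_div f g (z a b : C) : Cderiv f z a -> Cderiv g z b -> g z <> 0 ->
  Cderiv (fun w => f w / g w) z ((a * g z - f z * b) / (g z * g z)).
Proof.
  intros Hf Hg Hn. eapply Cderiv_eq.
  - apply Cderiv_mult; [exact Hf|apply Cderiv_inv; eauto].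
  - cbv beta; field; auto.
Qed.

Lemma Cderiv_exp (z : C) : Cderiv Cexp z (Cexp z).
Proof.
  apply Cderiv_iff; intros eps He.
  set (K := (Cmod (Cexp z) * 5 * exp 1)%R).
  assert (HK : (0 < K)%R).
  { unfold K; rewrite Cmod_Cexp. pose proof (exp_pos (Re z)); pose proof (exp_pos 1); nra. }
  exists (Rmin 1 (eps / K)); split.
  { apply Rmin_pos; [lra|apply Rdiv_lt_0_compat; auto]. }
  intros w Hw.
  destruct (Rmin_Rgt_l _ _ _ Hw) as [H1 H2].
  replace (Cexp w) with (Cexp z * Cexp (w - z)) by (rewrite <- Cexp_plus; f_equal; ring).
  replace (Cexp z * Cexp (w - z) - Cexp z - Cexp z * (w - z))
    with (Cexp z * (Cexp (w - z) - 1 - (w - z))) by ring.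
  rewrite Cmod_mult.
  pose proof (Cexp_taylor (w - z)) as T. set (t := Cmod (w - z)) in *.
  assert (Ht : (0 <= t)%R) by apply Cmod_ge_0.
  assert (exp t <= exp 1)%R by (apply exp_le; lra).
  assert (HtK : (t * K <= eps)%R).
  { apply Rle_trans with (eps / K * K)%R; [apply Rmult_le_compat_r; lra|right; field; lra]. }
  assert (Cmod (Cexp (w - z) - 1 - (w - z)) <= 5 * t ^ 2 * exp 1)%R.
  { eapply Rle_trans; [exact T|]. apply Rmult_le_compat_l; auto. nra. }
  apply Rle_trans with (Cmod (Cexp z) * (5 * t ^ 2 * exp 1))%R.
  - apply Rmult_le_compat_l; auto. apply Cmod_ge_0.
  - replace (_ * (5 * t ^ 2 * exp 1))%R with (t * K * t)%R by (unfold K; ring).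
    apply Rmult_le_compat_r; auto.
Qed.

Lemma Cderiv_Cexp f (z a : C) : Cderiv f z a -> Cderiv (fun w => Cexp (f w)) z (Cexp (f z) * a).
Proof. intros H; apply (Cderiv_comp Cexp f); auto using Cderiv_exp. Qed.

(** * Continuity in the plane and along lines *)

Definition Ccont (f : C -> C) (z : C) : Prop :=
  forall eps : R, (0 < eps)%R -> exists d : R, (0 < d)%R /\
    forall w : C, (Cmod (w - z) < d)%R -> (Cmod (f w - f z) < eps)%R.

Lemma Cderiv_Ccont f (z l : C) : Cderiv f z l -> Ccont f z.
Proof.
  intros H eps He.
  destruct (proj1 (Cderiv_iff f z l) H 1%R ltac:(lra)) as [d [Hd Hf]].
  pose proof (Cmod_ge_0 l) as Hl.
  exists (Rmin d (eps / (2 + Cmod l))); split.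
  { apply Rmin_pos; [auto|apply Rdiv_lt_0_compat; lra]. }
  intros w Hw.
  destruct (Rmin_Rgt_l _ _ _ Hw) as [H1 H2].
  specialize (Hf w H1).
  pose proof (Cmod_triangle (f w - f z - l * (w - z)) (l * (w - z))) as T.
  replace (f w - f z - l * (w - z) + l * (w - z)) with (f w - f z) in T by ring.
  rewrite Cmod_mult in T. pose proof (Cmod_ge_0 (w - z)).
  apply Rmult_lt_compat_r with (r := (2 + Cmod l)%R) in H2; [|lra].
  replace (eps / (2 + Cmod l) * (2 + Cmod l))%R with eps in H2 by (field; lra).
  nra.
Qed.

Definition rcont (g : R -> C) (t : R) : Prop :=
  forall eps : R, (0 < eps)%R -> exists d : R, (0 < d)%R /\
    forall s : R, (Rabs (s - t) < d)%R -> (Cmod (g s - g t) < eps)%R.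

Lemma rcont_continuous_Re g t : rcont g t -> continuous (fun s => Re (g s)) t.
Proof.
  intros H. apply filterlim_locally. intros [eps He].
  destruct (H eps He) as [d [Hd Hg]]. exists (mkposreal d Hd).
  intros s Hs. specialize (Hg s Hs). simpl.
  eapply Rle_lt_trans; [apply (Re_le_Cmod (g s - g t))|exact Hg].
Qed.

Lemma rcont_continuous_Im g t : rcont g t -> continuous (fun s => Im (g s)) t.
Proof.
  intros H. apply filterlim_locally. intros [eps He].
  destruct (H eps He) as [d [Hd Hg]]. exists (mkposreal d Hd).
  intros s Hs. specialize (Hg s Hs). simpl.
  eapply Rle_lt_trans; [apply (Im_le_Cmod (g s - g t))|exact Hg].
Qed.

Lemma rcont_line f (u v : C) (t : R) : Ccont f (u + t * v) -> rcont (fun s : R => f (u + s * v)) t.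
Proof.
  intros H eps He. destruct (H eps He) as [d [Hd Hf]].
  pose proof (Cmod_ge_0 v).
  exists (d / (1 + Cmod v))%R; split; [apply Rdiv_lt_0_compat; lra|].
  intros s Hs. apply Hf.
  replace (u + s * v - (u + t * v)) with ((s - t)%R * v) by (rewrite RtoC_minus; ring).
  rewrite Cmod_mult, Cmod_R.
  apply Rmult_lt_compat_r with (r := (1 + Cmod v)%R) in Hs; [|lra].
  replace (d / (1 + Cmod v) * (1 + Cmod v))%R with d in Hs by (field; lra).
  pose proof (Rabs_pos (s - t)). nra.
Qed.

Lemma rcont_const (c : C) t : rcont (fun _ => c) t.
Proof.
  intros eps He; exists 1%R; split; [lra|]. intros s _.
  rewrite Cmod_minus_diag; auto.
Qed.

Lemma rcont_ext f g t : (forall s, f s = g s) -> rcont f t -> rcont g t.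
Proof.
  intros E H eps He; destruct (H eps He) as [d [Hd Hf]]; exists d; split; auto.
  intros s Hs; rewrite <- !E; auto.
Qed.

Lemma rcont_plus f g t : rcont f t -> rcont g t -> rcont (fun s => f s + g s) t.
Proof.
  intros Hf Hg eps He.
  destruct (Hf (eps / 2)%R ltac:(lra)) as [d [Hd Hf']].
  destruct (Hg (eps / 2)%R ltac:(lra)) as [e [Hee Hg']].
  exists (Rmin d e); split; [apply Rmin_pos; auto|].
  intros s Hs.
  assert (H1 := Hf' s (Rlt_le_trans _ _ _ Hs (Rmin_l _ _))).
  assert (H2 := Hg' s (Rlt_le_trans _ _ _ Hs (Rmin_r _ _))).
  replace (f s + g s - (f t + g t)) with ((f s - f t) + (g s - g t)) by ring.
  eapply Rle_lt_trans; [apply Cmod_triangle|lra].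
Qed.

Lemma rcont_mult f g t : rcont f t -> rcont g t -> rcont (fun s => f s * g s) t.
Proof.
  intros Hf Hg eps He.
  pose proof (Cmod_ge_0 (f t)) as P1. pose proof (Cmod_ge_0 (g t)) as P2.
  set (M := (1 + Cmod (f t) + Cmod (g t))%R).
  assert (HM : (0 < M)%R) by (unfold M; lra).
  assert (Hm : (0 < eps / (2 * M))%R) by (apply Rdiv_lt_0_compat; lra).
  destruct (Hf (Rmin 1 (eps / (2 * M)))%R ltac:(apply Rmin_pos; lra)) as [d [Hd Hf']].
  destruct (Hg (Rmin 1 (eps / (2 * M)))%R ltac:(apply Rmin_pos; lra)) as [e [Hee Hg']].
  exists (Rmin d e); split; [apply Rmin_pos; auto|].
  intros s Hs.
  assert (H1 := Hf' s (Rlt_le_trans _ _ _ Hs (Rmin_l _ _))).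
  assert (H2 := Hg' s (Rlt_le_trans _ _ _ Hs (Rmin_r _ _))).
  replace (f s * g s - f t * g t)
    with ((f s - f t) * (g s - g t) + ((f s - f t) * g t + f t * (g s - g t))) by ring.
  eapply Rle_lt_trans; [apply Cmod_triangle|].
  eapply Rle_lt_trans; [apply Rplus_le_compat_l, Cmod_triangle|].
  rewrite !Cmod_mult.
  pose proof (Rmin_l 1 (eps / (2 * M))) as L1. pose proof (Rmin_r 1 (eps / (2 * M))) as L2.
  set (m := Rmin 1 (eps / (2 * M))) in *.
  pose proof (Cmod_ge_0 (f s - f t)) as Q1. pose proof (Cmod_ge_0 (g s - g t)) as Q2.
  assert (Hme : (m * M < eps)%R).
  { apply Rle_lt_trans with (eps / (2 * M) * M)%R.
    - apply Rmult_le_compat_r; lra.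
    - replace (eps / (2 * M) * M)%R with (eps / 2)%R by (field; lra). lra. }
  assert (Cmod (f s - f t) * Cmod (g s - g t) <= m * 1)%R by (apply Rmult_le_compat; lra).
  assert (Cmod (f s - f t) * Cmod (g t) <= m * Cmod (g t))%R by (apply Rmult_le_compat_r; lra).
  assert (Cmod (f t) * Cmod (g s - g t) <= Cmod (f t) * m)%R by (apply Rmult_le_compat_l; lra).
  unfold M in Hme. lra.
Qed.

Lemma rcont_scal (c : C) g t : rcont g t -> rcont (fun s => c * g s) t.
Proof. intros; apply (rcont_mult (fun _ => c)); auto using rcont_const. Qed.

Lemma rcont_minus f g t : rcont f t -> rcont g t -> rcont (fun s => f s - g s) t.
Proof.
  intros Hf Hg. apply rcont_plus; auto.
  apply rcont_ext with (fun s => - (1) * g s); [intros; ring|apply rcont_scal; auto].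
Qed.

(** * Complex-valued integrals over real intervals *)

Definition CInt (f : R -> C) (a b : R) : C :=
  (RInt (fun t => Re (f t)) a b, RInt (fun t => Im (f t)) a b).

Definition is_CInt (f : R -> C) (a b : R) (l : C) : Prop :=
  is_RInt (fun t => Re (f t)) a b (Re l) /\ is_RInt (fun t => Im (f t)) a b (Im l).

Definition rcont_on (f : R -> C) (a b : R) := forall t, (a <= t <= b)%R -> rcont f t.

Lemma is_CInt_unique f a b l : is_CInt f a b l -> CInt f a b = l.
Proof. intros [H1 H2]; apply C_eq; unfold CInt; ReIm; apply is_RInt_unique; auto. Qed.

Lemma CInt_correct f a b : (a <= b)%R -> rcont_on f a b -> is_CInt f a b (CInt f a b).
Proof.
  intros Hab Hf; split; unfold CInt; ReIm; apply (RInt_correct (V := R_CompleteNormedModule)), (@ex_RInt_continuous R_CompleteNormedModule); rewrite Rmin_left, Rmax_right by auto;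
  intros; [apply rcont_continuous_Re|apply rcont_continuous_Im]; auto.
Qed.

Lemma is_CInt_plus f g a b l m : is_CInt f a b l -> is_CInt g a b m ->
  is_CInt (fun t => f t + g t) a b (l + m).
Proof.
  intros [H1 H2] [H3 H4]; split.
  - apply (is_RInt_plus (V := R_NormedModule) _ _ _ _ _ _ H1 H3).
  - apply (is_RInt_plus (V := R_NormedModule) _ _ _ _ _ _ H2 H4).
Qed.

Lemma is_CInt_scal (c : C) f a b l : is_CInt f a b l -> is_CInt (fun t => c * f t) a b (c * l).
Proof.
  intros [H1 H2]; split; ReIm.
  - pose proof (is_RInt_minus (V := R_NormedModule) _ _ _ _ _ _
      (is_RInt_scal (V := R_NormedModule) _ _ _ (Re c) _ H1)
      (is_RInt_scal (V := R_NormedModule) _ _ _ (Im c) _ H2)) as H.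
    exact H.
  - pose proof (is_RInt_plus (V := R_NormedModule) _ _ _ _ _ _
      (is_RInt_scal (V := R_NormedModule) _ _ _ (Re c) _ H2)
      (is_RInt_scal (V := R_NormedModule) _ _ _ (Im c) _ H1)) as H.
    exact H.
Qed.

Lemma CInt_plus f g a b : (a <= b)%R -> rcont_on f a b -> rcont_on g a b ->
  CInt (fun t => f t + g t) a b = CInt f a b + CInt g a b.
Proof. intros; apply is_CInt_unique, is_CInt_plus; apply CInt_correct; auto. Qed.

Lemma CInt_scal (c : C) f a b : (a <= b)%R -> rcont_on f a b ->
  CInt (fun t => c * f t) a b = c * CInt f a b.
Proof. intros; apply is_CInt_unique, is_CInt_scal, CInt_correct; auto. Qed.

Lemma CInt_ext f g a b : (a <= b)%R -> (forall t, (a <= t <= b)%R -> f t = g t) ->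
  CInt f a b = CInt g a b.
Proof.
  intros Hab E; apply C_eq; unfold CInt; ReIm; apply RInt_ext;
  rewrite Rmin_left, Rmax_right by auto; intros; rewrite E; auto; lra.
Qed.

Lemma CInt_minus f g a b : (a <= b)%R -> rcont_on f a b -> rcont_on g a b ->
  CInt (fun t => f t - g t) a b = CInt f a b - CInt g a b.
Proof.
  intros Hab Hf Hg.
  rewrite (CInt_ext _ (fun t => f t + - (1) * g t)) by (auto; intros; ring).
  rewrite CInt_plus, CInt_scal; auto; [ring|]. intros t Ht; apply rcont_scal; auto.
Qed.

Lemma CInt_Chasles f a b c : (a <= b)%R -> (b <= c)%R -> rcont_on f a c ->
  CInt f a c = CInt f a b + CInt f b c.
Proof.
  intros Hab Hbc Hf.
  destruct (CInt_correct f a b Hab ltac:(intros t Ht; apply Hf; lra)) as [H1 H2].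
  destruct (CInt_correct f b c Hbc ltac:(intros t Ht; apply Hf; lra)) as [H3 H4].
  apply is_CInt_unique; split; apply (is_RInt_Chasles (V := R_NormedModule)) with b; auto.
Qed.

(** The factor 2 comes from bounding real and imaginary part separately; it is harmless, since the
    bound only serves to show that integrals are small. *)
Lemma CInt_bound f a b M : (a <= b)%R -> rcont_on f a b ->
  (forall t, (a <= t <= b)%R -> (Cmod (f t) <= M)%R) ->
  (Cmod (CInt f a b) <= 2 * M * (b - a))%R.
Proof.
  intros Hab Hf HM.
  destruct (CInt_correct f a b Hab Hf) as [H1 H2].
  eapply Rle_trans; [apply Cmod_le_Re_Im|].
  assert (B1 : (Rabs (Re (CInt f a b)) <= (b - a) * M)%R).
  { apply (norm_RInt_le_const (V := R_NormedModule) (fun t => Re (f t)) a b _ M Hab); auto.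
    intros t Ht; eapply Rle_trans; [apply Re_le_Cmod|auto]. }
  assert (B2 : (Rabs (Im (CInt f a b)) <= (b - a) * M)%R).
  { apply (norm_RInt_le_const (V := R_NormedModule) (fun t => Im (f t)) a b _ M Hab); auto.
    intros t Ht; eapply Rle_trans; [apply Im_le_Cmod|auto]. }
  lra.
Qed.

Lemma CInt_shift f a b v : (a <= b)%R -> rcont_on f (a + v) (b + v) ->
  CInt (fun t => f (t + v)%R) a b = CInt f (a + v) (b + v).
Proof.
  intros Hab Hf.
  destruct (CInt_correct f (a + v) (b + v) ltac:(lra) Hf) as [H1 H2].
  apply is_CInt_unique; split.
  - pose proof (is_RInt_comp_lin (V := R_NormedModule) (fun t => Re (f t)) 1 v a b) as H.
    rewrite !Rmult_1_l in H. specialize (H _ H1).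
    eapply (is_RInt_ext (V := R_NormedModule)); [|exact H]. intros; unfold scal; simpl; unfold mult; simpl.
    rewrite !Rmult_1_l; reflexivity.
  - pose proof (is_RInt_comp_lin (V := R_NormedModule) (fun t => Im (f t)) 1 v a b) as H.
    rewrite !Rmult_1_l in H. specialize (H _ H2).
    eapply (is_RInt_ext (V := R_NormedModule)); [|exact H]. intros; unfold scal; simpl; unfold mult; simpl.
    rewrite !Rmult_1_l; reflexivity.
Qed.

(** Extensionality of integrals leaves equations in the carrier of a normed module; retyping them at
    [R] makes [ring] applicable. *)
Ltac toR := cbv beta; match goal with |- @eq _ ?a ?b => change (@eq R a b) end.

Lemma is_RInt_affine (p q a b : R) :
  is_RInt (fun t => p + t * q)%R a b ((b - a) * p + (b ^ 2 - a ^ 2) / 2 * q)%R.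
Proof.
  replace ((b - a) * p + (b ^ 2 - a ^ 2) / 2 * q)%R
    with (minus ((fun t => t * p + t ^ 2 / 2 * q) b) ((fun t => t * p + t ^ 2 / 2 * q) a))%R
    by (unfold minus, plus, opp; simpl; field).
  apply (is_RInt_derive (V := R_CompleteNormedModule) (fun t => t * p + t ^ 2 / 2 * q)%R (fun t => p + t * q)%R).
  - intros x _. auto_derive; auto. field.
  - intros x _. apply (continuous_plus (V := R_NormedModule)); [apply continuous_const|].
    apply (continuous_mult (K := R_AbsRing)); [apply continuous_id|apply continuous_const].
Qed.

Lemma CInt_affine (u v : C) a b :
  CInt (fun t => u + t * v) a b = (b - a)%R * u + ((b ^ 2 - a ^ 2) / 2)%R * v.
Proof.
  apply is_CInt_unique; split; ReIm.
  - replace (_ + _)%R with ((b - a) * Re u + (b ^ 2 - a ^ 2) / 2 * Re v)%R by ring.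
    eapply (is_RInt_ext (V := R_NormedModule)); [|apply (is_RInt_affine (Re u) (Re v))].
    intros; toR; ReIm; ring.
  - replace (_ + _)%R with ((b - a) * Im u + (b ^ 2 - a ^ 2) / 2 * Im v)%R by ring.
    eapply (is_RInt_ext (V := R_NormedModule)); [|apply (is_RInt_affine (Im u) (Im v))].
    intros; toR; ReIm; ring.
Qed.

Lemma CInt_const (c : C) a b : CInt (fun _ => c) a b = (b - a)%R * c.
Proof.
  transitivity (CInt (fun t => c + t * 0) a b).
  - apply C_eq; unfold CInt; ReIm; apply RInt_ext; intros; toR; ReIm; ring.
  - rewrite CInt_affine; ring.
Qed.

(** * Goursat's theorem *)

(** The boundary integral, counterclockwise: bottom minus top, then right minus left with the factor
    [Ci] because [dz = i dy] on vertical sides. *)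
Definition rect_int (F : C -> C) (a b c d : R) : C :=
  CInt (fun x => F (x, c)) a b - CInt (fun x => F (x, d)) a b +
  Ci * (CInt (fun y => F (b, y)) c d - CInt (fun y => F (a, y)) c d).

Definition Ccont_on (F : C -> C) (a b c d : R) :=
  forall z : C, (a <= Re z <= b)%R -> (c <= Im z <= d)%R -> Ccont F z.

Lemma rcont_horizontal F (x c : R) : Ccont F (x, c) -> rcont (fun t => F (t, c)) x.
Proof.
  intros H. apply rcont_ext with (fun s : R => F ((0, c)%R + s * 1)).
  - intros s; f_equal; apply C_eq; ReIm; ring.
  - apply rcont_line. replace ((0, c)%R + x * 1) with (x, c); [auto|].
    apply C_eq; ReIm; ring.
Qed.

Lemma rcont_vertical F (x c : R) : Ccont F (c, x) -> rcont (fun t => F (c, t)) x.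
Proof.
  intros H. apply rcont_ext with (fun s : R => F ((c, 0)%R + s * Ci)).
  - intros s; f_equal; apply C_eq; ReIm; ring.
  - apply rcont_line. replace ((c, 0)%R + x * Ci) with (c, x); [auto|].
    apply C_eq; ReIm; ring.
Qed.

Ltac rcr := intros ? ?; first [apply rcont_horizontal | apply rcont_vertical];
  match goal with H : Ccont_on _ _ _ _ _ |- _ => apply H; ReIm; lra end.

Lemma rect_int_split_x F a m b c d : (a <= m <= b)%R -> (c <= d)%R ->
  Ccont_on F a b c d -> rect_int F a b c d = rect_int F a m c d + rect_int F m b c d.
Proof.
  intros Hm Hcd H. unfold rect_int.
  rewrite (CInt_Chasles (fun x => F (x, c)) a m b) by (try lra; rcr).
  rewrite (CInt_Chasles (fun x => F (x, d)) a m b) by (try lra; rcr).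
  ring.
Qed.

Lemma rect_int_split_y F a b c m d : (a <= b)%R -> (c <= m <= d)%R ->
  Ccont_on F a b c d -> rect_int F a b c d = rect_int F a b c m + rect_int F a b m d.
Proof.
  intros Hm Hcd H. unfold rect_int.
  rewrite (CInt_Chasles (fun x => F (b, x)) c m d) by (try lra; rcr).
  rewrite (CInt_Chasles (fun x => F (a, x)) c m d) by (try lra; rcr).
  ring.
Qed.

(** Goursat's proof subtracts from [F] its affine approximation at the limit point; the boundary
    integral of that part vanishes by explicit evaluation. *)
Lemma rect_int_affine (u v : C) a b c d : rect_int (fun z => u + z * v) a b c d = 0.
Proof.
  assert (E1 : forall y, CInt (fun x => u + (x, y) * v) a b =
     (b - a)%R * (u + Ci * y * v) + ((b ^ 2 - a ^ 2) / 2)%R * v).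
  { intros y; rewrite <- CInt_affine; unfold CInt; apply C_eq; ReIm; apply RInt_ext;
    intros; toR; ReIm; ring. }
  assert (E2 : forall x, CInt (fun y => u + (x, y) * v) c d =
     (d - c)%R * (u + x * v) + ((d ^ 2 - c ^ 2) / 2)%R * (Ci * v)).
  { intros y; rewrite <- CInt_affine; unfold CInt; apply C_eq; ReIm; apply RInt_ext;
    intros; toR; ReIm; ring. }
  unfold rect_int; rewrite !E1, !E2.
  apply C_eq; ReIm; field.
Qed.

Lemma rect_int_minus F G a b c d : (a <= b)%R -> (c <= d)%R ->
  Ccont_on F a b c d -> Ccont_on G a b c d ->
  rect_int (fun z => F z - G z) a b c d = rect_int F a b c d - rect_int G a b c d.
Proof.
  intros Hab Hcd HF HG. unfold rect_int.
  assert (Hx : forall K y, Ccont_on K a b c d -> (c <= y <= d)%R -> rcont_on (fun x => K (x, y)) a b).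
  { intros K y HK Hy x Hx. apply rcont_horizontal, HK; ReIm; lra. }
  assert (Hy : forall K x, Ccont_on K a b c d -> (a <= x <= b)%R -> rcont_on (fun y => K (x, y)) c d).
  { intros K y HK Hy x Hx'. apply rcont_vertical, HK; ReIm; lra. }
  rewrite !CInt_minus by (try lra; first [apply Hx|apply Hy]; auto; lra).
  ring.
Qed.

Lemma rect_int_bound F a b c d M : (a <= b)%R -> (c <= d)%R -> Ccont_on F a b c d ->
  (forall z : C, (a <= Re z <= b)%R -> (c <= Im z <= d)%R -> (Cmod (F z) <= M)%R) ->
  (Cmod (rect_int F a b c d) <= 4 * M * (b - a + (d - c)))%R.
Proof.
  intros Hab Hcd H HM. unfold rect_int.
  assert (Hx : forall y, (c <= y <= d)%R -> (Cmod (CInt (fun x => F (x, y)) a b) <= 2 * M * (b - a))%R).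
  { intros y Hy. apply CInt_bound; [auto|..].
    - intros x Hx. apply rcont_horizontal, H; ReIm; lra.
    - intros x Hx. apply HM; ReIm; lra. }
  assert (Hy : forall x, (a <= x <= b)%R -> (Cmod (CInt (fun y => F (x, y)) c d) <= 2 * M * (d - c))%R).
  { intros x Hx'. apply CInt_bound; [auto|..].
    - intros y Hy. apply rcont_vertical, H; ReIm; lra.
    - intros y Hy. apply HM; ReIm; lra. }
  eapply Rle_trans; [apply Cmod_triangle|]. rewrite Cmod_mult, Cmod_Ci.
  pose proof (Cmod_triangle_minus (CInt (fun x => F (x, c)) a b) (CInt (fun x => F (x, d)) a b)).
  pose proof (Cmod_triangle_minus (CInt (fun y => F (b, y)) c d) (CInt (fun y => F (a, y)) c d)).
  pose proof (Hx c ltac:(lra)). pose proof (Hx d ltac:(lra)).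
  pose proof (Hy a ltac:(lra)). pose proof (Hy b ltac:(lra)).
  lra.
Qed.

Record rect := Rect { rl : R; rr : R; rb : R; rt : R }.

Definition rint F (r : rect) := rect_int F (rl r) (rr r) (rb r) (rt r).

Definition quarter (i j : bool) (r : rect) : rect :=
  let m := ((rl r + rr r) / 2)%R in
  let n := ((rb r + rt r) / 2)%R in
  Rect (if i then m else rl r) (if i then rr r else m)
       (if j then n else rb r) (if j then rt r else n).

(** The last quarter is taken untested: if the first three integrals are each below a quarter of the
    modulus, the triangle inequality leaves at least a quarter to it. *)
Definition bisect F (r : rect) : rect :=
  let big i j := Rle_dec (Cmod (rint F r) / 4) (Cmod (rint F (quarter i j r))) in
  if big false false then quarter false false r else
  if big false true then quarter false true r else
  if big true false then quarter true false r else quarter true true r.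

Definition proper_rect r := (rl r <= rr r)%R /\ (rb r <= rt r)%R.

Definition Ccont_rect F r := Ccont_on F (rl r) (rr r) (rb r) (rt r).

Lemma bisect_quarter F r : exists i j, bisect F r = quarter i j r.
Proof. unfold bisect; repeat destruct Rle_dec; eauto. Qed.

Lemma bisect_large F r : proper_rect r -> Ccont_rect F r ->
  (Cmod (rint F r) / 4 <= Cmod (rint F (bisect F r)))%R.
Proof.
  intros [H1 H2] HF. unfold bisect; repeat destruct Rle_dec; auto.
  assert (E : rint F r = rint F (quarter false false r) + rint F (quarter false true r)
    + (rint F (quarter true false r) + rint F (quarter true true r))).
  { unfold rint; simpl.
    rewrite (rect_int_split_x F _ ((rl r + rr r) / 2)) by (auto; lra).
    f_equal; apply rect_int_split_y; try lra; intros z Hz1 Hz2; apply HF; lra. }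
  pose proof (Cmod_triangle (rint F (quarter false false r) + rint F (quarter false true r))
    (rint F (quarter true false r) + rint F (quarter true true r))) as T1.
  rewrite <- E in T1.
  pose proof (Cmod_triangle (rint F (quarter false false r)) (rint F (quarter false true r))).
  pose proof (Cmod_triangle (rint F (quarter true false r)) (rint F (quarter true true r))).
  lra.
Qed.

Fixpoint bisections F r n : rect :=
  match n with O => r | S n => bisect F (bisections F r n) end.

Section Bisections.
Context (F : C -> C) (r : rect) (Hr : proper_rect r) (HF : Ccont_rect F r).

Lemma bisections_nested n : let s := bisections F r n in
  proper_rect s /\ (rl r <= rl s)%R /\ (rr s <= rr r)%R /\ (rb r <= rb s)%R /\ (rt s <= rt r)%R.
Proof.
  induction n; simpl; [repeat split; try lra; apply Hr|].
  simpl in IHn. destruct IHn as [[P1 P2] IH].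
  destruct (bisect_quarter F (bisections F r n)) as [i [j ->]].
  unfold proper_rect; destruct i, j; simpl; repeat split; lra.
Qed.

Lemma bisections_monotone n k : let s := bisections F r n in let t := bisections F r (n + k) in
  (rl s <= rl t)%R /\ (rr t <= rr s)%R /\ (rb s <= rb t)%R /\ (rt t <= rt s)%R.
Proof.
  simpl. induction k; [rewrite Nat.add_0_r; lra|].
  rewrite Nat.add_succ_r; simpl.
  destruct (bisections_nested (n + k)) as [[P1 P2] _].
  destruct (bisect_quarter F (bisections F r (n + k))) as [i [j ->]].
  destruct i, j; simpl; lra.
Qed.

Lemma bisections_size n : let s := bisections F r n in
  (rr s - rl s = (rr r - rl r) / 2 ^ n)%R /\ (rt s - rb s = (rt r - rb r) / 2 ^ n)%R.
Proof.
  induction n; simpl; [split; field|]. simpl in IHn. destruct IHn as [E1 E2].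
  assert (Hp := pow_nonzero 2 n ltac:(lra)).
  destruct (bisect_quarter F (bisections F r n)) as [i [j ->]].
  split.
  - transitivity ((rr (bisections F r n) - rl (bisections F r n)) / 2)%R.
    + destruct i, j; simpl; field.
    + rewrite E1; field; auto.
  - transitivity ((rt (bisections F r n) - rb (bisections F r n)) / 2)%R.
    + destruct i, j; simpl; field.
    + rewrite E2; field; auto.
Qed.

Lemma bisections_large n :
  (Cmod (rint F r) / 4 ^ n <= Cmod (rint F (bisections F r n)))%R.
Proof.
  induction n; simpl; [lra|].
  eapply Rle_trans; [|apply bisect_large].
  - assert (Hp := pow_nonzero 4 n ltac:(lra)).
    replace (Cmod (rint F r) / (4 * 4 ^ n))%R with (Cmod (rint F r) / 4 ^ n / 4)%R by (field; auto).
    lra.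
  - apply bisections_nested.
  - destruct (bisections_nested n) as [_ H]. intros z H1 H2; apply HF; lra.
Qed.

(** Nested intervals in each coordinate. The supremum of the lower ends works because every lower
    end lies below every upper end: stages [n] and [m] are compared at stage [n + m]. *)
Lemma bisections_point : exists p : C, forall n, let s := bisections F r n in
  (rl s <= Re p <= rr s)%R /\ (rb s <= Im p <= rt s)%R.
Proof.
  assert (Hle : forall (lo hi : rect -> R),
    (forall n k, lo (bisections F r n) <= lo (bisections F r (n + k)))%R ->
    (forall n k, hi (bisections F r (n + k)) <= hi (bisections F r n))%R ->
    (forall n, lo (bisections F r n) <= hi (bisections F r n))%R ->
    exists p, forall n, (lo (bisections F r n) <= p <= hi (bisections F r n))%R).
  { intros lo hi Hlo Hhi Hlh.
    assert (Hcross : forall n m, (lo (bisections F r n) <= hi (bisections F r m))%R).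
    { intros n m. apply Rle_trans with (lo (bisections F r (n + m))); [apply Hlo|].
      eapply Rle_trans; [apply Hlh|]. rewrite Nat.add_comm; apply Hhi. }
    destruct (completeness (fun x => exists n, x = lo (bisections F r n))) as [p [Hp1 Hp2]].
    - exists (hi (bisections F r 0)). intros x [n ->]; apply Hcross.
    - exists (lo (bisections F r 0)); eauto.
    - exists p; intros n; split.
      + apply Hp1; eauto.
      + apply Hp2. intros x [m ->]; apply Hcross. }
  destruct (Hle rl rr) as [x Hx]; [apply bisections_monotone..| |].
  { intros n; apply bisections_nested. }
  destruct (Hle rb rt) as [y Hy]; [apply bisections_monotone..| |].
  { intros n; apply bisections_nested. }
  exists (x, y). intros n; split; [apply Hx|apply Hy].
Qed.

End Bisections.

Theorem Goursat_rect F a b c d : (a <= b)%R -> (c <= d)%R ->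
  (forall z : C, (a <= Re z <= b)%R -> (c <= Im z <= d)%R -> exists l, Cderiv F z l) ->
  rect_int F a b c d = 0.
Proof.
  intros Hab Hcd HF.
  set (r := Rect a b c d).
  assert (Hr : proper_rect r) by (split; auto).
  assert (HC : Ccont_rect F r).
  { intros z H1 H2. destruct (HF z H1 H2) as [l Hl]. eapply Cderiv_Ccont; eauto. }
  destruct (bisections_point F r Hr) as [p Hp].
  destruct (HF p) as [l Hl]; [apply (Hp O)..|].
  set (W := (b - a + (d - c))%R).
  assert (HW : (0 <= W)%R) by (unfold W; lra).
  change (rint F r = 0).
  apply Cmod_eq0_small. intros eps He.
  (* [W] is half the perimeter. The final estimate is [4 e W^2]; the summand 1 covers degenerate
     rectangles, where [W = 0]. *)
  assert (He' : (0 < eps / (4 * W ^ 2 + 1))%R) by (apply Rdiv_lt_0_compat; nra).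
  set (e := (eps / (4 * W ^ 2 + 1))%R) in *.
  destruct (proj1 (Cderiv_iff F p l) Hl e He') as [dl [Hdl Hlin]].
  (* At stage [n] the half-perimeter [W / 2 ^ n] is below [dl], so the rectangle lies in the disc
     where [F] is affine up to [e |z - p|]. *)
  destruct (pow_lt_1_zero (/ 2) ltac:(rewrite Rabs_pos_eq; lra) (dl / (W + 1))) as [n Hn].
  { apply Rdiv_lt_0_compat; lra. }
  specialize (Hn n (le_n n)). rewrite pow_inv, Rabs_pos_eq in Hn
    by (left; apply Rinv_0_lt_compat, pow_lt; lra).
  assert (H2n : (0 < 2 ^ n)%R) by (apply pow_lt; lra).
  set (s := bisections F r n) in *.
  destruct (bisections_nested F r Hr n) as [[P1 P2] Q]. fold s in P1, P2, Q. simpl in Q.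
  destruct (bisections_size F r n) as [S1 S2]. fold s in S1, S2. simpl in S1, S2.
  specialize (Hp n). fold s in Hp. simpl in Hp. destruct Hp as [Hp1 Hp2].
  assert (HWn : (W / 2 ^ n < dl)%R).
  { unfold Rdiv. apply Rmult_lt_compat_l with (r := (W + 1)%R) in Hn; [|lra].
    replace ((W + 1) * (dl / (W + 1)))%R with dl in Hn by (field; lra).
    pose proof (Rinv_0_lt_compat _ H2n). nra. }
  assert (Hdist : forall z : C, (rl s <= Re z <= rr s)%R -> (rb s <= Im z <= rt s)%R ->
    (Cmod (z - p) <= W / 2 ^ n)%R).
  { intros z Hz1 Hz2. eapply Rle_trans; [apply Cmod_le_Re_Im|]. ReIm.
    assert (Rabs (Re z - Re p) <= rr s - rl s)%R by (apply Rabs_le; lra).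
    assert (Rabs (Im z - Im p) <= rt s - rb s)%R by (apply Rabs_le; lra).
    unfold W. replace ((b - a + (d - c)) / 2 ^ n)%R with ((b - a) / 2 ^ n + (d - c) / 2 ^ n)%R by (field; lra).
    lra. }
  assert (HCs : Ccont_on F (rl s) (rr s) (rb s) (rt s)).
  { intros z H1 H2; apply HC; simpl; lra. }
  assert (HA : Ccont_on (fun z => (F p - l * p) + z * l) (rl s) (rr s) (rb s) (rt s)).
  { intros z _ _. eapply Cderiv_Ccont, Cderiv_plus; [apply Cderiv_const|].
    apply Cderiv_mult; [apply Cderiv_id|apply Cderiv_const]. }
  assert (HD : Ccont_on (fun z => F z - ((F p - l * p) + z * l)) (rl s) (rr s) (rb s) (rt s)).
  { intros z Hz1 Hz2. destruct (HF z) as [m Hm]; [lra..|].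
    eapply Cderiv_Ccont, Cderiv_minus; [exact Hm|]. apply Cderiv_plus; [apply Cderiv_const|].
    apply Cderiv_mult; [apply Cderiv_id|apply Cderiv_const]. }
  assert (HI : rint F s = rect_int (fun z => F z - ((F p - l * p) + z * l)) (rl s) (rr s) (rb s) (rt s)).
  { rewrite rect_int_minus, rect_int_affine by auto. unfold rint; ring. }
  assert (HB : (Cmod (rint F s) <= 4 * (e * (W / 2 ^ n)) * (W / 2 ^ n))%R).
  { rewrite HI. replace (W / 2 ^ n)%R with (rr s - rl s + (rt s - rb s))%R at 2.
    - apply rect_int_bound; auto. intros z Hz1 Hz2.
      specialize (Hdist z Hz1 Hz2).
      replace (F z - (F p - l * p + z * l)) with (F z - F p - l * (z - p)) by ring.
      eapply Rle_trans; [apply Hlin; lra|]. apply Rmult_le_compat_l; lra.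
    - rewrite S1, S2; unfold W; field; lra. }
  pose proof (bisections_large F r Hr HC n) as HL. fold s in HL.
  (* The integral shrinks at most by [4 ^ n], while its bound, a length times a deviation, shrinks
     exactly by [4 ^ n]; so the stage cancels. *)
  assert (H4 : (4 ^ n = 2 ^ n * 2 ^ n)%R) by (rewrite <- Rpow_mult_distr; f_equal; lra).
  rewrite H4 in HL.
  assert (HL2 : (Cmod (rint F r) <= 4 * e * W ^ 2)%R).
  { replace (Cmod (rint F r)) with (Cmod (rint F r) / (2 ^ n * 2 ^ n) * (2 ^ n * 2 ^ n))%R by (field; lra).
    replace (4 * e * W ^ 2)%R with (4 * (e * (W / 2 ^ n)) * (W / 2 ^ n) * (2 ^ n * 2 ^ n))%R by (field; lra).
    apply Rmult_le_compat_r; [nra|lra]. }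
  assert (He3 : (e * (4 * W ^ 2 + 1) = eps)%R) by (unfold e; field; nra).
  nra.
Qed.

(** * Fourier series of periodic holomorphic functions *)

Definition Csum (a : nat -> C) (n : nat) : C := @sum_n C_NormedModule a n.

Lemma Csum_0 a : Csum a 0 = a O.
Proof. exact (@sum_O C_NormedModule a). Qed.

Lemma Csum_S a n : Csum a (S n) = Csum a n + a (S n).
Proof. exact (@sum_Sn C_NormedModule a n). Qed.

Definition is_Cseries (a : nat -> C) (l : C) : Prop :=
  @is_series C_AbsRing C_NormedModule a l.

Lemma is_Cseries_iff a l : is_Cseries a l <->
  forall eps : R, (0 < eps)%R -> exists N, forall n, (N <= n)%nat ->
    (Cmod (Csum a n - l) < eps)%R.
Proof.
  split.
  - intros H eps He.
    specialize (H (fun z => (Cmod (z - l) < eps)%R)).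
    destruct H as [N HN].
    + apply (locally_le_locally_norm (K := C_AbsRing) (V := C_NormedModule)).
      exists (mkposreal eps He). intros y Hy; exact Hy.
    + exists N; exact HN.
  - intros H P HP.
    apply (locally_norm_le_locally (K := C_AbsRing) (V := C_NormedModule)) in HP.
    destruct HP as [e He].
    destruct (H e (cond_pos e)) as [N HN]. exists N. intros n Hn; apply He, HN, Hn.
Qed.

Lemma is_Cseries_unique a l m : is_Cseries a l -> is_Cseries a m -> l = m.
Proof.
  intros H1 H2. apply Ceq_minus, Cmod_eq0_small. intros eps He.
  destruct (proj1 (is_Cseries_iff a l) H1 (eps / 2)%R ltac:(lra)) as [N1 HN1].
  destruct (proj1 (is_Cseries_iff a m) H2 (eps / 2)%R ltac:(lra)) as [N2 HN2].
  specialize (HN1 (N1 + N2)%nat ltac:(lia)). specialize (HN2 (N1 + N2)%nat ltac:(lia)).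
  replace (l - m) with ((Csum a (N1 + N2) - m) - (Csum a (N1 + N2) - l)) by ring.
  eapply Rle_trans; [apply Cmod_triangle_minus|lra].
Qed.

Lemma Csum_shift a n : Csum a (S n) = a O + Csum (fun k => a (S k)) n.
Proof. induction n; rewrite Csum_S, ?Csum_0, ?IHn, ?Csum_S; [reflexivity|ring]. Qed.

Lemma is_Cseries_tail a l : is_Cseries a l -> is_Cseries (fun n => a (S n)) (l - a O).
Proof.
  intros H. apply is_Cseries_iff. intros eps He.
  destruct (proj1 (is_Cseries_iff _ _) H eps He) as [N HN].
  exists N. intros n Hn. specialize (HN (S n) ltac:(lia)). rewrite Csum_shift in HN.
  replace (Csum (fun k => a (S k)) n - (l - a O)) with (a O + Csum (fun k => a (S k)) n - l) by ring. auto.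
Qed.

Lemma is_Cseries_cons a l : is_Cseries (fun n => a (S n)) l -> is_Cseries a (a O + l).
Proof.
  intros H. apply is_Cseries_iff. intros eps He.
  destruct (proj1 (is_Cseries_iff _ _) H eps He) as [N HN].
  exists (S N). intros [|n] Hn; [lia|]. specialize (HN n ltac:(lia)). rewrite Csum_shift.
  replace (_ - _) with (Csum (fun k => a (S k)) n - l) by ring. auto.
Qed.

Lemma is_Cseries_ext a b l : (forall n, a n = b n) -> is_Cseries a l -> is_Cseries b l.
Proof. apply is_series_ext. Qed.

Lemma is_Cseries_0 : is_Cseries (fun _ => 0) 0.
Proof.
  apply is_Cseries_iff. intros eps He. exists O. intros n _.
  replace (Csum _ n) with (RtoC 0).
  - rewrite Cmod_minus_diag; auto.
  - induction n; rewrite ?Csum_0, ?Csum_S, <- ?IHn; ring.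
Qed.

Definition ek (k : Z) (z : C) : C := Cexp ((2 * PI * IZR k)%R * Ci * z).

Lemma ek_0 z : ek 0 z = 1.
Proof. unfold ek. rewrite <- Cexp_0. f_equal. rewrite Rmult_0_r; ring. Qed.

Lemma ek_at_0 k : ek k 0 = 1.
Proof. unfold ek. rewrite <- Cexp_0. f_equal. ring. Qed.

Lemma ek_add k l z : ek (k + l) z = ek k z * ek l z.
Proof.
  unfold ek. rewrite <- Cexp_plus. f_equal. rewrite plus_IZR, !RtoC_mult, RtoC_plus; ring.
Qed.

Lemma ek_plus k z w : ek k (z + w) = ek k z * ek k w.
Proof. unfold ek. rewrite <- Cexp_plus. f_equal; ring. Qed.

Lemma ek_opp k z : ek (- k) z * ek k z = 1.
Proof. rewrite <- ek_add, Z.add_opp_diag_l; apply ek_0. Qed.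

Lemma Cexp_Z_period (k : Z) : Cexp ((2 * PI * IZR k)%R * Ci) = 1.
Proof.
  assert (P : forall n : nat, Cexp ((2 * PI * INR n)%R * Ci) = 1).
  { intros n. replace ((2 * PI * INR n)%R * Ci) with (INR n * (2 * PI * Ci)).
    - rewrite Cexp_INR, Cexp_2PI, Cpow_1_l; reflexivity.
    - rewrite !RtoC_mult; ring. }
  destruct (Z.abs_or_opp_abs k) as [E|E].
  - rewrite E, <- (Z2Nat.id (Z.abs k)), <- INR_IZR_INZ by lia; apply P.
  - rewrite E, <- (Z2Nat.id (Z.abs k)), opp_IZR, <- INR_IZR_INZ by lia.
    replace ((2 * PI * - INR (Z.to_nat (Z.abs k)))%R * Ci)
      with (- ((2 * PI * INR (Z.to_nat (Z.abs k)))%R * Ci)) by (rewrite Ropp_mult_distr_r_reverse, RtoC_opp; ring).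
    rewrite Cexp_opp, P. field.
Qed.

Lemma ek_period k z : ek k (z + 1) = ek k z.
Proof.
  rewrite ek_plus. unfold ek at 2. rewrite Cmult_1_r, Cexp_Z_period; ring.
Qed.

Lemma Cmod_ek_R k (x : R) : Cmod (ek k x) = 1%R.
Proof.
  unfold ek. rewrite Cmod_Cexp. ReIm. rewrite <- exp_0. f_equal; ring.
Qed.

Lemma Cmod_ek k z : Cmod (ek k z) = exp (- (2 * PI * IZR k * Im z)).
Proof. unfold ek. rewrite Cmod_Cexp. ReIm. f_equal; ring. Qed.

Lemma Cderiv_ek k z : Cderiv (ek k) z (ek k z * ((2 * PI * IZR k)%R * Ci)).
Proof.
  unfold ek. eapply Cderiv_eq.
  - apply Cderiv_Cexp, Cderiv_scal, Cderiv_id.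
  - cbv beta; ring.
Qed.

Lemma Cderiv_shift F (z v l : C) : Cderiv F (z + v) l -> Cderiv (fun w => F (w + v)) z l.
Proof.
  intros H. eapply Cderiv_eq.
  - apply (Cderiv_comp F (fun w => w + v)); [exact H|].
    apply Cderiv_plus; [apply Cderiv_id|apply Cderiv_const].
  - ring.
Qed.

(** The strip is a predicate on heights, to cover three cases: positive heights for q-expansions,
    all heights for theta functions, and the single height 0 in Chernoff's argument. *)
Definition strip_holo (P : R -> Prop) (F : C -> C) : Prop :=
  forall z, P (Im z) -> exists l, Cderiv F z l.

Definition Rconvex (P : R -> Prop) : Prop :=
  forall a b y, P a -> P b -> (a <= y <= b)%R -> P y.

Definition period_int (F : C -> C) (y : R) : C := CInt (fun x => F (x, y)) 0 1.

(** Goursat's theorem on a rectangle of width one period: the vertical sides cancel, and the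
    difference of the horizontal ones remains. *)
Lemma period_int_const P F y1 y2 : Rconvex P -> strip_holo P F ->
  (forall z, F (z + 1) = F z) -> P y1 -> P y2 -> period_int F y1 = period_int F y2.
Proof.
  intros HP HF Hper.
  assert (W : forall u v, (u <= v)%R -> P u -> P v -> period_int F u = period_int F v).
  { intros u v Huv Hu Hv.
    pose proof (Goursat_rect F 0 1 u v ltac:(lra) Huv) as G.
    unfold rect_int in G.
    replace (CInt (fun y => F (1%R, y)) u v) with (CInt (fun y => F (0%R, y)) u v) in G.
    - apply Ceq_minus. unfold period_int. rewrite <- G; [ring|].
      intros z _ Hz. apply HF. apply (HP u v); auto.
    - apply CInt_ext; auto. intros t _. rewrite <- Hper. f_equal. apply C_eq; ReIm; ring. }
  intros H1 H2. destruct (Rle_dec y1 y2); [auto|symmetry; apply W; auto; lra].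
Qed.

Lemma period_shift_Z (g : R -> C) (k : Z) x : (forall x, g (x + 1)%R = g x) -> g (x + IZR k)%R = g x.
Proof.
  intros H.
  assert (P : forall n : nat, forall x, g (x + INR n)%R = g x).
  { induction n; intros y; [f_equal; simpl; ring|].
    rewrite S_INR. replace (y + (INR n + 1))%R with (y + INR n + 1)%R by ring. rewrite H; auto. }
  destruct (Z.abs_or_opp_abs k) as [E|E].
  - rewrite E, <- (Z2Nat.id (Z.abs k)), <- INR_IZR_INZ by lia; apply P.
  - rewrite E, <- (Z2Nat.id (Z.abs k)), opp_IZR, <- INR_IZR_INZ by lia.
    rewrite <- (P (Z.to_nat (Z.abs k))). f_equal; ring.
Qed.

Lemma CInt_period (g : R -> C) v : (forall x, g (x + 1)%R = g x) -> (forall x, rcont g x) ->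
  CInt g v (v + 1) = CInt g 0 1.
Proof.
  intros H Hg.
  assert (W : forall u, (0 <= u <= 1)%R -> CInt g u (u + 1) = CInt g 0 1).
  { intros u Hu.
    assert (Hon : forall a b, rcont_on g a b) by (intros a b t _; auto).
    rewrite (CInt_Chasles g u 1 (u + 1)), (CInt_Chasles g 0 u 1) by (auto; lra).
    rewrite Cplus_comm. f_equal.
    replace (CInt g 1 (u + 1)) with (CInt g (0 + 1) (u + 1)) by (f_equal; ring).
    rewrite <- CInt_shift by (auto; lra). apply CInt_ext; [lra|intros; apply H]. }
  destruct (base_Int_part v) as [B1 B2].
  set (u := (v - IZR (Int_part v))%R).
  rewrite <- (W u) by (unfold u; lra).
  replace v with (u + IZR (Int_part v))%R at 1 2 by (unfold u; ring).
  replace (u + IZR (Int_part v) + 1)%R with ((u + 1) + IZR (Int_part v))%R by ring.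
  rewrite <- CInt_shift.
  - apply CInt_ext; [lra|]. intros; apply period_shift_Z; auto.
  - lra.
  - intros t _; auto.
Qed.

Lemma strip_rcont P F x y : strip_holo P F -> P y -> rcont (fun x => F (x, y)) x.
Proof.
  intros HF Hy. destruct (HF (x, y) Hy) as [l Hl].
  apply rcont_horizontal; eapply Cderiv_Ccont; eauto.
Qed.

Lemma period_int_shift P F (v : C) y : strip_holo P F -> (forall z, F (z + 1) = F z) ->
  P (y + Im v)%R -> period_int (fun z => F (z + v)) y = period_int F (y + Im v).
Proof.
  intros HF Hper Hy. unfold period_int.
  rewrite <- (CInt_period (fun x => F (x, y + Im v)%R) (Re v)).
  - replace (CInt _ (Re v) (Re v + 1))
      with (CInt (fun x => F (x, y + Im v)%R) (0 + Re v) (1 + Re v)) by (f_equal; ring).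
    rewrite <- CInt_shift; [|lra|intros t _; apply (strip_rcont P); auto].
    apply CInt_ext; [lra|]. intros t _; f_equal; apply C_eq; ReIm; ring.
  - intros x. rewrite <- (Hper (x, _)). f_equal; apply C_eq; ReIm; ring.
  - intros x; apply (strip_rcont P); auto.
Qed.

(** The exponential is taken at the complex point [z], not at its real part; this is what makes the
    coefficient independent of [y]. *)
Definition fcoef (F : C -> C) (y : R) (k : Z) : C := period_int (fun z => F z * ek (- k) z) y.

Lemma fcoef_holo P F k : strip_holo P F -> strip_holo P (fun z => F z * ek k z).
Proof.
  intros HF z Hz. destruct (HF z Hz) as [l Hl]. eexists.
  apply Cderiv_mult; [exact Hl|apply Cderiv_ek].
Qed.

Lemma fcoef_const P F k y1 y2 : Rconvex P -> strip_holo P F ->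
  (forall z, F (z + 1) = F z) -> P y1 -> P y2 -> fcoef F y1 k = fcoef F y2 k.
Proof.
  intros HP HF Hper; apply (period_int_const P); auto.
  - apply fcoef_holo, HF.
  - intros z; rewrite ek_period, Hper; reflexivity.
Qed.

(** With [v] a base point it moves the expansion to [0], where Chernoff's argument works; with
    [v = tau] it turns a quasi-period into a recursion. *)
Lemma fcoef_shift P F (v : C) y k : strip_holo P F -> (forall z, F (z + 1) = F z) ->
  P (y + Im v)%R -> fcoef (fun z => F (z + v)) y k = ek k v * fcoef F (y + Im v) k.
Proof.
  intros HF Hper Hy. unfold fcoef.
  rewrite <- (period_int_shift P (fun z => F z * ek (- k) z) v y); auto.
  - unfold period_int. rewrite <- CInt_scal; [|lra|].
    + apply CInt_ext; [lra|]. intros t _. rewrite ek_plus.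
      transitivity (F ((t, y) + v) * ek (- k) (t, y) * (ek (- k) v * ek k v)); [rewrite ek_opp; ring|ring].
    + intros t _.
      destruct (HF ((t, y) + v)) as [l Hl]; [exact Hy|].
      apply (rcont_horizontal (fun z => F (z + v) * ek (- k) (z + v))).
      eapply Cderiv_Ccont, Cderiv_mult; apply Cderiv_shift; [exact Hl|apply Cderiv_ek].
  - apply fcoef_holo, HF.
  - intros z; rewrite ek_period, Hper; reflexivity.
Qed.

(** For [k < 0] the right side decays as [y] grows, which excludes coefficients of negative index
    when [F] is bounded near [i oo]. *)
Lemma fcoef_bound F y k M : (forall x : R, rcont (fun x => F (x, y)) x) ->
  (forall x : R, (0 <= x <= 1)%R -> (Cmod (F (x, y)) <= M)%R) ->
  (Cmod (fcoef F y k) <= 2 * M * exp (2 * PI * IZR k * y))%R.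
Proof.
  intros HF HM. unfold fcoef, period_int.
  eapply Rle_trans; [apply CInt_bound with (M := (M * exp (2 * PI * IZR k * y))%R)|]; try lra.
  - intros x _. apply rcont_mult; [auto|]. apply rcont_horizontal.
    eapply Cderiv_Ccont, Cderiv_ek.
  - intros t Ht. rewrite Cmod_mult, Cmod_ek, opp_IZR. simpl Im.
    replace (- (2 * PI * - IZR k * y))%R with (2 * PI * IZR k * y)%R by ring.
    apply Rmult_le_compat_r; [left; apply exp_pos|auto].
Qed.

(** * Orthogonality of the exponentials and Bessel's inequality *)

Lemma ek_R k (x : R) : ek k x = (cos (2 * PI * IZR k * x), sin (2 * PI * IZR k * x))%R.
Proof.
  unfold ek, Cexp. ReIm.
  match goal with |- (exp ?a * cos ?b, exp ?c * sin ?d)%R = _ =>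
    replace a with 0%R by ring; replace b with (2 * PI * IZR k * x)%R by ring end.
  rewrite exp_0, !Rmult_1_l; reflexivity.
Qed.

Lemma ek_conj k (x : R) : ek (- k) x = Cconj (ek k x).
Proof.
  rewrite !ek_R, opp_IZR.
  replace (2 * PI * - IZR k * x)%R with (- (2 * PI * IZR k * x))%R by ring.
  rewrite cos_neg, sin_neg; reflexivity.
Qed.

Lemma rcont_ek k t : rcont (fun x : R => ek k x) t.
Proof.
  apply (rcont_horizontal (ek k) t 0). eapply Cderiv_Ccont, Cderiv_ek.
Qed.

(** Translation by [1 / (2 k)] changes the sign of [ek k] but not its integral over a period. *)
Lemma CInt_ek k v : k <> 0%Z -> CInt (fun x : R => ek k x) v (v + 1) = 0.
Proof.
  intros Hk.
  assert (Hp : forall x : R, ek k (x + 1)%R = ek k x).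
  { intros x. rewrite RtoC_plus. apply ek_period. }
  assert (Hk' : IZR k <> 0%R) by (apply not_0_IZR; auto).
  set (s := (/ (2 * IZR k))%R).
  assert (E : ek k s = - RtoC 1).
  { rewrite <- Cexp_PI. unfold ek. f_equal.
    apply C_eq; ReIm; unfold s; field; auto. }
  assert (E2 : CInt (fun x : R => ek k x) s (s + 1) = - (1) * CInt (fun x : R => ek k x) 0 1).
  { replace s with (0 + s)%R at 1 by ring. replace (s + 1)%R with (1 + s)%R by ring.
    rewrite <- CInt_shift by (try lra; intros t _; apply rcont_ek).
    rewrite <- CInt_scal by (try lra; intros t _; apply rcont_ek).
    apply CInt_ext; [lra|]. intros t _. rewrite RtoC_plus, ek_plus, E; ring. }
  rewrite CInt_period in E2 |- * by auto using rcont_ek.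
  replace (CInt (fun x : R => ek k x) 0 1) with
    (/ 2 * (CInt (fun x : R => ek k x) 0 1 - - (1) * CInt (fun x : R => ek k x) 0 1)) by (field; intros H; injection H; lra).
  rewrite <- E2. ring.
Qed.

(** The interval is centred at [0] because the removable singularity of Chernoff's quotient sits
    there, and [ek 1] takes the value 1 nowhere else on it. *)
Definition qc (Q : R -> C) (k : Z) : C := CInt (fun x => Q x * ek (- k) x) (- / 2) (/ 2).

Definition rcont_sym Q := rcont_on Q (- / 2) (/ 2).

Lemma qc_ek j k : qc (fun x => ek j x) k = if Z.eq_dec j k then 1 else 0.
Proof.
  unfold qc. replace (/ 2)%R with (- / 2 + 1)%R at 2 by field.
  transitivity (CInt (fun x : R => ek (j - k) x) (- / 2) (- / 2 + 1)).
  - apply CInt_ext; [lra|]. intros t _. rewrite <- ek_add; reflexivity.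
  - destruct Z.eq_dec as [->|H].
    + rewrite Z.sub_diag. rewrite (CInt_ext _ (fun _ => 1)); [|lra|intros; apply ek_0].
      rewrite CInt_const. apply C_eq; ReIm; ring.
    + apply CInt_ek. lia.
Qed.

Lemma qc_minus_scal f (c : C) j k : rcont_sym f ->
  qc (fun x => f x - c * ek j x) k = qc f k - c * (if Z.eq_dec j k then 1 else 0).
Proof.
  intros Hf. rewrite <- qc_ek. unfold qc.
  rewrite <- CInt_scal by (try lra; intros t _; apply rcont_mult; apply rcont_ek).
  rewrite <- CInt_minus; try lra.
  - apply CInt_ext; [lra|]; intros; ring.
  - intros t Ht; apply rcont_mult; auto using rcont_ek.
  - intros t Ht; apply rcont_scal, rcont_mult; apply rcont_ek.
Qed.

Definition energy (f : R -> C) : R := RInt (fun x => (Cmod (f x) ^ 2)%R) (- / 2) (/ 2).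

Lemma energy_correct f : rcont_sym f ->
  is_RInt (fun x => (Cmod (f x) ^ 2)%R) (- / 2) (/ 2) (energy f).
Proof.
  intros Hf. apply (RInt_correct (V := R_CompleteNormedModule)), (@ex_RInt_continuous R_CompleteNormedModule).
  rewrite Rmin_left, Rmax_right by lra. intros t Ht.
  apply continuous_ext with (fun x => (Re (f x) * Re (f x) + Im (f x) * Im (f x))%R).
  { intros x. rewrite Cmod2_alt; toR; ring. }
  apply (continuous_plus (V := R_NormedModule));
  apply (continuous_mult (K := R_AbsRing)); first [apply rcont_continuous_Re|apply rcont_continuous_Im]; auto.
Qed.

Lemma energy_ge_0 f : rcont_sym f -> (0 <= energy f)%R.
Proof.
  intros Hf. apply (is_RInt_ge_0 (fun x => (Cmod (f x) ^ 2)%R) (- / 2) (/ 2)); [lra|apply energy_correct; auto|].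
  intros; apply pow2_ge_0.
Qed.

(** One step of Bessel's inequality. With [|e| = 1] and [c] the coefficient, expanding [|f - c e|^2]
    adds [|c|^2] to the energy and the cross term removes [2 |c|^2]. *)
Lemma energy_minus_coef f k : rcont_sym f ->
  energy (fun x => f x - qc f k * ek k x) = (energy f - Cmod (qc f k) ^ 2)%R.
Proof.
  intros Hf. set (c := qc f k).
  pose proof (energy_correct f Hf) as H1.
  assert (H2 : is_CInt (fun x => Cconj c * (f x * ek (- k) x)) (- / 2) (/ 2) (Cconj c * c)).
  { apply is_CInt_scal. unfold c, qc. apply CInt_correct; [lra|].
    intros t Ht; apply rcont_mult; auto using rcont_ek. }
  destruct H2 as [H2 _].
  apply (is_RInt_unique (V := R_CompleteNormedModule)).
  pose proof (is_RInt_const (V := R_NormedModule) (- / 2) (/ 2) (Cmod c ^ 2)%R) as H3.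
  pose proof (is_RInt_scal (V := R_NormedModule) _ _ _ (-2) _ H2) as H4.
  pose proof (is_RInt_plus (V := R_NormedModule) _ _ _ _ _ _ H1
    (is_RInt_plus (V := R_NormedModule) _ _ _ _ _ _ H3 H4)) as H.
  replace (energy f - Cmod c ^ 2)%R with
    (energy f + ((/ 2 - - / 2) * Cmod c ^ 2 + (-2) * Re (Cconj c * c)))%R.
  - eapply (is_RInt_ext (V := R_NormedModule)); [|exact H].
    intros x _.
    match goal with |- @eq _ ?a ?b => change (@eq R (Cmod (f x) ^ 2 + (Cmod c ^ 2 +
      (-2) * Re (Cconj c * (f x * ek (- k) x)))) b)%R end.
    rewrite ek_conj, !Cmod2_alt.
    assert (He : (Re (ek k x) ^ 2 + Im (ek k x) ^ 2 = 1)%R).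
    { rewrite <- Cmod2_alt, Cmod_ek_R; ring. }
    unfold Cconj; ReIm. change (fst c) with (Re c). change (snd c) with (Im c).
    change (fst (ek k x)) with (Re (ek k x)). change (snd (ek k x)) with (Im (ek k x)).
    set (p := Re (ek k x)) in *. set (q := Im (ek k x)) in *.
    generalize (Re (f x)) (Im (f x)) (Re c) (Im c). intros u v r s.
    replace ((r ^ 2 + s ^ 2))%R with ((r ^ 2 + s ^ 2) * (p ^ 2 + q ^ 2))%R by (rewrite He; ring).
    ring.
  - rewrite Cmod2_alt. unfold Cconj; ReIm.
    change (fst c) with (Re c). change (snd c) with (Im c). field.
Qed.

Section Bessel.
Context (Q : R -> C) (HQ : rcont_sym Q) (sigma : nat -> Z)
  (Hinj : forall i j, sigma i = sigma j -> i = j).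

(** What is left of [Q] after removing its components along [sigma 0, ..., sigma (n - 1)]; not a
    residue in the sense of contour integrals. In use [sigma] runs through the frequencies [n >= 0]
    or those below -1. *)
Fixpoint residue (n : nat) : R -> C :=
  match n with
  | O => Q
  | S n => fun x => residue n x - qc Q (sigma n) * ek (sigma n) x
  end.

Lemma residue_cont n : rcont_sym (residue n).
Proof.
  induction n; simpl; auto. intros t Ht. apply rcont_minus; [auto|].
  apply rcont_scal, rcont_ek.
Qed.

Lemma residue_coef n k : (forall i, (i < n)%nat -> sigma i <> k) -> qc (residue n) k = qc Q k.
Proof.
  induction n; intros H; simpl; [reflexivity|].
  rewrite qc_minus_scal by apply residue_cont.
  rewrite IHn by (intros; apply H; lia).
  destruct Z.eq_dec as [E|]; [|ring]. exfalso; apply (H n); auto.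
Qed.

Lemma residue_energy n : energy (residue (S n)) = (energy Q - sum_n (fun i => Cmod (qc Q (sigma i)) ^ 2) n)%R.
Proof.
  assert (R : forall n, energy (residue (S n)) = (energy (residue n) - Cmod (qc Q (sigma n)) ^ 2)%R).
  { intros m. simpl. rewrite <- (residue_coef m (sigma m)).
    - apply energy_minus_coef, residue_cont.
    - intros i Hi E. apply Hinj in E. lia. }
  induction n.
  - rewrite R, sum_O; reflexivity.
  - rewrite R, IHn, sum_Sn. unfold plus; simpl; ring.
Qed.

(** Energies of the remainders are nonnegative, so the sums of [|qc|^2] are bounded by [energy Q]; a
    convergent series has terms tending to 0. *)
Lemma Riemann_Lebesgue eps : (0 < eps)%R ->
  exists N, forall n, (N <= n)%nat -> (Cmod (qc Q (sigma n)) < eps)%R.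
Proof.
  intros He.
  assert (Hex : ex_series (fun i => (Cmod (qc Q (sigma i)) ^ 2)%R)).
  { assert (Hl : ex_finite_lim_seq (sum_n (fun i => (Cmod (qc Q (sigma i)) ^ 2)%R))).
    - apply ex_finite_lim_seq_incr with (energy Q).
      + intros n. rewrite sum_Sn. unfold plus; simpl.
        pose proof (pow2_ge_0 (Cmod (qc Q (sigma (S n))))). simpl in *; lra.
      + intros n. pose proof (residue_energy n) as E.
        pose proof (energy_ge_0 _ (residue_cont (S n))). lra.
    - destruct Hl as [l Hl]. exists l. exact Hl. }
  apply ex_series_lim_0 in Hex.
  apply is_lim_seq_spec in Hex. specialize (Hex (mkposreal (eps ^ 2) ltac:(nra))).
  destruct Hex as [N HN]. exists N. intros n Hn. specialize (HN n Hn). simpl in HN.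
  rewrite Rminus_0_r, Rabs_pos_eq in HN.
  - pose proof (Cmod_ge_0 (qc Q (sigma n))). nra.
  - pose proof (Cmod_ge_0 (qc Q (sigma n))). nra.
Qed.

End Bessel.

(** * Chernoff's proof that Fourier series converge *)

Lemma ek_eq_1_R (t : R) : (- / 2 <= t <= / 2)%R -> ek 1 t = 1 -> t = 0%R.
Proof.
  intros Ht E. rewrite ek_R in E. apply (f_equal Re) in E. simpl in E.
  rewrite Rmult_1_r in E. pose proof PI_RGT_0 as HPI.
  assert (HA : (cos (Rabs (2 * PI * t)) = 1)%R).
  { unfold Rabs; destruct Rcase_abs; rewrite ?cos_neg; auto. }
  assert (HB : (0 <= Rabs (2 * PI * t) <= PI)%R).
  { split; [apply Rabs_pos|apply Rabs_le; split; nra]. }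
  assert (HC : Rabs (2 * PI * t) = 0%R).
  { rewrite <- (acos_cos _ HB), HA; apply acos_1. }
  apply Rabs_eq_0 in HC. nra.
Qed.

Section Chernoff.
Context (G : C -> C) (HG : strip_holo (fun y => y = 0%R) G) (Hper : forall z, G (z + 1) = G z).

(** On the interval [ek 1 - 1] has a simple zero at [0] and no other, so [(G - G 0) / (ek 1 - 1)]
    extends continuously, with the quotient of the derivatives as value at [0]. *)
Lemma chernoff_quotient : exists Q : R -> C, rcont_sym Q /\
  forall t : R, (- / 2 <= t <= / 2)%R -> G t = G 0 + Q t * (ek 1 t - 1).
Proof.
  destruct (HG 0 eq_refl) as [l Hl].
  set (m := (2 * PI * IZR 1)%R * Ci).
  assert (Hm : m <> 0).
  { unfold m. apply Cmult_neq_0; [|apply Ci_nz]. intros H. apply RtoC_inj in H.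
    pose proof PI_RGT_0; lra. }
  assert (Hem : Cderiv (ek 1) 0 m).
  { eapply Cderiv_eq; [apply Cderiv_ek|]. rewrite ek_at_0. unfold m; ring. }
  set (Q := fun t : R => if Req_EM_T t 0 then l / m else (G t - G 0) / (ek 1 t - 1)).
  exists Q. split.
  - intros t Ht. destruct (Req_EM_T t 0) as [->|Hne].
    + (* continuity at 0: both increments are linear up to a relative error *)
      pose proof (proj1 (Cmod_gt_0 m) Hm) as Hmp. set (a := Cmod m) in *.
      intros eps He.
      pose proof (Cmod_ge_0 l) as Hlp.
      (* The first bound keeps [|ek 1 s - 1| >= (a / 2) |s|]; the second makes the numerator of the
         difference of quotients small against [eps]. *)
      set (e := Rmin (a / 2) (eps * a ^ 2 / (4 * (a + Cmod l)))%R).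
      assert (Hep : (0 < e)%R).
      { apply Rmin_pos; [lra|]. apply Rdiv_lt_0_compat; [|lra].
        apply Rmult_lt_0_compat; [lra|apply pow_lt; lra]. }
      destruct (proj1 (Cderiv_iff G 0 l) Hl e Hep) as [d1 [Hd1 D1]].
      destruct (proj1 (Cderiv_iff (ek 1) 0 m) Hem e Hep) as [d2 [Hd2 D2]].
      exists (Rmin d1 d2); split; [apply Rmin_pos; auto|].
      intros s Hs. unfold Q. destruct (Req_EM_T 0 0) as [_|]; [|lra].
      destruct (Req_EM_T s 0) as [_|Hs0].
      { rewrite Cmod_minus_diag; auto. }
      assert (Es : Cmod (s - 0) = Rabs s).
      { replace (s - 0) with (RtoC s) by ring. apply Cmod_R. }
      rewrite Rminus_0_r in Hs.
      specialize (D1 s). specialize (D2 s). rewrite Es in D1, D2. rewrite ek_at_0 in D2.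
      specialize (D1 (Rlt_le_trans _ _ _ Hs (Rmin_l _ _))).
      specialize (D2 (Rlt_le_trans _ _ _ Hs (Rmin_r _ _))).
      replace (s - 0) with (RtoC s) in D1, D2 by ring.
      assert (Hsp : (0 < Rabs s)%R) by (apply Rabs_pos_lt; auto).
      set (u := G s - G 0) in *. set (v := ek 1 s - 1) in *.
      assert (Hv : (a / 2 * Rabs s <= Cmod v)%R).
      { pose proof (Cmod_triangle_rev (m * s) (v - m * s)) as T.
        replace (m * s + (v - m * s)) with v in T by ring.
        rewrite Cmod_mult, Cmod_R in T. fold a in T.
        assert (e <= a / 2)%R by apply Rmin_l. nra. }
      assert (Hv0 : v <> 0) by (apply Cmod_gt_0; nra).
      replace (u / v - l / m) with (((u - l * s) * m - l * (v - m * s)) / (v * m)) by (field; auto).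
      rewrite Cmod_div, Cmod_mult by (apply Cmult_neq_0; auto). fold a.
      assert (HN : (Cmod ((u - l * s) * m - l * (v - m * s)) <= e * Rabs s * (a + Cmod l))%R).
      { eapply Rle_trans; [apply Cmod_triangle_minus|]. rewrite !Cmod_mult. fold a.
        apply Rmult_le_compat_r with (r := a) in D1; [|lra].
        apply Rmult_le_compat_l with (r := Cmod l) in D2; [|lra]. lra. }
      assert (He2 : (e * (a + Cmod l) <= eps * a ^ 2 / 4)%R).
      { apply Rle_trans with (eps * a ^ 2 / (4 * (a + Cmod l)) * (a + Cmod l))%R.
        - apply Rmult_le_compat_r; [lra|apply Rmin_r].
        - right; field; lra. }
      assert (Hva : (0 < Cmod v * a)%R) by (apply Rmult_lt_0_compat; [apply Cmod_gt_0; auto|lra]).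
      apply Rmult_lt_reg_r with (Cmod v * a)%R; [auto|].
      replace (Cmod ((u - l * s) * m - l * (v - m * s)) / (Cmod v * a) * (Cmod v * a))%R
        with (Cmod ((u - l * s) * m - l * (v - m * s))) by (field; split; nra).
      eapply Rle_lt_trans; [exact HN|].
      apply Rle_lt_trans with (eps * a ^ 2 / 4 * Rabs s)%R; [nra|].
      apply Rlt_le_trans with (eps * (a / 2 * Rabs s * a))%R; [|apply Rmult_le_compat_l; [lra|apply Rmult_le_compat_r; lra]].
      assert (0 < eps * a ^ 2 * Rabs s)%R by (apply Rmult_lt_0_compat; [apply Rmult_lt_0_compat; [lra|apply pow_lt; lra]|lra]).
      nra.
    + assert (Hne1 : ek 1 t - 1 <> 0).
      { intros E. apply Ceq_minus, ek_eq_1_R in E; auto. }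
      assert (HR : rcont (fun s : R => (G s - G 0) / (ek 1 s - 1)) t).
      { destruct (HG t eq_refl) as [lt Hlt].
        apply (rcont_horizontal (fun s => (G s - G 0) / (ek 1 s - 1)) t 0).
        eapply Cderiv_Ccont, Cderiv_div; [| |exact Hne1].
        - apply Cderiv_minus; [exact Hlt|apply Cderiv_const].
        - apply Cderiv_minus; [apply Cderiv_ek|apply Cderiv_const]. }
      intros eps He. destruct (HR eps He) as [d [Hd D]].
      exists (Rmin d (Rabs t)); split; [apply Rmin_pos; auto; apply Rabs_pos_lt; auto|].
      intros s Hs. unfold Q.
      destruct (Req_EM_T t 0); [easy|]. destruct (Req_EM_T s 0) as [->|_].
      * exfalso. pose proof (Rmin_r d (Rabs t)). rewrite Rminus_0_l, Rabs_Ropp in Hs. lra.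
      * apply D. eapply Rlt_le_trans; [exact Hs|apply Rmin_l].
  - intros t Ht. unfold Q. destruct (Req_EM_T t 0) as [->|Hne].
    + rewrite ek_at_0; ring.
    + field. intros E. apply Ceq_minus, ek_eq_1_R in E; auto.
Qed.

(** By [G = G 0 + Q (ek 1 - 1)], coefficient [k] is [qc Q (k - 1) - qc Q k], plus [G 0] at [k = 0].
    Both half sums telescope; [q = qc Q (-1)] is the boundary term where they meet, and the far ends
    vanish by the Riemann-Lebesgue lemma. *)
Lemma Fourier_at_0 : exists q : C,
  is_Cseries (fun n => fcoef G 0 (Z.of_nat n)) (G 0 + q) /\
  is_Cseries (fun n => fcoef G 0 (- Z.of_nat (S n))) (- q).
Proof.
  destruct chernoff_quotient as [Q [HQ E]].
  assert (HGk : forall k t, rcont (fun t : R => G t * ek (- k) t) t).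
  { intros k t. destruct (HG t eq_refl) as [lt Hlt].
    apply rcont_mult; [|apply rcont_ek].
    apply (rcont_horizontal G t 0). eapply Cderiv_Ccont; exact Hlt. }
  assert (HC : forall k, fcoef G 0 k = G 0 * (if Z.eq_dec 0 k then 1 else 0) + (qc Q (k - 1) - qc Q k)).
  { intros k. rewrite <- qc_ek. unfold fcoef, period_int.
    transitivity (CInt (fun t : R => G t * ek (- k) t) (- / 2) (/ 2)).
    { replace (/ 2)%R with (- / 2 + 1)%R at 2 by field.
      symmetry. apply CInt_period; auto.
      intros x; cbv beta. change ((x + 1)%R, 0%R) with (RtoC (x + 1)); change (x, 0%R) with (RtoC x). rewrite RtoC_plus, Hper, ek_period; reflexivity. }
    unfold qc.
    rewrite <- CInt_scal by (try lra; intros t _; apply rcont_mult; apply rcont_ek).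
    rewrite <- CInt_minus by (try lra; intros t Ht; apply rcont_mult; auto using rcont_ek).
    rewrite <- CInt_plus; try lra.
    - apply CInt_ext; [lra|]. intros t Ht. rewrite ek_0, E by auto.
      replace (- (k - 1))%Z with (- k + 1)%Z by lia. rewrite ek_add. ring.
    - intros t _; apply rcont_scal, rcont_mult; apply rcont_ek.
    - intros t Ht; apply rcont_minus; apply rcont_mult; auto using rcont_ek. }
  exists (qc Q (-1)). split.
  - assert (S1 : forall n, Csum (fun n => fcoef G 0 (Z.of_nat n)) n = G 0 + qc Q (-1) - qc Q (Z.of_nat n)).
    { induction n.
      - rewrite Csum_0, HC. simpl. ring.
      - rewrite Csum_S, IHn, HC. destruct Z.eq_dec; [lia|].
        replace (Z.of_nat (S n) - 1)%Z with (Z.of_nat n) by lia. ring. }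
    apply is_Cseries_iff. intros eps He.
    destruct (Riemann_Lebesgue Q HQ Z.of_nat Nat2Z.inj eps He) as [N HN].
    exists N. intros n Hn. rewrite S1.
    replace (_ - _) with (- qc Q (Z.of_nat n)) by ring. rewrite Cmod_opp; auto.
  - assert (S2 : forall n, Csum (fun n => fcoef G 0 (- Z.of_nat (S n))) n
      = qc Q (- Z.of_nat (S (S n))) - qc Q (-1)).
    { induction n.
      - rewrite Csum_0, HC. simpl. ring.
      - rewrite Csum_S, IHn, HC. destruct Z.eq_dec; [lia|].
        replace (- Z.of_nat (S (S n)) - 1)%Z with (- Z.of_nat (S (S (S n))))%Z by lia. ring. }
    apply is_Cseries_iff. intros eps He.
    destruct (Riemann_Lebesgue Q HQ (fun n => (- Z.of_nat (S (S n)))%Z) ltac:(intros i j Hij; cbv beta in Hij; lia) eps He) as [N HN].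
    exists N. intros n Hn. rewrite S2.
    replace (_ - _) with (qc Q (- Z.of_nat (S (S n)))) by ring. auto.
Qed.

End Chernoff.

(** [Fourier_at_0] for the translate of [F] by [z]. The halves converge separately and [q] cancels
    in their sum; if all negative coefficients vanish, the second half forces [q = 0]. *)
Theorem Laurent P F z : strip_holo P F -> (forall z, F (z + 1) = F z) -> P (Im z) ->
  exists q : C,
  is_Cseries (fun n => fcoef F (Im z) (Z.of_nat n) * ek (Z.of_nat n) z) (F z + q) /\
  is_Cseries (fun n => fcoef F (Im z) (- Z.of_nat (S n)) * ek (- Z.of_nat (S n)) z) (- q).
Proof.
  intros HF Hper Hz.
  destruct (Fourier_at_0 (fun w => F (w + z))) as [q [H1 H2]].
  - intros w Hw. destruct (HF (w + z)) as [l Hl].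
    + rewrite Im_plus, Hw, Rplus_0_l; auto.
    + exists l. apply Cderiv_shift; auto.
  - intros w. rewrite <- (Hper (w + z)). f_equal; ring.
  - assert (E : forall k, fcoef (fun w => F (w + z)) 0 k = fcoef F (Im z) k * ek k z).
    { intros k. rewrite (fcoef_shift P); auto.
      - rewrite Rplus_0_l; ring.
      - rewrite Rplus_0_l; auto. }
    exists q. split; [clear H2|clear H1].
    + rewrite Cplus_0_l in H1. eapply is_Cseries_ext; [|exact H1]. intros; apply E.
    + eapply is_Cseries_ext; [|exact H2]. intros; apply E.
Qed.

(** * Exponential sums *)

Lemma Re_Csum a n : Re (Csum a n) = sum_n (fun k => Re (a k)) n.
Proof.
  induction n; [rewrite Csum_0, sum_O; auto|].
  rewrite Csum_S, Re_plus, IHn, sum_Sn; reflexivity.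
Qed.

Lemma Im_Csum a n : Im (Csum a n) = sum_n (fun k => Im (a k)) n.
Proof.
  induction n; [rewrite Csum_0, sum_O; auto|].
  rewrite Csum_S, Im_plus, IHn, sum_Sn; reflexivity.
Qed.

Lemma is_series_R_iff (a : nat -> R) (l : R) :
  (forall eps : R, (0 < eps)%R -> exists N, forall n, (N <= n)%nat ->
    (Rabs (sum_n a n - l) < eps)%R) -> is_series a l.
Proof.
  intros H. apply filterlim_locally. intros [e He].
  destruct (H e He) as [N HN]. exists N. intros n Hn. apply HN, Hn.
Qed.

Lemma CSeries_unique a l : is_Cseries a l -> CSeries a = l.
Proof.
  intros H. pose proof (proj1 (is_Cseries_iff a l) H) as H'.
  unfold CSeries. apply C_eq; ReIm; apply is_series_unique, is_series_R_iff;
  intros eps He; destruct (H' eps He) as [N HN]; exists N; intros n Hn.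
  - rewrite <- Re_Csum. eapply Rle_lt_trans; [apply (Re_le_Cmod (Csum a n - l))|auto].
  - rewrite <- Im_Csum. eapply Rle_lt_trans; [apply (Im_le_Cmod (Csum a n - l))|auto].
Qed.

Lemma ex_series_C a : @ex_series C_AbsRing C_NormedModule a -> is_Cseries a (CSeries a).
Proof. intros [l Hl]. rewrite (CSeries_unique a l Hl). exact Hl. Qed.

Lemma is_Cseries_norm_le a l (b : nat -> R) B : is_Cseries a l ->
  (forall n, (Cmod (a n) <= b n)%R) -> is_series b B -> (Cmod l <= B)%R.
Proof.
  intros Ha Hab Hb.
  assert (Hn : forall n, (Cmod (Csum a n) <= sum_n b n)%R).
  { induction n; [rewrite Csum_0, sum_O; auto|].
    rewrite Csum_S, sum_Sn. eapply Rle_trans; [apply Cmod_triangle|].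
    unfold plus; simpl. specialize (Hab (S n)). lra. }
  assert (Hinc : forall n, (sum_n b n <= B)%R).
  { intros n. apply (is_lim_seq_incr_compare (sum_n b)).
    - exact Hb.
    - intros m. rewrite sum_Sn. unfold plus; simpl. pose proof (Cmod_ge_0 (a (S m))).
      specialize (Hab (S m)). lra. }
  apply Rnot_lt_le. intros Hlt.
  destruct (proj1 (is_Cseries_iff a l) Ha (Cmod l - B)%R ltac:(lra)) as [N HN].
  specialize (HN N (le_n N)).
  pose proof (Cmod_triangle_rev l (Csum a N - l)) as T.
  replace (l + (Csum a N - l)) with (Csum a N) in T by ring.
  specialize (Hn N). specialize (Hinc N). lra.
Qed.

Lemma one_sub_exp_neg_pos d : (0 < d)%R -> (0 < 1 - exp (- d))%R.
Proof. intros Hd. assert (exp (- d) < exp 0)%R by (apply exp_increasing; lra). rewrite exp_0 in *; lra. Qed.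

Lemma is_series_exp_geom K d : (0 < d)%R ->
  is_series (fun n => (K * exp (- d * INR n))%R) (K / (1 - exp (- d)))%R.
Proof.
  intros Hd.
  pose proof (one_sub_exp_neg_pos d Hd). pose proof (exp_pos (- d)).
  apply (is_series_ext (fun n => (K * exp (- d) ^ n)%R)).
  { intros n. f_equal. induction n.
    - simpl. rewrite Rmult_0_r, exp_0; auto.
    - rewrite S_INR. simpl. rewrite IHn, <- exp_plus. f_equal; ring. }
  apply (is_series_scal_l (K := R_AbsRing) K (fun n => (exp (- d) ^ n)%R) (/ (1 - exp (- d)))%R).
  apply is_series_geom. rewrite Rabs_pos_eq; lra.
Qed.

Lemma is_Cseries_exp_bound a K d : (0 < d)%R ->
  (forall n, (Cmod (a n) <= K * exp (- d * INR n))%R) ->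
  is_Cseries a (CSeries a) /\ (Cmod (CSeries a) <= K / (1 - exp (- d)))%R.
Proof.
  intros Hd Ha.
  assert (H : is_Cseries a (CSeries a)).
  { apply ex_series_C.
    apply (@ex_series_le C_AbsRing C_CompleteNormedModule) with (b := fun n => (K * exp (- d * INR n))%R).
    - exact Ha.
    - eexists; apply is_series_exp_geom; auto. }
  split; [exact H|]. eapply is_Cseries_norm_le; [exact H|exact Ha|]. apply is_series_exp_geom; auto.
Qed.

Lemma is_Cseries_plus a b l m : is_Cseries a l -> is_Cseries b m ->
  is_Cseries (fun n => a n + b n) (l + m).
Proof. exact (@is_series_plus C_AbsRing C_NormedModule a b l m). Qed.

Lemma is_Cseries_scal (c : C) a l : is_Cseries a l -> is_Cseries (fun n => c * a n) (c * l).
Proof. exact (@is_series_scal C_AbsRing C_NormedModule c a l). Qed.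

Lemma is_Cseries_minus a b l m : is_Cseries a l -> is_Cseries b m ->
  is_Cseries (fun n => a n - b n) (l - m).
Proof. exact (@is_series_minus C_AbsRing C_NormedModule a b l m). Qed.

(* Weierstrass' theorem for exponential sums: the second order Taylor bound of
   [Cexp] is summable. *)
Section ExpSum.
Context (a mu : nat -> C) (z : C) (r K d : R) (Hr : (0 < r)%R) (Hd : (0 < d)%R)
  (Hb : forall n, (Cmod (a n) * (1 + Cmod (mu n)) ^ 2 * exp (Re (mu n * z) + r * Cmod (mu n))
    <= K * exp (- d * INR n))%R).

(** Passing from [z] to [w] raises the real part of the exponent by at most [r |mu n|], which the
    hypothesis contains. The square factor pays for the derivative and for the quadratic
    remainder. *)
Lemma exp_sum_term_bound n w : (Cmod (w - z) <= r)%R ->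
  (Cmod (a n * Cexp (mu n * w)) * (1 + Cmod (mu n)) ^ 2 <= K * exp (- d * INR n))%R.
Proof.
  intros Hw. eapply Rle_trans; [|apply Hb].
  rewrite Cmod_mult, Cmod_Cexp.
  rewrite Rmult_assoc, (Rmult_comm (exp _)), <- Rmult_assoc.
  apply Rmult_le_compat_l.
  { apply Rmult_le_pos; [apply Cmod_ge_0|apply pow2_ge_0]. }
  replace (mu n * w) with (mu n * z + mu n * (w - z)) by ring.
  rewrite Re_plus.
  assert (H : (Re (mu n * (w - z)) <= r * Cmod (mu n))%R).
  { eapply Rle_trans; [apply Rle_abs|]. eapply Rle_trans; [apply Re_le_Cmod|].
    rewrite Cmod_mult, Rmult_comm. apply Rmult_le_compat_r; [apply Cmod_ge_0|auto]. }
  apply exp_le; lra.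
Qed.

Lemma exp_sum_correct w : (Cmod (w - z) <= r)%R ->
  is_Cseries (fun n => a n * Cexp (mu n * w)) (CSeries (fun n => a n * Cexp (mu n * w))).
Proof.
  intros Hw. apply (is_Cseries_exp_bound _ K d Hd). intros n.
  pose proof (exp_sum_term_bound n w Hw). pose proof (Cmod_ge_0 (mu n)).
  pose proof (Cmod_ge_0 (a n * Cexp (mu n * w))). nra.
Qed.

Lemma exp_sum_deriv_correct :
  is_Cseries (fun n => a n * mu n * Cexp (mu n * z)) (CSeries (fun n => a n * mu n * Cexp (mu n * z))).
Proof.
  apply (is_Cseries_exp_bound _ K d Hd). intros n.
  assert (H0 : (Cmod (z - z) <= r)%R) by (rewrite Cmod_minus_diag; lra).
  pose proof (exp_sum_term_bound n z H0).
  replace (a n * mu n * Cexp (mu n * z)) with (a n * Cexp (mu n * z) * mu n) by ring.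
  rewrite Cmod_mult. pose proof (Cmod_ge_0 (mu n)).
  pose proof (Cmod_ge_0 (a n * Cexp (mu n * z))). nra.
Qed.

Lemma exp_sum_Cderiv : Cderiv (fun w => CSeries (fun n => a n * Cexp (mu n * w))) z
  (CSeries (fun n => a n * mu n * Cexp (mu n * z))).
Proof.
  apply Cderiv_iff. intros eps He.
  set (B := (Rabs (5 * (K / (1 - exp (- d)))) + 1)%R).
  assert (HB : (0 < B)%R) by (unfold B; pose proof (Rabs_pos (5 * (K / (1 - exp (- d))))); lra).
  exists (Rmin r (eps / B)). split; [apply Rmin_pos; auto; apply Rdiv_lt_0_compat; auto|].
  intros w Hw.
  destruct (Rmin_Rgt_l _ _ _ Hw) as [Hwr Hwe].
  assert (H0 : (Cmod (z - z) <= r)%R) by (rewrite Cmod_minus_diag; lra).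
  set (h := w - z) in *. pose proof (Cmod_ge_0 h) as Hh0.
  pose proof (is_Cseries_minus _ _ _ _
    (is_Cseries_minus _ _ _ _ (exp_sum_correct w (Rlt_le _ _ Hwr)) (exp_sum_correct z H0))
    (is_Cseries_scal h _ _ exp_sum_deriv_correct)) as HS.
  rewrite (Cmult_comm _ h).
  eapply Rle_trans.
  - eapply (is_Cseries_norm_le _ _ (fun n => (5 * Cmod h ^ 2 * K * exp (- d * INR n))%R)); [exact HS| |apply is_series_exp_geom, Hd].
    intros n. cbv beta.
    replace (a n * Cexp (mu n * w) - a n * Cexp (mu n * z) - h * (a n * mu n * Cexp (mu n * z)))
      with (a n * (Cexp (mu n * z) * (Cexp (mu n * h) - 1 - mu n * h))).
    2:{ replace (mu n * w) with (mu n * z + mu n * h) by (unfold h; ring). rewrite Cexp_plus; ring. }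
    rewrite !Cmod_mult, Cmod_Cexp.
    pose proof (Cexp_taylor (mu n * h)) as T. rewrite Cmod_mult in T.
    pose proof (Hb n) as Hbn. rewrite exp_plus in Hbn.
    pose proof (Cmod_ge_0 (mu n)) as Hm. pose proof (Cmod_ge_0 (a n)) as Han.
    assert (Hexp : (exp (Cmod (mu n) * Cmod h) <= exp (r * Cmod (mu n)))%R).
    { assert (Hle : (Cmod (mu n) * Cmod h <= r * Cmod (mu n))%R) by nra.
      apply exp_le; lra. }
    set (m := Cmod (mu n)) in *. set (t := Cmod h) in *.
    pose proof (exp_pos (Re (mu n * z))) as E1. pose proof (exp_pos (m * t)) as E2.
    set (X := exp (Re (mu n * z))) in *. set (Y := exp (r * m)) in *.
    assert (T2 : (Cmod (Cexp (mu n * h) - 1 - mu n * h) <= 5 * t ^ 2 * ((1 + m) ^ 2 * Y))%R).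
    { eapply Rle_trans; [exact T|].
      replace (5 * (m * t) ^ 2 * exp (m * t))%R with (5 * t ^ 2 * (m ^ 2 * exp (m * t)))%R by ring.
      apply Rmult_le_compat_l; [nra|]. apply Rmult_le_compat; nra. }
    apply Rle_trans with (Cmod (a n) * (X * (5 * t ^ 2 * ((1 + m) ^ 2 * Y))))%R.
    + apply Rmult_le_compat_l; [auto|]. apply Rmult_le_compat_l; lra.
    + replace (Cmod (a n) * (X * (5 * t ^ 2 * ((1 + m) ^ 2 * Y))))%R
        with (5 * t ^ 2 * (Cmod (a n) * (1 + m) ^ 2 * (X * Y)))%R by ring.
      replace (5 * t ^ 2 * K * exp (- d * INR n))%R with (5 * t ^ 2 * (K * exp (- d * INR n)))%R by ring.
      apply Rmult_le_compat_l; [nra|exact Hbn].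
  - replace (5 * Cmod h ^ 2 * K / (1 - exp (- d)))%R
      with (Cmod h * Cmod h * (5 * (K / (1 - exp (- d)))))%R by (unfold Rdiv; ring).
    apply Rle_trans with (Cmod h * Cmod h * B)%R.
    + apply Rmult_le_compat_l; [nra|]. unfold B. pose proof (Rle_abs (5 * (K / (1 - exp (- d))))). lra.
    + apply Rmult_lt_compat_r with (r := B) in Hwe; [|auto].
      replace (eps / B * B)%R with eps in Hwe by (field; lra). nra.
Qed.

End ExpSum.

(** * Expansions in [exp (i pi tau)] and the identity theorem *)

Lemma expipi_plus z w : expipi (z + w) = expipi z * expipi w.
Proof. unfold expipi. rewrite <- Cexp_plus. f_equal; ring. Qed.

Lemma expipi_0 : expipi 0 = 1.
Proof. unfold expipi. rewrite <- Cexp_0. f_equal; ring. Qed.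

Lemma expipi_neq_0 z : expipi z <> 0.
Proof. apply Cexp_neq_0. Qed.

Lemma expipi_opp z : expipi (- z) * expipi z = 1.
Proof. rewrite <- expipi_plus, <- expipi_0. f_equal; ring. Qed.

Lemma expipi_2 : expipi 2 = 1.
Proof. unfold expipi. rewrite <- Cexp_2PI. f_equal; ring. Qed.

Lemma expipi_1 : expipi 1 = - RtoC 1.
Proof. unfold expipi. rewrite <- Cexp_PI. f_equal; ring. Qed.

Lemma Cmod_expipi z : Cmod (expipi z) = exp (- (PI * Im z)).
Proof. unfold expipi. rewrite Cmod_Cexp. ReIm. f_equal; ring. Qed.

Lemma Cderiv_expipi f (z a : C) : Cderiv f z a ->
  Cderiv (fun w => expipi (f w)) z (expipi (f z) * (Ci * PI * a)).
Proof. intros H. apply Cderiv_Cexp, Cderiv_scal, H. Qed.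

Definition has_limit_at_ioo (F : C -> C) (l : C) : Prop :=
  forall eps : R, (0 < eps)%R -> exists Y : R, forall tau, HH tau ->
    (Y < Im tau)%R -> (Cmod (F tau - l) < eps)%R.

Definition periodic2_on_HH (F : C -> C) : Prop := forall tau, HH tau -> F (tau + 2) = F tau.

(** The Fourier lemmas ask for periodicity at every complex point, while [F] is periodic only on
    [HH]; extension by 0 reconciles the two. *)
Definition on_HH (F : C -> C) (z : C) : C := if Rlt_dec 0 (Im z) then F z else 0.

Lemma on_HH_eq F z : HH z -> on_HH F z = F z.
Proof. intros H; unfold on_HH; destruct Rlt_dec; easy. Qed.

Lemma Cderiv_ext_HH F G tau l : HH tau -> (forall w, HH w -> F w = G w) ->
  Cderiv F tau l -> Cderiv G tau l.
Proof.
  intros H E. apply Cderiv_ext_loc with (Im tau); [exact H|].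
  intros w Hw. apply E. unfold HH.
  pose proof (Im_le_Cmod (w - tau)) as HI. rewrite Im_minus in HI.
  pose proof (Rle_abs (- (Im w - Im tau))) as HA. rewrite Rabs_Ropp in HA. lra.
Qed.

Section QExpansion.
Context (F : C -> C) (HF : holomorphic_on_HH F) (Hper : periodic2_on_HH F).

Definition period1_lift (z : C) : C := on_HH F (2 * z).

(** The height 1 is arbitrary; [qcoef_lift_const] moves it to any positive height. *)
Definition qcoef (n : nat) : C := fcoef period1_lift 1 (Z.of_nat n).

Lemma period1_lift_period z : period1_lift (z + 1) = period1_lift z.
Proof.
  unfold period1_lift, on_HH.
  replace (2 * (z + 1)) with (2 * z + 2) by ring.
  rewrite Im_plus. replace (Im 2) with 0%R by reflexivity. rewrite Rplus_0_r.
  destruct Rlt_dec; auto.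
Qed.

Lemma period1_lift_holo : strip_holo (Rlt 0) period1_lift.
Proof.
  intros z Hz. unfold period1_lift.
  assert (H2 : HH (2 * z)) by (unfold HH; ReIm; lra).
  destruct (HF _ H2) as [l Hl]. exists (l * (2 * 1)).
  apply (Cderiv_comp (on_HH F) (fun w => 2 * w)).
  - apply (Cderiv_ext_HH F); auto. intros w Hw; symmetry; apply on_HH_eq; auto.
  - apply Cderiv_scal, Cderiv_id.
Qed.

Lemma Rlt_0_convex : Rconvex (Rlt 0).
Proof. intros a b y Ha Hb Hy; lra. Qed.

Lemma qcoef_lift_const y k : (0 < y)%R -> fcoef period1_lift y k = fcoef period1_lift 1 k.
Proof.
  intros Hy. apply (fcoef_const (Rlt 0));
  auto using Rlt_0_convex, period1_lift_holo, period1_lift_period. lra.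
Qed.

Lemma ek_half (k : Z) tau : ek k (tau / 2) = expipi (IZR k * tau).
Proof.
  unfold ek, expipi. f_equal. rewrite !RtoC_mult. field.
Qed.

(** Coefficients of negative index, estimated at ever larger heights, are zero because [F] is
    bounded there. The negative half sum is then 0, which forces [q = 0] in [Laurent]. *)
Theorem q_expansion Y M : (forall tau, HH tau -> (Y < Im tau)%R -> (Cmod (F tau) <= M)%R) ->
  forall tau, HH tau -> is_Cseries (fun n => qcoef n * expipi (INR n * tau)) (F tau).
Proof.
  intros HM.
  assert (Hneg : forall n, fcoef period1_lift 1 (- Z.of_nat (S n)) = 0).
  { intros n. apply Cmod_eq0_small. intros eps He.
    (* High enough for the bound on [F] to apply, and for [2 |M| exp (- u) <= 2 |M| / y <= eps],
       where [u >= y]. *)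
    set (y := (Rabs Y + 1 + (2 * Rabs M) / eps)%R).
    pose proof (Rabs_pos Y). pose proof (Rabs_pos M). pose proof (Rle_abs Y). pose proof (Rle_abs M).
    assert (HQ : (0 <= 2 * Rabs M / eps)%R) by (apply Rdiv_le_0_compat; lra).
    assert (Hy : (0 < y)%R) by (unfold y; lra).
    rewrite <- (qcoef_lift_const y) by auto.
    eapply Rle_trans.
    - apply fcoef_bound with (M := Rabs M).
      + intros x. apply (strip_rcont (Rlt 0)); auto using period1_lift_holo.
      + intros x _. unfold period1_lift. rewrite on_HH_eq by (unfold HH; ReIm; lra).
        eapply Rle_trans; [apply HM; unfold HH; ReIm; unfold y in *; lra|auto].
    - set (u := (2 * PI * INR (S n) * y)%R).
      replace (2 * PI * IZR (- Z.of_nat (S n)) * y)%R with (- u)%R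
        by (unfold u; rewrite opp_IZR, <- INR_IZR_INZ; ring).
      assert (Hu : (y <= u)%R).
      { unfold u. pose proof PI_4. pose proof (PI2_1). unfold PI2 in *.
        pose proof (pos_INR n). rewrite S_INR.
        assert (1 <= 2 * PI * (INR n + 1))%R by nra. nra. }
      assert (Hx : (u <= exp u)%R) by (pose proof (exp_ineq1_le u); lra).
      assert (Hup : (0 < u)%R) by lra.
      rewrite exp_Ropp.
      apply Rle_trans with (2 * Rabs M * / y)%R.
      + apply Rmult_le_compat_l; [lra|]. apply Rinv_le_contravar; lra.
      + apply Rmult_le_reg_r with y; [auto|].
        replace (2 * Rabs M * / y * y)%R with (2 * Rabs M)%R by (field; lra).
        unfold y. rewrite Rmult_plus_distr_l.
        replace (eps * (2 * Rabs M / eps))%R with (2 * Rabs M)%R by (field; lra). nra. }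
  intros tau Ht.
  assert (Hz : (0 < Im (tau / 2))%R).
  { replace (tau / 2) with (RtoC (/ 2) * tau) by (rewrite RtoC_inv by lra; field; intros E; apply RtoC_inj in E; lra).
    unfold HH in Ht. ReIm. lra. }
  destruct (Laurent (Rlt 0) period1_lift (tau / 2)) as [q [H1 H2]];
    auto using period1_lift_holo, period1_lift_period.
  assert (Hq : - q = 0).
  { eapply is_Cseries_unique; [exact H2|].
    apply is_Cseries_iff. intros eps He. exists O. intros n _.
    replace (Csum _ n) with (RtoC 0).
    - rewrite Cmod_minus_diag; auto.
    - induction n; rewrite ?Csum_0, ?Csum_S, <- ?IHn; rewrite qcoef_lift_const, Hneg by auto; ring. }
  replace (F tau) with (period1_lift (tau / 2) + q).
  - eapply is_Cseries_ext; [|exact H1]. intros n. unfold qcoef.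
    rewrite qcoef_lift_const by auto. rewrite ek_half, <- INR_IZR_INZ. reflexivity.
  - replace q with (- - q) by ring. rewrite Hq. unfold period1_lift.
    replace (2 * (tau / 2)) with tau by (field; intros E; apply RtoC_inj in E; lra).
    rewrite on_HH_eq by auto. ring.
Qed.

(** The coefficients may be computed at a height where [F] is zero. *)
Lemma qcoef_vanish Y : (forall tau, HH tau -> (Y < Im tau)%R -> F tau = 0) ->
  forall n, qcoef n = 0.
Proof.
  intros H n. unfold qcoef. pose proof (Rabs_pos Y). pose proof (Rle_abs Y).
  rewrite <- (qcoef_lift_const (Rabs Y + 1)) by lra.
  unfold fcoef, period_int. rewrite (CInt_ext _ (fun _ => 0)); [rewrite CInt_const; ring|lra|].
  intros t _. unfold period1_lift. rewrite on_HH_eq by (unfold HH; ReIm; lra).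
  rewrite H; [ring|unfold HH; ReIm; lra..].
Qed.

End QExpansion.

Lemma holo_comp F G : holomorphic_on_HH F -> holomorphic_on_HH G -> (forall tau, HH tau -> HH (G tau)) ->
  holomorphic_on_HH (fun tau => F (G tau)).
Proof.
  intros HF HG HGH tau Ht. destruct (HG tau Ht) as [b Hb]. destruct (HF (G tau) (HGH tau Ht)) as [a Ha].
  exists (a * b). apply Cderiv_comp; auto.
Qed.

Lemma RtoC_neq (x y : R) : x <> y -> RtoC x <> RtoC y.
Proof. intros H E; apply H, RtoC_inj, E. Qed.

Lemma Cinv_neq_0 (z : C) : z <> 0 -> / z <> 0.
Proof.
  intros H E. apply C1_nz. rewrite <- (Cinv_r z H), E. ring.
Qed.

Lemma Im_div (z w : C) : w <> 0 -> Im (z / w) = ((Im z * Re w - Re z * Im w) / Cmod w ^ 2)%R.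
Proof.
  intros Hw. rewrite Cmod2_alt.
  destruct z as [a b], w as [c d]. unfold Cdiv, Cinv. ReIm. simpl. field.
  intros E. apply Hw. apply C_eq; simpl; nra.
Qed.

(* Proved by transporting [D] to the unit disc with a Cayley transform centred
   at a point high in the half plane, where all Taylor coefficients vanish. *)
Theorem identity_HH D y0 : holomorphic_on_HH D ->
  (forall tau, HH tau -> (y0 < Im tau)%R -> D tau = 0) -> forall tau, HH tau -> D tau = 0.
Proof.
  intros HD H0 tau Ht.
  (* The centre [i Y] lies at least 1 above [y0], so points closer to it than 1 are still in the
     region where [D] vanishes. *)
  set (Y := (Rabs y0 + 1)%R).
  assert (HY : (1 <= Y)%R) by (unfold Y; pose proof (Rabs_pos y0); lra).
  assert (HY0 : (y0 + 1 <= Y)%R) by (unfold Y; pose proof (Rle_abs y0); lra).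
  set (iY := Ci * Y).
  set (cay := fun w : C => iY * (1 + w) / (1 - w)).
  assert (Hden : forall w, (Cmod w < 1)%R -> 1 - w <> 0).
  { intros w Hw E. apply Ceq_minus in E. rewrite <- E, Cmod_1 in Hw. lra. }
  assert (Hcay : forall w, (Cmod w < 1)%R -> HH (cay w)).
  { intros w Hw. unfold HH, cay. rewrite Im_div by (apply Hden; auto).
    apply Rdiv_lt_0_compat.
    - assert (Hm : (Cmod w ^ 2 < 1)%R) by (pose proof (Cmod_ge_0 w); nra).
      rewrite Cmod2_alt in Hm. unfold iY; ReIm. nra.
    - apply pow_lt, Cmod_gt_0, Hden; auto. }
  assert (Hq : forall z, HH z -> (Cmod (expipi z) < 1)%R).
  { intros z Hz. rewrite Cmod_expipi, <- exp_0. apply exp_increasing.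
    pose proof PI_RGT_0. unfold HH in Hz. nra. }
  (* A Taylor series on the disc becomes a q-expansion under [w = exp (i pi z)], so the expansion
     theorem for periodic functions applies. *)
  set (F := fun z => D (cay (expipi z))).
  assert (HF : holomorphic_on_HH F).
  { intros z Hz. destruct (HD (cay (expipi z)) (Hcay _ (Hq _ Hz))) as [l Hl].
    eexists. apply (Cderiv_comp D (fun z => cay (expipi z))); [exact Hl|].
    unfold cay. apply Cderiv_div; [| |apply Hden, Hq, Hz].
    - apply Cderiv_scal, Cderiv_plus; [apply Cderiv_const|apply Cderiv_expipi, Cderiv_id].
    - apply Cderiv_minus; [apply Cderiv_const|apply Cderiv_expipi, Cderiv_id]. }
  assert (Hper : periodic2_on_HH F).
  { intros z _. unfold F. rewrite expipi_plus, expipi_2, Cmult_1_r; reflexivity. }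
  assert (HC0 : Ccont cay 0).
  { eapply Cderiv_Ccont. unfold cay. apply Cderiv_div.
    - apply Cderiv_scal, Cderiv_plus; [apply Cderiv_const|apply Cderiv_id].
    - apply Cderiv_minus; [apply Cderiv_const|apply Cderiv_id].
    - apply Hden. rewrite Cmod_0; lra. }
  destruct (HC0 1%R ltac:(lra)) as [d [Hd Hc]].
  assert (Hzero : forall z, HH z -> (/ d < Im z)%R -> F z = 0).
  { intros z Hz Hzd. unfold F. apply H0; [apply Hcay, Hq, Hz|].
    assert (Hs : (Cmod (expipi z - 0) < d)%R).
    { replace (expipi z - 0) with (expipi z) by ring. rewrite Cmod_expipi.
      assert (Hid : (0 < / d)%R) by (apply Rinv_0_lt_compat; auto).
      rewrite exp_Ropp. rewrite <- (Rinv_inv d). apply Rinv_lt_contravar.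
      - apply Rmult_lt_0_compat; [auto|apply exp_pos].
      - pose proof (exp_ineq1_le (PI * Im z)). pose proof PI2_1. unfold PI2 in *. nra. }
    specialize (Hc _ Hs).
    pose proof (Im_le_Cmod (cay (expipi z) - cay 0)) as HI. rewrite Im_minus in HI.
    assert (E0 : Im (cay 0) = Y).
    { unfold cay. replace (iY * (1 + 0) / (1 - 0)) with iY by (field; intros E; apply RtoC_inj in E; lra).
      unfold iY; ReIm; ring. }
    rewrite E0 in HI. pose proof (Rle_abs (- (Im (cay (expipi z)) - Y))) as HA.
    rewrite Rabs_Ropp in HA. lra. }
  assert (HFz : forall z, HH z -> F z = 0).
  { intros z Hz. eapply is_Cseries_unique.
    - apply (q_expansion F HF Hper (/ d) 0); [|exact Hz].
      intros t Ht' Hyt. rewrite Hzero by auto. rewrite Cmod_0; lra.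
    - eapply is_Cseries_ext; [|apply is_Cseries_0]. intros n.
      rewrite (qcoef_vanish F HF Hper (/ d)) by auto. cbv beta; ring. }
  set (w := (tau - iY) / (tau + iY)).
  assert (Hti : tau + iY <> 0).
  { intros E. apply (f_equal Im) in E. unfold iY in E. revert E. ReIm. unfold HH in Ht. intros; nra. }
  assert (Hw1 : 1 - w <> 0).
  { unfold w. replace (1 - (tau - iY) / (tau + iY)) with (2 * iY / (tau + iY)) by (field; auto).
    apply Cmult_neq_0; [apply Cmult_neq_0|].
    - apply RtoC_neq; lra.
    - unfold iY. apply Cmult_neq_0; [apply Ci_nz|apply RtoC_neq; lra].
    - apply Cinv_neq_0; auto. }
  assert (Hcw : cay w = tau).
  { unfold cay, w. field. repeat split; auto.
    replace (tau + iY - (tau - iY)) with ((1 - w) * (tau + iY)) by (unfold w; field; auto).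
    apply Cmult_neq_0; auto. }
  assert (Hwm : (Cmod w < 1)%R).
  { unfold w. rewrite Cmod_div by auto.
    pose proof (proj1 (Cmod_gt_0 _) Hti) as Hp.
    apply Rmult_lt_reg_r with (Cmod (tau + iY)); [auto|].
    replace (Cmod (tau - iY) / Cmod (tau + iY) * Cmod (tau + iY))%R with (Cmod (tau - iY)) by (field; lra).
    rewrite Rmult_1_l. apply Rsqr_incrst_0; [|apply Cmod_ge_0|lra].
    rewrite !Rsqr_pow2, !Cmod2_alt. unfold iY, HH in *; ReIm. nra. }
  (* The centre [w = 0] is not of the form [exp (i pi z)]; it corresponds to [tau = i Y], which is
     above [y0]. *)
  destruct (Req_dec (Cmod w) 0) as [E|E].
  - apply Cmod_eq_0 in E. rewrite <- Hcw, E. apply H0.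
    + apply Hcay. rewrite Cmod_0; lra.
    + unfold cay. replace (iY * (1 + 0) / (1 - 0)) with iY by (field; apply RtoC_neq; lra).
      unfold iY; ReIm; lra.
  - destruct (Cexp_surj w) as [z0 Hz0].
    { intros E'; apply E; rewrite E'; apply Cmod_0. }
    set (z := z0 / (Ci * PI)).
    assert (HPI : RtoC PI <> 0) by (apply RtoC_neq, PI_neq0).
    assert (Ez : expipi z = w).
    { unfold expipi, z. rewrite <- Hz0. f_equal. field. split; auto. apply Ci_nz. }
    assert (Hz : HH z).
    { rewrite <- Ez, Cmod_expipi, <- exp_0 in Hwm. apply exp_lt_inv in Hwm.
      unfold HH. pose proof PI_RGT_0. nra. }
    rewrite <- Hcw, <- Ez. apply (HFz z Hz).
Qed.

(** * Limits at [i oo] *)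

Lemma ioo_limit_const (c : C) : has_limit_at_ioo (fun _ => c) c.
Proof.
  intros eps He. exists 0%R. intros tau _ _.
  rewrite Cmod_minus_diag; auto.
Qed.

Lemma ioo_limit_ext F G l : (forall tau, HH tau -> F tau = G tau) ->
  has_limit_at_ioo F l -> has_limit_at_ioo G l.
Proof.
  intros E H eps He. destruct (H eps He) as [Y HY]. exists Y.
  intros tau Ht HtY. rewrite <- E; auto.
Qed.

Lemma ioo_limit_cont f F l : Ccont f l -> has_limit_at_ioo F l ->
  has_limit_at_ioo (fun tau => f (F tau)) (f l).
Proof.
  intros Hf HF eps He. destruct (Hf eps He) as [d [Hd D]].
  destruct (HF d Hd) as [Y HY]. exists Y. auto.
Qed.

Lemma ioo_limit_plus F G l m : has_limit_at_ioo F l -> has_limit_at_ioo G m ->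
  has_limit_at_ioo (fun tau => F tau + G tau) (l + m).
Proof.
  intros HF HG eps He.
  destruct (HF (eps / 2)%R ltac:(lra)) as [Y1 H1]. destruct (HG (eps / 2)%R ltac:(lra)) as [Y2 H2].
  exists (Rmax Y1 Y2). intros tau Ht HY.
  pose proof (Rmax_l Y1 Y2). pose proof (Rmax_r Y1 Y2).
  specialize (H1 tau Ht ltac:(lra)). specialize (H2 tau Ht ltac:(lra)).
  replace (F tau + G tau - (l + m)) with (F tau - l + (G tau - m)) by ring.
  eapply Rle_lt_trans; [apply Cmod_triangle|lra].
Qed.

Lemma ioo_limit_scal (c : C) F l : has_limit_at_ioo F l -> has_limit_at_ioo (fun tau => c * F tau) (c * l).
Proof.
  intros H. apply (ioo_limit_cont (fun w => c * w)); auto.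
  eapply Cderiv_Ccont, Cderiv_scal, Cderiv_id.
Qed.

Lemma ioo_limit_minus F G l m : has_limit_at_ioo F l -> has_limit_at_ioo G m ->
  has_limit_at_ioo (fun tau => F tau - G tau) (l - m).
Proof.
  intros HF HG. replace (l - m) with (l + - (1) * m) by ring.
  apply ioo_limit_ext with (fun tau => F tau + - (1) * G tau); [intros; ring|].
  apply ioo_limit_plus; auto using ioo_limit_scal.
Qed.

Lemma ioo_limit_mult_0 F G : has_limit_at_ioo F 0 -> has_limit_at_ioo G 0 ->
  has_limit_at_ioo (fun tau => F tau * G tau) 0.
Proof.
  intros HF HG eps He.
  destruct (HF 1%R ltac:(lra)) as [Y1 H1]. destruct (HG eps He) as [Y2 H2].
  exists (Rmax Y1 Y2). intros tau Ht HY.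
  pose proof (Rmax_l Y1 Y2). pose proof (Rmax_r Y1 Y2).
  specialize (H1 tau Ht ltac:(lra)). specialize (H2 tau Ht ltac:(lra)).
  replace (F tau - 0) with (F tau) in H1 by ring. replace (G tau - 0) with (G tau) in H2 by ring.
  replace (F tau * G tau - 0) with (F tau * G tau) by ring. rewrite Cmod_mult.
  pose proof (Cmod_ge_0 (F tau)). pose proof (Cmod_ge_0 (G tau)). nra.
Qed.

Lemma ioo_limit_mult F G l m : has_limit_at_ioo F l -> has_limit_at_ioo G m ->
  has_limit_at_ioo (fun tau => F tau * G tau) (l * m).
Proof.
  intros HF HG.
  assert (HF0 : has_limit_at_ioo (fun tau => F tau - l) 0).
  { replace (RtoC 0) with (l - l) by ring. apply ioo_limit_minus; auto using ioo_limit_const. }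
  assert (HG0 : has_limit_at_ioo (fun tau => G tau - m) 0).
  { replace (RtoC 0) with (m - m) by ring. apply ioo_limit_minus; auto using ioo_limit_const. }
  replace (l * m) with (0 + (l * m + (m * 0 + l * 0))) by ring.
  apply ioo_limit_ext with (fun tau => (F tau - l) * (G tau - m) + (l * m + (m * (F tau - l) + l * (G tau - m)))).
  { intros; ring. }
  apply ioo_limit_plus; [apply ioo_limit_mult_0; auto|].
  apply ioo_limit_plus; [apply ioo_limit_const|].
  apply ioo_limit_plus; apply ioo_limit_scal; auto.
Qed.

Lemma ioo_limit_div F G l m : has_limit_at_ioo F l -> has_limit_at_ioo G m -> m <> 0 ->
  has_limit_at_ioo (fun tau => F tau / G tau) (l / m).
Proof.
  intros HF HG Hm. apply ioo_limit_mult; auto.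
  apply (ioo_limit_cont Cinv); auto. eapply Cderiv_Ccont, Cderiv_inv_id, Hm.
Qed.

Lemma ioo_limit_pow F l n : has_limit_at_ioo F l -> has_limit_at_ioo (fun tau => F tau ^ n) (l ^ n).
Proof.
  intros H. induction n; [apply (ioo_limit_const 1)|].
  apply ioo_limit_mult; auto.
Qed.

Lemma ioo_limit_exp F l : has_limit_at_ioo F l -> has_limit_at_ioo (fun tau => Cexp (F tau)) (Cexp l).
Proof. intros H; apply ioo_limit_cont; auto. eapply Cderiv_Ccont, Cderiv_exp. Qed.

Lemma ioo_limit_unique F l m : has_limit_at_ioo F l -> has_limit_at_ioo F m -> l = m.
Proof.
  intros H1 H2. apply Ceq_minus, Cmod_eq0_small. intros eps He.
  destruct (H1 (eps / 2)%R ltac:(lra)) as [Y1 H1']. destruct (H2 (eps / 2)%R ltac:(lra)) as [Y2 H2'].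
  pose proof (Rabs_pos Y1). pose proof (Rabs_pos Y2). pose proof (Rle_abs Y1). pose proof (Rle_abs Y2).
  set (tau := (0, Rabs Y1 + Rabs Y2 + 1)%R : C).
  assert (Ht : HH tau) by (unfold HH, tau; ReIm; lra).
  specialize (H1' tau Ht ltac:(unfold tau; ReIm; lra)).
  specialize (H2' tau Ht ltac:(unfold tau; ReIm; lra)).
  replace (l - m) with (F tau - m - (F tau - l)) by ring.
  eapply Rle_trans; [apply Cmod_triangle_minus|lra].
Qed.

(** Beyond the first term, a part [exp (- n)] of the decay makes the tail summable, and the
    remaining factor [exp (- (y - 1))] tends to 0. *)
Lemma series_limit_at_ioo (u : C -> nat -> C) (M Y0 : R) l :
  (forall tau n, HH tau -> (Y0 < Im tau)%R -> (Cmod (u tau n) <= M * exp (- (Im tau * INR n)))%R) ->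
  has_limit_at_ioo (fun tau => u tau O) l -> has_limit_at_ioo (fun tau => CSeries (u tau)) l.
Proof.
  intros Hu H0.
  replace l with (l + 0) by ring.
  apply ioo_limit_ext with (fun tau => u tau O + (CSeries (u tau) - u tau O)); [intros; ring|].
  apply ioo_limit_plus; [exact H0|].
  set (G := (Rabs M * / (1 - exp (- (1))))%R). pose proof (Rabs_pos M). pose proof (Rle_abs M).
  assert (HG : (0 <= G)%R).
  { apply Rmult_le_pos; [auto|]. left; apply Rinv_0_lt_compat, one_sub_exp_neg_pos; lra. }
  intros eps He. exists (2 + Rabs Y0 + G / eps)%R. intros tau Ht Hy.
  pose proof (Rabs_pos Y0). pose proof (Rle_abs Y0).
  assert (HQ : (0 <= G / eps)%R) by (apply Rdiv_le_0_compat; lra).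
  specialize (fun n => Hu tau n Ht ltac:(lra)). set (y := Im tau) in *.
  destruct (is_Cseries_exp_bound (u tau) M y ltac:(lra)) as [HS _].
  { intros n. rewrite Ropp_mult_distr_l_reverse. apply Hu. }
  assert (HB : (Cmod (CSeries (u tau) - u tau O) <= Rabs M * exp (- (y - 1)) / (1 - exp (- (1))))%R).
  { eapply is_Cseries_norm_le; [exact (is_Cseries_tail _ _ HS)| |apply is_series_exp_geom; lra].
    intros n. cbv beta. eapply Rle_trans; [apply Hu|].
    rewrite Rmult_assoc, <- exp_plus, S_INR. pose proof (pos_INR n).
    apply Rle_trans with (Rabs M * exp (- (y * (INR n + 1))))%R.
    - apply Rmult_le_compat_r; [left; apply exp_pos|auto].
    - apply Rmult_le_compat_l; [auto|]. apply exp_le. nra. }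
  replace (CSeries (u tau) - u tau O - 0) with (CSeries (u tau) - u tau O) by ring.
  eapply Rle_lt_trans; [exact HB|]. rewrite exp_Ropp.
  replace (Rabs M * / exp (y - 1) / (1 - exp (- (1))))%R with (/ exp (y - 1) * G)%R by (unfold G, Rdiv; ring).
  pose proof (exp_ineq1_le (y - 1)). pose proof (exp_pos (y - 1)) as Hp.
  apply Rmult_lt_reg_r with (exp (y - 1)); [auto|].
  replace (/ exp (y - 1) * G * exp (y - 1))%R with G by (field; lra).
  assert (Hlt : (G / eps < exp (y - 1))%R) by lra.
  apply Rmult_lt_compat_l with (r := eps) in Hlt; [|auto].
  replace (eps * (G / eps))%R with G in Hlt by (field; lra). lra.
Qed.

(** * Power series in [exp (i pi tau)] with subexponential coefficients *)

Definition subexp (c : nat -> C) : Prop := forall eps : R, (0 < eps)%R ->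
  exists M : R, forall n : nat, (Cmod (c n) <= M * exp (eps * INR n))%R.

Definition qfull (c : nat -> C) (tau : C) : C := CSeries (fun n => c n * expipi (INR n * tau)).

(** [subexp] bounds the sequence from index 0 on, so that no threshold is carried through the
    estimates. *)
Lemma subexp_subexponential c : subexp c -> subexponential c.
Proof. intros H eps He. destruct (H eps He) as [M HM]. exists M, O. auto. Qed.

(** Absorbs the square factor of the exponential sum bounds in an arbitrarily slow exponential. *)
Lemma sq_le_exp (d s : R) : (0 < d)%R -> (0 <= s)%R ->
  ((1 + s) ^ 2 <= (1 + 2 / d) ^ 2 * exp (d * s))%R.
Proof.
  intros Hd Hs.
  assert (H1 : (1 + s <= (1 + 2 / d) * exp (d / 2 * s))%R).
  { pose proof (exp_ineq1_le (d / 2 * s)) as E.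
    assert (Hd2 : (0 < 2 / d)%R) by (apply Rdiv_lt_0_compat; lra).
    apply Rle_trans with ((1 + 2 / d) * (1 + d / 2 * s))%R.
    - replace ((1 + 2 / d) * (1 + d / 2 * s))%R with (1 + s + (2 / d + d / 2 * s))%R by (field; lra).
      nra.
    - apply Rmult_le_compat_l; lra. }
  replace (exp (d * s)) with (exp (d / 2 * s) * exp (d / 2 * s))%R
    by (rewrite <- exp_plus; f_equal; field).
  replace ((1 + 2 / d) ^ 2 * (exp (d / 2 * s) * exp (d / 2 * s)))%R
    with (((1 + 2 / d) * exp (d / 2 * s)) ^ 2)%R by ring.
  apply pow_incr; lra.
Qed.

Definition qfreq (n : nat) : C := Ci * PI * INR n.

Lemma Cmod_qfreq n : Cmod (qfreq n) = (PI * INR n)%R.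
Proof.
  unfold qfreq. rewrite !Cmod_mult, Cmod_Ci, !Cmod_R, !Rabs_pos_eq; [ring|apply pos_INR|].
  pose proof PI_RGT_0; lra.
Qed.

Lemma Cexp_qfreq n tau : Cexp (qfreq n * tau) = expipi (INR n * tau).
Proof. unfold expipi, qfreq. f_equal; ring. Qed.

Lemma CSeries_ext a b : (forall n, a n = b n) -> CSeries a = CSeries b.
Proof. intros E; unfold CSeries; f_equal; apply Series_ext; intros n; rewrite E; reflexivity. Qed.

Section QFull.
Context (c : nat -> C) (Hc : subexp c).

(** The decay [exp (- pi n Im tau)] is split in four: one quarter each for the growth of [c n], the
    square factor and the radius [Im tau / 4]; the last quarter remains as decay. *)
Lemma subexp_exp_sum tau : HH tau -> exists K : R, forall n,
  (Cmod (c n) * (1 + Cmod (qfreq n)) ^ 2 * exp (Re (qfreq n * tau) + Im tau / 4 * Cmod (qfreq n))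
    <= K * exp (- (PI * Im tau / 4) * INR n))%R.
Proof.
  intros Ht. unfold HH in Ht. set (y := Im tau) in *. pose proof PI_RGT_0 as HPI.
  destruct (Hc (PI * y / 4)%R ltac:(nra)) as [M HM].
  exists (M * (1 + 2 / (y / 4)) ^ 2)%R. intros n.
  rewrite Cmod_qfreq. set (s := (PI * INR n)%R).
  assert (Hs : (0 <= s)%R) by (unfold s; pose proof (pos_INR n); nra).
  replace (Re (qfreq n * tau)) with (- s * y)%R by (unfold qfreq, s, y; ReIm; ring).
  pose proof (sq_le_exp (y / 4) s ltac:(lra) Hs) as Q. specialize (HM n).
  replace (PI * y / 4 * INR n)%R with (y / 4 * s)%R in HM by (unfold s; field).
  replace (- (PI * y / 4) * INR n)%R with (y / 4 * s + y / 4 * s + (- s * y + y / 4 * s))%R by (unfold s; field).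
  rewrite !(exp_plus (y / 4 * s + y / 4 * s)), (exp_plus (y / 4 * s) (y / 4 * s)).
  pose proof (exp_pos (- s * y + y / 4 * s)).
  rewrite <- Rmult_assoc. apply Rmult_le_compat_r; [lra|].
  replace (M * (1 + 2 / (y / 4)) ^ 2 * (exp (y / 4 * s) * exp (y / 4 * s)))%R
    with (M * exp (y / 4 * s) * ((1 + 2 / (y / 4)) ^ 2 * exp (y / 4 * s)))%R by ring.
  apply Rmult_le_compat; auto. apply Cmod_ge_0. apply pow2_ge_0.
Qed.

Lemma qfull_correct tau : HH tau -> is_Cseries (fun n => c n * expipi (INR n * tau)) (qfull c tau).
Proof.
  intros Ht. destruct (subexp_exp_sum tau Ht) as [K HK]. unfold HH in Ht. pose proof PI_RGT_0.
  assert (H0 : (Cmod (tau - tau) <= Im tau / 4)%R) by (rewrite Cmod_minus_diag; lra).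
  pose proof (exp_sum_correct c qfreq tau (Im tau / 4) K (PI * Im tau / 4) ltac:(nra) HK tau H0) as H1.
  unfold qfull. rewrite (CSeries_ext _ (fun n => c n * Cexp (qfreq n * tau))) by (intros; rewrite Cexp_qfreq; auto).
  eapply is_Cseries_ext; [|exact H1]. intros n; cbv beta; rewrite Cexp_qfreq; auto.
Qed.

Lemma Cderiv_qfull tau : HH tau -> Cderiv (qfull c) tau (qfull (fun n => c n * qfreq n) tau).
Proof.
  intros Ht. destruct (subexp_exp_sum tau Ht) as [K HK]. unfold HH in Ht. pose proof PI_RGT_0.
  pose proof (exp_sum_Cderiv c qfreq tau (Im tau / 4) K (PI * Im tau / 4) ltac:(lra) ltac:(nra) HK) as H1.
  unfold qfull. rewrite (CSeries_ext _ (fun n => c n * qfreq n * Cexp (qfreq n * tau))) by (intros; rewrite Cexp_qfreq; auto).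
  eapply Cderiv_ext; [|exact H1]. intros w; cbv beta. apply CSeries_ext; intros; rewrite Cexp_qfreq; auto.
Qed.

Lemma qfull_holo : holomorphic_on_HH (qfull c).
Proof. intros tau Ht; eexists; apply Cderiv_qfull; auto. Qed.

Lemma subexp_deriv : subexp (fun n => c n * qfreq n).
Proof.
  intros eps He. destruct (Hc (eps / 2)%R ltac:(lra)) as [M HM]. pose proof PI_RGT_0 as HPI.
  exists (M * (1 + 2 / (eps / 2 / PI)) ^ 2)%R. intros n. specialize (HM n).
  rewrite Cmod_mult, Cmod_qfreq.
  assert (Hs : (0 <= PI * INR n)%R) by (pose proof (pos_INR n); nra).
  pose proof (sq_le_exp (eps / 2 / PI) (PI * INR n) ltac:(apply Rdiv_lt_0_compat; lra) Hs) as Q.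
  replace (eps / 2 / PI * (PI * INR n))%R with (eps / 2 * INR n)%R in Q by (field; lra).
  replace (eps * INR n)%R with (eps / 2 * INR n + eps / 2 * INR n)%R by field.
  rewrite exp_plus.
  replace (M * (1 + 2 / (eps / 2 / PI)) ^ 2 * (exp (eps / 2 * INR n) * exp (eps / 2 * INR n)))%R
    with (M * exp (eps / 2 * INR n) * ((1 + 2 / (eps / 2 / PI)) ^ 2 * exp (eps / 2 * INR n)))%R by ring.
  apply Rmult_le_compat; auto; [apply Cmod_ge_0|]. nra.
Qed.

Lemma qfull_periodic : periodic2_on_HH (qfull c).
Proof.
  intros tau _. unfold qfull. apply CSeries_ext. intros n. f_equal.
  rewrite Cmult_plus_distr_l, expipi_plus.
  replace (expipi (INR n * 2)) with (RtoC 1); [ring|].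
  symmetry. transitivity (expipi 2 ^ n).
  - unfold expipi. rewrite <- Cexp_INR. f_equal; ring.
  - rewrite expipi_2; apply Cpow_1_l.
Qed.

Lemma qfull_limit : has_limit_at_ioo (qfull c) (c O).
Proof.
  destruct (Hc 1%R ltac:(lra)) as [M HM].
  apply (series_limit_at_ioo (fun tau n => c n * expipi (INR n * tau)) M 1).
  - intros tau n Ht Hy. rewrite Cmod_mult, Cmod_expipi.
    replace (Im (INR n * tau)) with (INR n * Im tau)%R by (ReIm; ring).
    eapply Rle_trans; [apply Rmult_le_compat_r; [left; apply exp_pos|apply HM]|].
    rewrite Rmult_assoc, <- exp_plus. apply Rmult_le_compat_l.
    + specialize (HM O). simpl in HM. rewrite Rmult_0_r, exp_0 in HM. pose proof (Cmod_ge_0 (c O)); lra.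
    + apply exp_le. pose proof PI2_1 as HPI. unfold PI2 in HPI. pose proof (pos_INR n).
      assert (0 <= INR n * Im tau)%R by (apply Rmult_le_pos; lra).
      assert (2 * (INR n * Im tau) <= PI * (INR n * Im tau))%R by (apply Rmult_le_compat_r; lra). nra.
  - eapply ioo_limit_ext; [|apply (ioo_limit_const (c O))]. intros tau _.
    replace (INR 0 * tau) with (RtoC 0) by (simpl; ring). rewrite expipi_0; ring.
Qed.

Lemma qterm_series tau : HH tau -> is_Cseries (qterm c tau) (qfull c tau - c O).
Proof.
  intros Ht. pose proof (is_Cseries_tail _ _ (qfull_correct tau Ht)) as H. cbv beta in H.
  replace (INR 0 * tau) with (RtoC 0) in H by (simpl; ring).
  rewrite expipi_0, Cmult_1_r in H. exact H.
Qed.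

Lemma qfull_split tau : HH tau -> c O + qseries c tau = qfull c tau.
Proof.
  intros Ht. unfold qseries. rewrite (CSeries_unique _ _ (qterm_series tau Ht)). ring.
Qed.

Lemma subexp_converges : qseries_converges c.
Proof. intros tau Ht. eexists. apply qterm_series, Ht. Qed.

End QFull.

Lemma is_Cseries_bounded a l : is_Cseries a l -> exists M : R, forall n, (Cmod (a n) <= M)%R.
Proof.
  intros H.
  destruct (@filterlim_bounded C_AbsRing C_NormedModule (Csum a)) as [M HM]; [exists l; exact H|].
  change (forall n, (Cmod (Csum a n) <= M)%R) in HM.
  exists (M + M)%R. intros [|n].
  - pose proof (HM O) as H0. rewrite Csum_0 in H0. pose proof (Cmod_ge_0 (a O)); lra.
  - replace (a (S n)) with (Csum a (S n) - Csum a n) by (rewrite Csum_S; ring).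
    eapply Rle_trans; [apply Cmod_triangle_minus|]. apply Rplus_le_compat; apply HM.
Qed.

Lemma terms_bounded_subexp (c : nat -> C) :
  (forall y : R, (0 < y)%R -> exists M : R, forall n, (Cmod (c (S n)) * exp (- (y * INR (S n))) <= M)%R) ->
  subexp c.
Proof.
  intros H eps He. destruct (H eps He) as [M HM].
  exists (Rmax (Cmod (c O)) M). intros [|n].
  - simpl. rewrite Rmult_0_r, exp_0, Rmult_1_r. apply Rmax_l.
  - specialize (HM n). rewrite exp_Ropp in HM.
    pose proof (exp_pos (eps * INR (S n))) as Hp.
    apply Rle_trans with (M * exp (eps * INR (S n)))%R.
    + apply Rmult_le_compat_r with (r := exp (eps * INR (S n))) in HM; [|lra].
      rewrite Rmult_assoc, Rinv_l, Rmult_1_r in HM by lra. exact HM.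
    + apply Rmult_le_compat_r; [lra|apply Rmax_r].
Qed.

(** At [tau = i y / pi] the terms have modulus [|c_n| exp (- y n)], and the terms of a convergent
    series are bounded. *)
Lemma converges_subexp (c : nat -> C) : qseries_converges c -> subexp c.
Proof.
  intros H. apply terms_bounded_subexp. intros y Hy.
  pose proof PI_RGT_0 as HPI.
  destruct (H (0, y / PI)%R) as [l Hl]; [unfold HH; ReIm; apply Rdiv_lt_0_compat; lra|].
  destruct (is_Cseries_bounded _ _ Hl) as [M HM]. exists M. intros n.
  eapply Rle_trans; [|apply (HM n)]. unfold qterm. rewrite Cmod_mult, Cmod_expipi.
  right. f_equal. f_equal. ReIm. field; lra.
Qed.

(** The bridge from functions to coefficients, from which the sequences asserted by the theorem are
    obtained. The limit at [i oo] supplies boundedness and identifies the constant term. *)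
Theorem q_expansion_limit F l : holomorphic_on_HH F -> periodic2_on_HH F -> has_limit_at_ioo F l ->
  exists c, subexp c /\ c O = l /\ forall tau, HH tau -> F tau = qfull c tau.
Proof.
  intros HF Hper Hlim.
  destruct (Hlim 1%R ltac:(lra)) as [Y HY].
  pose proof (q_expansion F HF Hper Y (1 + Cmod l)%R) as HQ.
  assert (HM : forall tau, HH tau -> (Y < Im tau)%R -> (Cmod (F tau) <= 1 + Cmod l)%R).
  { intros tau Ht Hy. specialize (HY tau Ht Hy).
    replace (F tau) with (F tau - l + l) by ring. eapply Rle_trans; [apply Cmod_triangle|lra]. }
  specialize (HQ HM).
  assert (Hc : subexp (qcoef F)).
  { apply terms_bounded_subexp. intros y Hy. pose proof PI_RGT_0 as HPI.
    destruct (is_Cseries_bounded _ _ (HQ (0, y / PI)%R ltac:(unfold HH; ReIm; apply Rdiv_lt_0_compat; lra))) as [M HM2].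
    exists M. intros n. eapply Rle_trans; [|apply (HM2 (S n))]. rewrite Cmod_mult, Cmod_expipi.
    right. f_equal. f_equal. ReIm. field; lra. }
  assert (HE : forall tau, HH tau -> F tau = qfull (qcoef F) tau).
  { intros tau Ht. eapply is_Cseries_unique; [apply HQ, Ht|apply qfull_correct; auto]. }
  exists (qcoef F). split; [auto|]. split; [|auto].
  eapply ioo_limit_unique; [|exact Hlim].
  eapply ioo_limit_ext; [|apply qfull_limit, Hc]. intros tau Ht; symmetry; auto.
Qed.

(** * Theta functions *)

Definition pos_half (u : Z -> C) (n : nat) : C := u (Z.of_nat n).
Definition neg_half (u : Z -> C) (n : nat) : C := u (- Z.of_nat (S n))%Z.

Definition is_CseriesZ (u : Z -> C) (l : C) : Prop :=
  exists a b, is_Cseries (pos_half u) a /\ is_Cseries (neg_half u) b /\ l = a + b.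

Lemma CSeriesZ_unique u l : is_CseriesZ u l -> CSeriesZ u = l.
Proof.
  intros [a [b [Ha [Hb ->]]]]. unfold CSeriesZ.
  rewrite <- (CSeries_unique _ _ Ha), <- (CSeries_unique _ _ Hb). reflexivity.
Qed.

Lemma is_CseriesZ_unique u l m : is_CseriesZ u l -> is_CseriesZ u m -> l = m.
Proof. intros H1 H2. rewrite <- (CSeriesZ_unique _ _ H1). apply CSeriesZ_unique, H2. Qed.

Lemma is_CseriesZ_ext u v l : (forall n, u n = v n) -> is_CseriesZ u l -> is_CseriesZ v l.
Proof.
  intros E [a [b [Ha [Hb ->]]]]. exists a, b. repeat split.
  - eapply is_Cseries_ext; [|exact Ha]. intros; apply E.
  - eapply is_Cseries_ext; [|exact Hb]. intros; apply E.
Qed.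

Lemma is_CseriesZ_scal (c : C) u l : is_CseriesZ u l -> is_CseriesZ (fun n => c * u n) (c * l).
Proof.
  intros [a [b [Ha [Hb ->]]]]. exists (c * a), (c * b). repeat split; [| |ring].
  - exact (is_Cseries_scal c _ _ Ha).
  - exact (is_Cseries_scal c _ _ Hb).
Qed.

(** The term [u 0] moves from the nonnegative half to the negative one. *)
Lemma is_CseriesZ_shift u l : is_CseriesZ u l -> is_CseriesZ (fun n => u (n + 1)%Z) l.
Proof.
  intros [a [b [Ha [Hb ->]]]]. exists (a - u 0%Z), (u 0%Z + b). repeat split; [| |ring].
  - eapply is_Cseries_ext; [|exact (is_Cseries_tail _ _ Ha)]. intros n; unfold pos_half. f_equal; lia.
  - apply (is_Cseries_ext (fun n => u (- Z.of_nat n)%Z)).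
    { intros n; unfold neg_half. f_equal; lia. }
    apply (is_Cseries_cons (fun n => u (- Z.of_nat n)%Z)). exact Hb.
Qed.

Lemma is_CseriesZ_opp u l : is_CseriesZ u l -> is_CseriesZ (fun n => u (- n)%Z) l.
Proof.
  intros [a [b [Ha [Hb ->]]]]. exists (u 0%Z + b), (a - u 0%Z). repeat split; [| |ring].
  - exact (is_Cseries_cons (fun n => u (- Z.of_nat n)%Z) _ Hb).
  - eapply is_Cseries_ext; [|exact (is_Cseries_tail _ _ Ha)].
    intros n; unfold neg_half, pos_half. f_equal; lia.
Qed.

Lemma is_Cseries_even_odd u l a b : is_Cseries u l -> is_Cseries (fun n => u (2 * n)%nat) a ->
  is_Cseries (fun n => u (2 * n + 1)%nat) b -> l = a + b.
Proof.
  intros H Ha Hb. apply (is_Cseries_unique (fun n => u (2 * n)%nat + u (2 * n + 1)%nat));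
    [|apply is_Cseries_plus; auto].
  apply is_Cseries_iff. intros eps He.
  destruct (proj1 (is_Cseries_iff _ _) H eps He) as [N HN].
  exists N. intros n Hn. specialize (HN (2 * n + 1)%nat ltac:(lia)).
  replace (Csum _ n) with (Csum u (2 * n + 1)); [auto|]. clear.
  induction n.
  - rewrite Csum_0. simpl (2 * 0 + 1)%nat. rewrite Csum_S, Csum_0. reflexivity.
  - replace (2 * S n + 1)%nat with (S (S (2 * n + 1))) by lia.
    rewrite !Csum_S, IHn. replace (S (2 * n + 1)) with (2 * S n)%nat by lia.
    replace (S (2 * S n)) with (2 * S n + 1)%nat by lia. ring.
Qed.

Lemma is_CseriesZ_even_odd u l a b : is_CseriesZ u l -> is_CseriesZ (fun n => u (2 * n)%Z) a ->
  is_CseriesZ (fun n => u (2 * n + 1)%Z) b -> l = a + b.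
Proof.
  intros [p [q [Hp [Hq ->]]]] [a1 [a2 [Ha1 [Ha2 ->]]]] [b1 [b2 [Hb1 [Hb2 ->]]]].
  assert (E1 : p = a1 + b1).
  { apply (is_Cseries_even_odd _ _ _ _ Hp).
    - eapply is_Cseries_ext; [|exact Ha1]. intros; unfold pos_half; f_equal; lia.
    - eapply is_Cseries_ext; [|exact Hb1]. intros; unfold pos_half; f_equal; lia. }
  assert (E2 : q = b2 + a2).
  { apply (is_Cseries_even_odd _ _ _ _ Hq).
    - eapply is_Cseries_ext; [|exact Hb2]. intros; unfold neg_half; f_equal; lia.
    - eapply is_Cseries_ext; [|exact Ha2]. intros; unfold neg_half; f_equal; lia. }
  rewrite E1, E2; ring.
Qed.

Definition theta_term (z tau : C) (n : Z) : C := expipi (IZR n ^ 2 * tau + 2 * IZR n * z).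
Definition Theta (z tau : C) : C := CSeriesZ (theta_term z tau).

Lemma theta00_Theta tau : theta00 tau = Theta 0 tau.
Proof.
  unfold theta00, Theta, CSeriesZ. f_equal; apply CSeries_ext; intros n; unfold theta_term; f_equal; ring.
Qed.

(** Completing the square; it lets a Gaussian with any linear exponent be dominated by a geometric
    sequence. *)
Lemma quadratic_le_linear (al B x : R) : (0 < al)%R ->
  (- al * x ^ 2 + B * x <= (B + 1) ^ 2 / (4 * al) - x)%R.
Proof.
  intros Ha. assert (H : (0 <= (2 * al * x - (B + 1)) ^ 2 / (4 * al))%R).
  { apply Rdiv_le_0_compat; [apply pow2_ge_0|lra]. }
  replace ((2 * al * x - (B + 1)) ^ 2 / (4 * al))%R
    with (al * x ^ 2 - (B + 1) * x + (B + 1) ^ 2 / (4 * al))%R in H by (field; lra). lra.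
Qed.

Lemma Cmod_expipi_R (x : R) : Cmod (expipi x) = 1%R.
Proof. rewrite Cmod_expipi. ReIm. rewrite Rmult_0_r, Ropp_0, exp_0; auto. Qed.

Definition theta_freq (k : Z) : C := Ci * PI * (2 * IZR k).

Lemma theta_term_freq z tau k : theta_term z tau k = expipi (IZR k ^ 2 * tau) * Cexp (theta_freq k * z).
Proof. unfold theta_term, theta_freq. rewrite expipi_plus. f_equal. unfold expipi. f_equal; ring. Qed.

Lemma Cmod_theta_freq k : Cmod (theta_freq k) = (2 * PI * Rabs (IZR k))%R.
Proof.
  unfold theta_freq. rewrite !Cmod_mult, Cmod_Ci, !Cmod_R, (Rabs_pos_eq PI), (Rabs_pos_eq 2);
    [ring|lra|pose proof PI_RGT_0; lra].
Qed.

Lemma theta_exp_sum tau z : HH tau -> exists K : R, (0 <= K)%R /\ forall k : Z,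
  (Cmod (expipi (IZR k ^ 2 * tau)) * (1 + Cmod (theta_freq k)) ^ 2 *
   exp (Re (theta_freq k * z) + 1 * Cmod (theta_freq k)) <= K * exp (- (1) * Rabs (IZR k)))%R.
Proof.
  intros Ht. unfold HH in Ht. set (y := Im tau) in *. pose proof PI_RGT_0 as HPI.
  (* [B] collects the linear growth: [2 pi] each from the square factor and from the radius 1, and
     [2 pi |z|] from [z]. The 9 is [(1 + 2 / 1) ^ 2] from [sq_le_exp]. *)
  set (B := (2 * PI * (2 + Cmod z))%R).
  set (K := exp ((B + 1) ^ 2 / (4 * (PI * y)))).
  exists (9 * K)%R. split; [pose proof (exp_pos ((B + 1) ^ 2 / (4 * (PI * y)))); unfold K; lra|].
  intros k. rewrite Cmod_expipi, Cmod_theta_freq.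
  set (x := Rabs (IZR k)). assert (Hx : (0 <= x)%R) by apply Rabs_pos.
  replace (Im (IZR k ^ 2 * tau)) with (x ^ 2 * y)%R.
  2:{ unfold x, y. rewrite pow2_abs. simpl (IZR k ^ 2). ReIm. ring. }
  assert (H1 : ((1 + 2 * PI * x) ^ 2 <= 9 * exp (2 * PI * x))%R).
  { pose proof (sq_le_exp 1 (2 * PI * x) ltac:(lra) ltac:(nra)) as Q.
    rewrite Rmult_1_l in Q. replace ((1 + 2 / 1) ^ 2)%R with 9%R in Q by field. exact Q. }
  assert (H2 : (Re (theta_freq k * z) <= 2 * PI * x * Cmod z)%R).
  { eapply Rle_trans; [apply Rle_abs|]. eapply Rle_trans; [apply Re_le_Cmod|].
    rewrite Cmod_mult, Cmod_theta_freq. unfold x; lra. }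
  assert (H3 : (exp (Re (theta_freq k * z) + 1 * (2 * PI * x)) <= exp (2 * PI * x * Cmod z + 2 * PI * x))%R).
  { rewrite Rmult_1_l. apply exp_le; lra. }
  pose proof (exp_pos (- (PI * (x ^ 2 * y)))).
  pose proof (exp_pos (2 * PI * x)).
  apply Rle_trans with (exp (- (PI * (x ^ 2 * y))) * (9 * exp (2 * PI * x)) * exp (2 * PI * x * Cmod z + 2 * PI * x))%R.
  - apply Rmult_le_compat; [apply Rmult_le_pos; [lra|apply pow2_ge_0]|left; apply exp_pos| |auto].
    apply Rmult_le_compat_l; lra.
  - replace (exp (- (PI * (x ^ 2 * y))) * (9 * exp (2 * PI * x)) * exp (2 * PI * x * Cmod z + 2 * PI * x))%R
      with (9 * (exp (- (PI * (x ^ 2 * y))) * exp (2 * PI * x) * exp (2 * PI * x * Cmod z + 2 * PI * x)))%R by ring.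
    rewrite (Rmult_assoc 9 K). apply Rmult_le_compat_l; [lra|].
    unfold K. rewrite <- !exp_plus.
    pose proof (quadratic_le_linear (PI * y) B x ltac:(nra)) as Q.
    match goal with |- (exp ?a <= exp ?b)%R => assert (L : (a <= b)%R) end.
    { unfold B in *. nra. }
    apply exp_le; lra.
Qed.

Lemma Rabs_IZR_of_nat n : Rabs (IZR (Z.of_nat n)) = INR n.
Proof. rewrite <- INR_IZR_INZ. apply Rabs_pos_eq, pos_INR. Qed.

Lemma Rabs_IZR_neg n : Rabs (IZR (- Z.of_nat n)) = INR n.
Proof. rewrite opp_IZR, Rabs_Ropp. apply Rabs_IZR_of_nat. Qed.

Section ThetaZ.
Context (tau : C) (Ht : HH tau).

Lemma theta_half_sums z : exists K : R,
  (forall n, (Cmod (expipi (IZR (Z.of_nat n) ^ 2 * tau)) * (1 + Cmod (theta_freq (Z.of_nat n))) ^ 2 *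
   exp (Re (theta_freq (Z.of_nat n) * z) + 1 * Cmod (theta_freq (Z.of_nat n))) <= K * exp (- (1) * INR n))%R) /\
  (forall n, (Cmod (expipi (IZR (- Z.of_nat (S n)) ^ 2 * tau)) * (1 + Cmod (theta_freq (- Z.of_nat (S n)))) ^ 2 *
   exp (Re (theta_freq (- Z.of_nat (S n)) * z) + 1 * Cmod (theta_freq (- Z.of_nat (S n)))) <= K * exp (- (1) * INR n))%R).
Proof.
  destruct (theta_exp_sum tau z Ht) as [K [HK0 HK]]. exists K. split; intros n.
  - rewrite <- Rabs_IZR_of_nat. apply HK.
  - eapply Rle_trans; [apply HK|]. rewrite Rabs_IZR_neg. apply Rmult_le_compat_l; [auto|].
    apply exp_le. rewrite S_INR; lra.
Qed.

Lemma Theta_correct z : is_CseriesZ (theta_term z tau) (Theta z tau).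
Proof.
  destruct (theta_half_sums z) as [K [H1 H2]].
  assert (H0 : (Cmod (z - z) <= 1)%R) by (rewrite Cmod_minus_diag; lra).
  pose proof (exp_sum_correct (fun n => expipi (IZR (Z.of_nat n) ^ 2 * tau))
    (fun n => theta_freq (Z.of_nat n)) z 1 K 1 ltac:(lra) H1 z H0) as S1.
  pose proof (exp_sum_correct (fun n => expipi (IZR (- Z.of_nat (S n)) ^ 2 * tau))
    (fun n => theta_freq (- Z.of_nat (S n))) z 1 K 1 ltac:(lra) H2 z H0) as S2.
  assert (H : is_CseriesZ (theta_term z tau)
    (CSeries (fun n => expipi (IZR (Z.of_nat n) ^ 2 * tau) * Cexp (theta_freq (Z.of_nat n) * z)) +
     CSeries (fun n => expipi (IZR (- Z.of_nat (S n)) ^ 2 * tau) * Cexp (theta_freq (- Z.of_nat (S n)) * z)))).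
  { eexists; eexists; split; [|split; [|reflexivity]].
    - eapply is_Cseries_ext; [|exact S1]. intros n; unfold pos_half; rewrite theta_term_freq; reflexivity.
    - eapply is_Cseries_ext; [|exact S2]. intros n; unfold neg_half; rewrite theta_term_freq; reflexivity. }
  unfold Theta. rewrite (CSeriesZ_unique _ _ H). exact H.
Qed.

Lemma Theta_entire z : exists l, Cderiv (fun w => Theta w tau) z l.
Proof.
  destruct (theta_half_sums z) as [K [H1 H2]].
  pose proof (exp_sum_Cderiv (fun n => expipi (IZR (Z.of_nat n) ^ 2 * tau))
    (fun n => theta_freq (Z.of_nat n)) z 1 K 1 ltac:(lra) ltac:(lra) H1) as S1.
  pose proof (exp_sum_Cderiv (fun n => expipi (IZR (- Z.of_nat (S n)) ^ 2 * tau))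
    (fun n => theta_freq (- Z.of_nat (S n))) z 1 K 1 ltac:(lra) ltac:(lra) H2) as S2.
  eexists. eapply Cderiv_ext; [|apply (Cderiv_plus _ _ _ _ _ S1 S2)].
  intros w. cbv beta. unfold Theta, CSeriesZ.
  f_equal; apply CSeries_ext; intros n; rewrite theta_term_freq; reflexivity.
Qed.

Lemma expipi_even (k : Z) : expipi (2 * IZR k) = 1.
Proof.
  rewrite <- (Cexp_Z_period k). unfold expipi. f_equal. rewrite !RtoC_mult; ring.
Qed.

Lemma Theta_period z : Theta (z + 1) tau = Theta z tau.
Proof.
  unfold Theta, CSeriesZ; f_equal; apply CSeries_ext; intros n; unfold theta_term;
  rewrite Cmult_plus_distr_l, Cplus_assoc, expipi_plus, Cmult_1_r, expipi_even; ring.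
Qed.

Lemma Theta_even z : Theta (- z) tau = Theta z tau.
Proof.
  apply (is_CseriesZ_unique (theta_term (- z) tau)); [apply Theta_correct|].
  eapply is_CseriesZ_ext; [|apply is_CseriesZ_opp, Theta_correct].
  intros n. unfold theta_term. rewrite opp_IZR, RtoC_opp. f_equal; ring.
Qed.

Lemma Theta_quasi_period z : Theta (z + tau) tau = expipi (- (tau + 2 * z)) * Theta z tau.
Proof.
  apply (is_CseriesZ_unique (theta_term (z + tau) tau)); [apply Theta_correct|].
  eapply is_CseriesZ_ext; [|apply is_CseriesZ_scal, is_CseriesZ_shift, Theta_correct].
  intros n. unfold theta_term. rewrite <- expipi_plus, plus_IZR, RtoC_plus. f_equal; ring.
Qed.

(** Evenness with the period 1 identifies the values at [1/2 + tau/2] and [1/2 - tau/2]; the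
    quasi-period [tau] makes them opposite. *)
Lemma Theta_zero : Theta (1 / 2 + tau / 2) tau = 0.
Proof.
  assert (H2 : RtoC 2 <> 0) by (apply RtoC_neq; lra).
  assert (E1 : Theta (1 / 2 + tau / 2) tau = Theta (1 / 2 - tau / 2) tau).
  { rewrite <- Theta_even, <- Theta_period. f_equal. field. }
  assert (E2 : Theta (1 / 2 + tau / 2) tau = - Theta (1 / 2 - tau / 2) tau).
  { replace (1 / 2 + tau / 2) with (1 / 2 - tau / 2 + tau) by field.
    rewrite Theta_quasi_period.
    replace (- (tau + 2 * (1 / 2 - tau / 2))) with (- RtoC 1) by field.
    replace (expipi (- RtoC 1)) with (- RtoC 1); [ring|].
    pose proof (expipi_opp 1) as E. rewrite expipi_1 in E.
    replace (expipi (- RtoC 1)) with (- (expipi (- RtoC 1) * - RtoC 1)) by ring. rewrite E; ring. }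
  rewrite <- E1 in E2.
  replace (Theta (1 / 2 + tau / 2) tau) with ((Theta (1 / 2 + tau / 2) tau - - Theta (1 / 2 + tau / 2) tau) / 2) by field.
  rewrite <- E2. field.
Qed.

End ThetaZ.

(** * Entire functions with the quasi-periods of a theta function *)

Definition entire (F : C -> C) : Prop := strip_holo (fun _ => True) F.

Lemma fcoef_entire F y k : entire F -> (forall z, F (z + 1) = F z) -> fcoef F y k = fcoef F 0 k.
Proof. intros HF Hper. apply (fcoef_const (fun _ => True)); auto. intros a b c _ _ _; exact I. Qed.

Lemma Laurent_Z F z : entire F -> (forall z, F (z + 1) = F z) ->
  is_CseriesZ (fun k => fcoef F 0 k * ek k z) (F z).
Proof.
  intros HF Hper. destruct (Laurent _ F z HF Hper I) as [q [H1 H2]].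
  exists (F z + q), (- q). repeat split; [| |ring].
  - eapply is_Cseries_ext; [|exact H1]. intros n; unfold pos_half. rewrite fcoef_entire; auto.
  - eapply is_Cseries_ext; [|exact H2]. intros n; unfold neg_half. rewrite fcoef_entire; auto.
Qed.

Lemma ek_expipi k z : ek k z = expipi (2 * IZR k * z).
Proof. unfold ek, expipi. f_equal. rewrite !RtoC_mult; ring. Qed.

(** The Fourier coefficients of [F (z + tau)] are computed twice: by translation, and from the
    quasi-period, whose factor [exp (- 2 i pi N z)] shifts the index by [N]. *)
Lemma fcoef_recursion F (N : Z) tau : entire F -> (forall z, F (z + 1) = F z) ->
  (forall z, F (z + tau) = expipi (- (IZR N * (tau + 2 * z))) * F z) ->
  forall k, fcoef F 0 (k + N) = expipi ((IZR N + 2 * IZR k) * tau) * fcoef F 0 k.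
Proof.
  intros HF Hper Hq k.
  pose proof (fcoef_shift _ F tau 0 k HF Hper I) as H.
  rewrite (fcoef_entire F) in H by auto.
  assert (E : fcoef (fun z => F (z + tau)) 0 k = expipi (- (IZR N * tau)) * fcoef F 0 (k + N)).
  { unfold fcoef, period_int. rewrite <- CInt_scal; [|lra|].
    - apply CInt_ext; [lra|]. intros t _. rewrite Hq, !ek_expipi.
      rewrite Z.opp_add_distr, plus_IZR, !opp_IZR, RtoC_plus, !RtoC_opp.
      transitivity (expipi (- (IZR N * tau)) * expipi (2 * - IZR N * (t, 0%R)) * F (t, 0%R) *
         expipi (2 * - IZR k * (t, 0%R))).
      + rewrite <- expipi_plus. do 3 f_equal. ring.
      + replace (2 * (- IZR k + - IZR N) * (t, 0%R)) with (2 * - IZR k * (t, 0%R) + 2 * - IZR N * (t, 0%R)) by ring.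
        rewrite expipi_plus. ring.
    - intros t _. destruct (HF (t, 0%R) I) as [l Hl].
      apply (rcont_horizontal (fun z => F z * ek (- (k + N)) z)).
      eapply Cderiv_Ccont, Cderiv_mult; [exact Hl|apply Cderiv_ek]. }
  rewrite E in H.
  replace (fcoef F 0 (k + N)) with (expipi (IZR N * tau) * (expipi (- (IZR N * tau)) * fcoef F 0 (k + N))).
  - rewrite H, ek_expipi, Cmult_assoc, <- expipi_plus. do 2 f_equal. ring.
  - rewrite Cmult_assoc, (Cmult_comm (expipi (IZR N * tau))), expipi_opp. ring.
Qed.

Lemma expipi_cancel (z a b : C) : expipi z * a = expipi z * b -> a = b.
Proof.
  intros H. transitivity (expipi (- z) * (expipi z * a)).
  - rewrite Cmult_assoc, expipi_opp; ring.
  - rewrite H, Cmult_assoc, expipi_opp; ring.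
Qed.

Lemma Z_two_sided_ind (P : Z -> Prop) : P 0%Z -> (forall k, P k <-> P (k + 1)%Z) -> forall k, P k.
Proof.
  intros H0 H. apply Z.peano_ind; auto.
  - intros k Hk. apply (proj1 (H k)), Hk.
  - intros k Hk. apply (proj2 (H (Z.pred k))). replace (Z.pred k + 1)%Z with k by lia. exact Hk.
Qed.

(** Two sequences with the same ratios are proportional; the ratios are exponentials, hence
    invertible, so the recursion also runs towards negative indices. *)
Lemma geometric_recursion (c d : Z -> C) (e : Z -> C) :
  (forall k, c (k + 1)%Z = expipi (e k) * c k) -> (forall k, d (k + 1)%Z = expipi (e k) * d k) ->
  d 0%Z = 1 -> forall k, c k = d k * c 0%Z.
Proof.
  intros Hc Hd H0. apply Z_two_sided_ind.
  - rewrite H0; ring.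
  - intros k. rewrite Hc, Hd. split.
    + intros ->. ring.
    + intros H. apply (expipi_cancel (e k)). rewrite H. ring.
Qed.

Lemma theta_space_dim1 F tau : HH tau -> entire F -> (forall z, F (z + 1) = F z) ->
  (forall z, F (z + tau) = expipi (- (tau + 2 * z)) * F z) ->
  exists c, forall z, F z = c * Theta z tau.
Proof.
  intros Ht HF Hper Hq. exists (fcoef F 0 0). intros z.
  assert (Hr := fcoef_recursion F 1 tau HF Hper).
  assert (Hk : forall k, fcoef F 0 k = expipi (IZR k ^ 2 * tau) * fcoef F 0 0).
  { apply (geometric_recursion _ (fun k => expipi (IZR k ^ 2 * tau)) (fun k => (1 + 2 * IZR k) * tau)).
    - intros k. apply Hr. intros w. rewrite Hq. do 2 f_equal. ring.
    - intros k. cbv beta. rewrite <- expipi_plus. f_equal. rewrite plus_IZR, RtoC_plus. ring.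
    - rewrite <- expipi_0. f_equal. ring. }
  apply (is_CseriesZ_unique (fun k => fcoef F 0 k * ek k z)); [apply Laurent_Z; auto|].
  eapply is_CseriesZ_ext; [|apply is_CseriesZ_scal, Theta_correct, Ht].
  intros k. cbv beta. rewrite (Hk k), ek_expipi. unfold theta_term. rewrite expipi_plus. ring.
Qed.

Lemma HH_double tau : HH tau -> HH (2 * tau).
Proof. unfold HH. ReIm. lra. Qed.

(** The recursion has step 2, so even and odd coefficients are governed by coefficients 0 and 1;
    each parity class sums to a theta series at [2 tau]. *)
Lemma theta_space_dim2 F tau : HH tau -> entire F -> (forall z, F (z + 1) = F z) ->
  (forall z, F (z + tau) = expipi (- (2 * (tau + 2 * z))) * F z) ->
  exists c0 c1, forall z, F z = c0 * Theta (2 * z) (2 * tau) + c1 * (expipi (2 * z) * Theta (2 * z + tau) (2 * tau)).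
Proof.
  intros Ht HF Hper Hq. exists (fcoef F 0 0), (fcoef F 0 1). intros z.
  assert (Hr := fcoef_recursion F 2 tau HF Hper Hq).
  assert (H0 : forall k, fcoef F 0 (2 * k) = expipi (2 * IZR k ^ 2 * tau) * fcoef F 0 0).
  { apply (geometric_recursion (fun k => fcoef F 0 (2 * k)) (fun k => expipi (2 * IZR k ^ 2 * tau))
      (fun k => (2 + 4 * IZR k) * tau)).
    - intros k. cbv beta. replace (2 * (k + 1))%Z with (2 * k + 2)%Z by lia. rewrite Hr.
      do 2 f_equal. rewrite mult_IZR, RtoC_mult. ring.
    - intros k. cbv beta. rewrite <- expipi_plus. f_equal. rewrite plus_IZR, RtoC_plus. ring.
    - rewrite <- expipi_0. f_equal. ring. }
  assert (H1 : forall k, fcoef F 0 (2 * k + 1) = expipi ((2 * IZR k ^ 2 + 2 * IZR k) * tau) * fcoef F 0 1).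
  { apply (geometric_recursion (fun k => fcoef F 0 (2 * k + 1)) (fun k => expipi ((2 * IZR k ^ 2 + 2 * IZR k) * tau))
      (fun k => (4 + 4 * IZR k) * tau)).
    - intros k. cbv beta. replace (2 * (k + 1) + 1)%Z with (2 * k + 1 + 2)%Z by lia. rewrite Hr.
      do 2 f_equal. rewrite plus_IZR, mult_IZR, RtoC_plus, RtoC_mult. ring.
    - intros k. cbv beta. rewrite <- expipi_plus. f_equal. rewrite plus_IZR, RtoC_plus. ring.
    - rewrite <- expipi_0. f_equal. ring. }
  apply (is_CseriesZ_even_odd _ _ _ _ (Laurent_Z F z HF Hper)).
  - eapply is_CseriesZ_ext; [|apply is_CseriesZ_scal, Theta_correct, HH_double, Ht].
    intros k. cbv beta. rewrite (H0 k), ek_expipi. unfold theta_term.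
    match goal with |- _ = expipi ?a * ?c * expipi ?b =>
      replace (expipi a * c * expipi b) with (c * expipi (a + b)) by (rewrite expipi_plus; ring) end. do 2 f_equal.
    rewrite mult_IZR, RtoC_mult. ring.
  - eapply is_CseriesZ_ext; [|apply is_CseriesZ_scal, is_CseriesZ_scal, Theta_correct, HH_double, Ht].
    intros k. cbv beta. rewrite (H1 k), ek_expipi. unfold theta_term.
    match goal with |- _ = expipi ?a * ?c * expipi ?b =>
      replace (expipi a * c * expipi b) with (c * expipi (a + b)) by (rewrite expipi_plus; ring) end.
    rewrite <- expipi_plus. do 2 f_equal.
    rewrite plus_IZR, mult_IZR, RtoC_plus, RtoC_mult. ring.
Qed.

Lemma HH_neq_0 tau : HH tau -> tau <> 0.
Proof. unfold HH. intros H ->. revert H. ReIm. lra. Qed.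

Lemma HH_inv tau : HH tau -> HH (- (1) / tau).
Proof.
  intros H. pose proof (HH_neq_0 _ H) as H0. unfold HH in *. rewrite Im_div by auto.
  apply Rdiv_lt_0_compat.
  - ReIm. lra.
  - apply pow_lt, Cmod_gt_0, H0.
Qed.

(* [z |-> exp (i pi tau z^2) Theta (tau z) tau] has the quasi-periods of
   [Theta z (-1/tau)]. *)
Lemma Theta_inversion tau : HH tau -> exists c, forall z,
  expipi (tau * (z * z)) * Theta (tau * z) tau = c * Theta z (- (1) / tau).
Proof.
  intros Ht. pose proof (HH_neq_0 _ Ht) as H0.
  apply (theta_space_dim1 (fun z => expipi (tau * (z * z)) * Theta (tau * z) tau)).
  - apply HH_inv, Ht.
  - intros z _. destruct (Theta_entire tau Ht (tau * z)) as [l Hl]. eexists.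
    apply Cderiv_mult.
    + apply Cderiv_expipi, Cderiv_scal, Cderiv_mult; apply Cderiv_id.
    + apply (Cderiv_comp (fun w => Theta w tau) (fun w => tau * w)); [exact Hl|].
      apply Cderiv_scal, Cderiv_id.
  - intros z. replace (tau * (z + 1)) with (tau * z + tau) by ring.
    rewrite Theta_quasi_period, Cmult_assoc, <- expipi_plus by auto. do 2 f_equal. ring.
  - intros z. replace (tau * (z + - (1) / tau)) with (tau * z - 1) by (field; auto).
    replace (Theta (tau * z - 1) tau) with (Theta (tau * z) tau).
    + rewrite (Cmult_assoc (expipi _) (expipi _)), <- expipi_plus. do 2 f_equal.
      replace (tau * ((z + - (1) / tau) * (z + - (1) / tau)))
        with (- (- (1) / tau + 2 * z) + tau * (z * z)) by (field; auto). reflexivity.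
    + rewrite <- (Theta_period tau (tau * z - 1)). f_equal. ring.
Qed.

(** * Theta constants, duplication and Jacobi's identity *)

Definition theta01 (tau : C) : C := Theta (1 / 2) tau.
(* [theta10] without its factor [exp (i pi tau / 4)], hence 2-periodic. *)
Definition theta10' (tau : C) : C := Theta (tau / 2) tau.

Lemma C2_neq_0 : RtoC 2 <> 0. Proof. apply RtoC_neq; lra. Qed.
Lemma C4_neq_0 : RtoC 4 <> 0. Proof. apply RtoC_neq; lra. Qed.

Lemma theta10_Theta tau : HH tau -> theta10 tau = expipi (tau / 4) * theta10' tau.
Proof.
  intros Ht. unfold theta10, theta10'. apply CSeriesZ_unique.
  eapply is_CseriesZ_ext; [|apply is_CseriesZ_scal, Theta_correct, Ht].
  intros n. unfold theta_term. rewrite <- expipi_plus. f_equal. field.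
Qed.

Lemma ek_1_half : expipi (2 * (1 / 2)) = - RtoC 1.
Proof. rewrite <- expipi_1. f_equal. field. Qed.

(* Landen's relations up to the unknown factors [c0], [c1]. *)
Lemma theta_duplication tau : HH tau -> exists c0 c1 : C,
  let P := theta00 (2 * tau) in let Q := theta10' (2 * tau) in
  theta00 tau ^ 2 = c0 * P + c1 * Q /\
  theta01 tau ^ 2 = c0 * P - c1 * Q /\
  theta10' tau ^ 2 = c0 * Q + c1 * (expipi (- tau) * P) /\
  c0 * Q = c1 * (expipi (- tau) * P) /\
  (c0 = 0 -> c1 = 0 -> forall z, Theta z tau = 0).
Proof.
  intros Ht. pose proof (HH_double _ Ht) as H2t.
  destruct (theta_space_dim2 (fun z => Theta z tau ^ 2) tau) as [c0 [c1 H]]; auto.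
  - intros z _. destruct (Theta_entire tau Ht z) as [l Hl]. eexists.
    apply Cderiv_mult; [exact Hl|]. apply Cderiv_mult; [exact Hl|apply Cderiv_const].
  - intros z. rewrite Theta_period. reflexivity.
  - intros z. rewrite Theta_quasi_period by auto.
    replace (- (2 * (tau + 2 * z))) with (- (tau + 2 * z) + - (tau + 2 * z)) by ring.
    rewrite expipi_plus. ring.
  - exists c0, c1. intros P Q.
    assert (EQ : Theta tau (2 * tau) = Q).
    { unfold Q, theta10'. f_equal. field. }
    assert (EP : Theta (2 * tau) (2 * tau) = expipi (- (2 * tau)) * P).
    { unfold P. rewrite theta00_Theta, <- (Cplus_0_l (2 * tau)) at 1.
      rewrite Theta_quasi_period by auto. do 2 f_equal. ring. }
    split; [|split; [|split; [|split]]].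
    + rewrite theta00_Theta. rewrite H. replace (2 * 0) with (RtoC 0) by ring.
      rewrite Cplus_0_l, EQ, expipi_0. unfold P. rewrite theta00_Theta. ring.
    + unfold theta01. rewrite H, ek_1_half.
      replace (2 * (1 / 2)) with (0 + 1) by (field; apply C2_neq_0).
      replace (0 + 1 + tau) with (tau + 1) by ring.
      rewrite !Theta_period, EQ. unfold P. rewrite theta00_Theta. ring.
    + unfold theta10'. rewrite H.
      replace (2 * (tau / 2)) with tau by (field; apply C2_neq_0).
      replace (tau + tau) with (2 * tau) by ring.
      rewrite EQ, EP. rewrite (Cmult_assoc (expipi tau)), <- expipi_plus.
      replace (tau + - (2 * tau)) with (- tau) by ring. reflexivity.
    (* At the zero [1/2 + tau/2] of [Theta (., tau)] the left side vanishes, which ties [c0] to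
       [c1]. *)
    + pose proof (H (1 / 2 + tau / 2)) as E. cbv beta in E. rewrite Theta_zero in E by auto.
      rewrite Cmult_plus_distr_l, expipi_plus, ek_1_half in E.
      replace (2 * (1 / 2)) with (RtoC 1) in E by (field; apply C2_neq_0).
      replace (2 * (tau / 2)) with tau in E by (field; apply C2_neq_0).
      replace (1 + tau) with (tau + 1) in E by ring.
      replace (tau + 1 + tau) with (2 * tau + 1) in E by ring.
      rewrite !Theta_period, EQ, EP in E.
      apply Ceq_minus. transitivity (RtoC 0 ^ 2); [rewrite E|ring].
      replace (- tau) with (tau + - (2 * tau)) by ring. rewrite expipi_plus. ring.
    + intros -> -> z. specialize (H z). cbv beta in H.
      destruct (Req_dec (Cmod (Theta z tau)) 0) as [E|E]; [apply Cmod_eq_0, E|].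
      exfalso. apply (Cpow_nz (Theta z tau) 2).
      * intros E2; apply E; rewrite E2; apply Cmod_0.
      * rewrite H; ring.
Qed.

(** The difference of the squares of [c0 P + c1 Q] and [c0 P - c1 Q] is [4 c0 c1 P Q]. The two
    summands of [theta10' tau ^ 2] are equal, so its square is four times their product, and
    [expipi tau] turns that into [4 c0 c1 P Q] as well. *)
Lemma Jacobi_identity tau : HH tau ->
  theta00 tau ^ 4 = theta01 tau ^ 4 + expipi tau * theta10' tau ^ 4.
Proof.
  intros Ht. destruct (theta_duplication tau Ht) as [c0 [c1 [H1 [H2 [H3 [H4 _]]]]]].
  cbv zeta in *. set (P := theta00 (2 * tau)) in *. set (Q := theta10' (2 * tau)) in *.
  replace (theta00 tau ^ 4) with ((theta00 tau ^ 2) ^ 2) by ring.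
  replace (theta01 tau ^ 4) with ((theta01 tau ^ 2) ^ 2) by ring.
  replace (theta10' tau ^ 4) with ((theta10' tau ^ 2) ^ 2) by ring.
  rewrite H1, H2, H3.
  replace (expipi tau * (c0 * Q + c1 * (expipi (- tau) * P)) ^ 2)
    with (expipi tau * (4 * (c0 * Q) * (c1 * (expipi (- tau) * P)))).
  - replace (expipi tau * (4 * (c0 * Q) * (c1 * (expipi (- tau) * P))))
      with (expipi (- tau) * expipi tau * (4 * (c0 * Q) * (c1 * P))) by ring.
    rewrite expipi_opp. ring.
  - rewrite <- H4. ring.
Qed.

(** * Theta constants as functions of [tau] *)

Section ThetaTau.
Context (al be : R) (Hal : (0 <= al <= / 2)%R).

Definition theta_exponent (k : Z) : R := (IZR k ^ 2 + 2 * IZR k * al)%R.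
Definition tau_freq (k : Z) : C := Ci * PI * theta_exponent k.
(** One family for all three theta constants: [(al, be)] is [(0, 0)] for [theta00], [(0, 1/2)] for
    [theta01] and [(1/2, 0)] for [theta10']. *)
Definition Theta_line (tau : C) : C := Theta (al * tau + be) tau.

Lemma theta_exponent_pos n : (INR n <= theta_exponent (Z.of_nat n))%R.
Proof.
  unfold theta_exponent. rewrite <- INR_IZR_INZ. pose proof (pos_INR n).
  assert (INR n <= INR n ^ 2)%R.
  { destruct n; [simpl; lra|]. rewrite S_INR in *. pose proof (pos_INR n). nra. }
  nra.
Qed.

(** Here [al <= 1/2] enters: with [m = n + 1] the exponent [m^2 - 2 m al] is at least
    [m^2 - m = n (n + 1)]. *)
Lemma theta_exponent_neg n : (INR n <= theta_exponent (- Z.of_nat (S n)))%R.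
Proof.
  unfold theta_exponent. rewrite opp_IZR, <- INR_IZR_INZ, S_INR. pose proof (pos_INR n).
  assert (INR n <= INR n ^ 2)%R.
  { destruct n; [simpl; lra|]. rewrite S_INR in *. pose proof (pos_INR n). nra. }
  nra.
Qed.

Lemma theta_term_tau_freq tau k :
  theta_term (al * tau + be) tau k = expipi (2 * IZR k * be) * Cexp (tau_freq k * tau).
Proof.
  unfold theta_term, tau_freq, theta_exponent, expipi. rewrite <- Cexp_plus. f_equal.
  rewrite RtoC_plus, RtoC_pow, !RtoC_mult. ring.
Qed.

Lemma Cmod_theta_phase (k : Z) : Cmod (expipi (2 * IZR k * be)) = 1%R.
Proof. rewrite <- !RtoC_mult. apply Cmod_expipi_R. Qed.

(** Of the decay [s y], half pays for the radius [y / 2], a quarter for the square factor, and a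
    quarter remains. *)
Lemma tau_freq_bound k n tau : (INR n <= theta_exponent k)%R -> HH tau ->
  (Cmod (expipi (2 * IZR k * be)) * (1 + Cmod (tau_freq k)) ^ 2 *
   exp (Re (tau_freq k * tau) + Im tau / 2 * Cmod (tau_freq k))
   <= (1 + 2 / (Im tau / 4)) ^ 2 * exp (- (Im tau / 4) * INR n))%R.
Proof.
  intros Hn Ht. unfold HH in Ht. set (y := Im tau) in *.
  pose proof PI2_1 as HPI. unfold PI2 in HPI. pose proof (pos_INR n) as Hn0.
  set (e := theta_exponent k) in *.
  assert (Hm : Cmod (tau_freq k) = (PI * e)%R).
  { unfold tau_freq. fold e. rewrite !Cmod_mult, Cmod_Ci, !Cmod_R, !Rabs_pos_eq by lra. ring. }
  rewrite Cmod_theta_phase, Hm, Rmult_1_l.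
  replace (Re (tau_freq k * tau)) with (- (PI * e * y))%R by (unfold tau_freq, y; fold e; ReIm; ring).
  set (s := (PI * e)%R). assert (Hs : (INR n <= s)%R) by (unfold s; nra).
  pose proof (sq_le_exp (y / 4) s ltac:(lra) ltac:(lra)) as Q.
  eapply Rle_trans; [apply Rmult_le_compat_r; [left; apply exp_pos|exact Q]|].
  rewrite Rmult_assoc. apply Rmult_le_compat_l; [apply pow2_ge_0|].
  rewrite <- exp_plus.
  assert (L : (y / 4 * s + (- (s * y) + y / 2 * s) <= - (y / 4) * INR n)%R) by nra.
  apply exp_le; lra.
Qed.

Lemma Theta_line_holo : holomorphic_on_HH Theta_line.
Proof.
  intros tau Ht. assert (Ht' : (0 < Im tau)%R) by exact Ht.
  pose proof (exp_sum_Cderiv (fun n => expipi (2 * IZR (Z.of_nat n) * be))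
    (fun n => tau_freq (Z.of_nat n)) tau (Im tau / 2) _ (Im tau / 4) ltac:(lra) ltac:(lra)
    (fun n => tau_freq_bound _ n tau (theta_exponent_pos n) Ht)) as S1.
  pose proof (exp_sum_Cderiv (fun n => expipi (2 * IZR (- Z.of_nat (S n)) * be))
    (fun n => tau_freq (- Z.of_nat (S n))) tau (Im tau / 2) _ (Im tau / 4) ltac:(lra) ltac:(lra)
    (fun n => tau_freq_bound _ n tau (theta_exponent_neg n) Ht)) as S2.
  eexists. eapply Cderiv_ext; [|apply (Cderiv_plus _ _ _ _ _ S1 S2)].
  intros w. cbv beta. unfold Theta_line, Theta, CSeriesZ.
  f_equal; apply CSeries_ext; intros n; rewrite theta_term_tau_freq; reflexivity.
Qed.

(** Integrality of [2 al] makes every [theta_exponent k] an integer, so the shift by 2 multiplies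
    each term by 1. *)
Lemma Theta_line_periodic : (2 * al = 0 \/ 2 * al = 1)%R -> periodic2_on_HH Theta_line.
Proof.
  intros Ha tau _. unfold Theta_line, Theta, CSeriesZ.
  assert (E : forall k, theta_term (al * (tau + 2) + be) (tau + 2) k = theta_term (al * tau + be) tau k).
  { intros k. unfold theta_term.
    replace (IZR k ^ 2 * (tau + 2) + 2 * IZR k * (al * (tau + 2) + be))
      with (IZR k ^ 2 * tau + 2 * IZR k * (al * tau + be) + 2 * (IZR k ^ 2 + IZR k * RtoC (2 * al)))
      by (rewrite RtoC_mult; ring).
    rewrite expipi_plus. rewrite <- (Cmult_1_r (expipi (_ + _))) at 2. f_equal.
    destruct Ha as [-> | ->].
    - transitivity (expipi (2 * IZR (k * k))); [|apply expipi_even]. f_equal. rewrite mult_IZR, RtoC_mult. ring.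
    - transitivity (expipi (2 * IZR (k * k + k))); [|apply expipi_even]. f_equal. rewrite plus_IZR, mult_IZR, RtoC_plus, RtoC_mult. ring. }
  f_equal; apply CSeries_ext; intros n; apply E.
Qed.

(** The terms [k = 0] and [k = -1] lead the two halves. The latter has exponent [1 - 2 al], so it
    survives at [i oo] exactly when [al = 1/2]; this is where the limit 2 of [theta10'] comes
    from. *)
Lemma Theta_line_limit l :
  has_limit_at_ioo (fun tau => expipi (theta_exponent (-1) * tau - 2 * be)) l ->
  has_limit_at_ioo Theta_line (1 + l).
Proof.
  intros Hl. unfold Theta_line, Theta, CSeriesZ.
  assert (Hb : forall k n tau, (INR n <= theta_exponent k)%R -> HH tau ->
    (Cmod (theta_term (al * tau + be) tau k) <= exp (- (Im tau * INR n)))%R).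
  { intros k n tau Hn Ht. unfold HH in Ht. pose proof PI2_1 as HPI. unfold PI2 in HPI.
    pose proof (pos_INR n).
    rewrite theta_term_tau_freq, Cmod_mult, Cmod_theta_phase, Rmult_1_l, Cmod_Cexp.
    replace (Re (tau_freq k * tau)) with (- (PI * theta_exponent k * Im tau))%R
      by (unfold tau_freq; ReIm; ring).
    assert (L : (- (PI * theta_exponent k * Im tau) <= - (Im tau * INR n))%R).
    { assert (INR n <= PI * theta_exponent k)%R by nra. nra. }
    apply exp_le; lra. }
  apply ioo_limit_plus.
  - apply (series_limit_at_ioo _ 1 0); [intros; rewrite Rmult_1_l; apply Hb; auto using theta_exponent_pos|].
    eapply ioo_limit_ext; [|apply (ioo_limit_const 1)].
    intros tau _. simpl. unfold theta_term. rewrite <- expipi_0. f_equal. ring.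
  - apply (series_limit_at_ioo _ 1 0); [intros; rewrite Rmult_1_l; apply Hb; auto using theta_exponent_neg|].
    eapply ioo_limit_ext; [|exact Hl]. intros tau _. unfold theta_term. f_equal.
    change (- Z.of_nat 1)%Z with (-1)%Z. unfold theta_exponent.
    rewrite RtoC_plus, RtoC_pow, !RtoC_mult. ring.
Qed.

End ThetaTau.

Lemma expipi_limit : has_limit_at_ioo expipi 0.
Proof.
  intros eps He. exists (/ eps)%R. intros tau Ht Hy.
  replace (expipi tau - 0) with (expipi tau) by ring. rewrite Cmod_expipi, exp_Ropp.
  assert (Hi : (0 < / eps)%R) by (apply Rinv_0_lt_compat; auto).
  rewrite <- (Rinv_inv eps). apply Rinv_lt_contravar.
  - apply Rmult_lt_0_compat; [auto|apply exp_pos].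
  - pose proof (exp_ineq1_le (PI * Im tau)). pose proof PI2_1. unfold PI2 in *. nra.
Qed.

Lemma theta00_line tau : theta00 tau = Theta_line 0 0 tau.
Proof. rewrite theta00_Theta. unfold Theta_line. f_equal; ring. Qed.

Lemma theta01_line tau : theta01 tau = Theta_line 0 (/ 2) tau.
Proof. unfold theta01, Theta_line. f_equal. rewrite RtoC_inv by lra. field. Qed.

Lemma theta10'_line tau : theta10' tau = Theta_line (/ 2) 0 tau.
Proof. unfold theta10', Theta_line. f_equal. rewrite RtoC_inv by lra. field. Qed.

Lemma holo_ext F G : (forall tau, F tau = G tau) -> holomorphic_on_HH F -> holomorphic_on_HH G.
Proof. intros E H tau Ht. destruct (H tau Ht) as [l Hl]. exists l. apply (Cderiv_ext F); auto. Qed.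

Lemma theta00_holo : holomorphic_on_HH theta00.
Proof. apply (holo_ext (Theta_line 0 0)); [intros; symmetry; apply theta00_line|apply Theta_line_holo; lra]. Qed.

Lemma theta01_holo : holomorphic_on_HH theta01.
Proof. apply (holo_ext (Theta_line 0 (/ 2))); [intros; symmetry; apply theta01_line|apply Theta_line_holo; lra]. Qed.

Lemma theta10'_holo : holomorphic_on_HH theta10'.
Proof. apply (holo_ext (Theta_line (/ 2) 0)); [intros; symmetry; apply theta10'_line|apply Theta_line_holo; lra]. Qed.

Lemma theta00_periodic : periodic2_on_HH theta00.
Proof. intros tau Ht. rewrite !theta00_line. apply Theta_line_periodic; auto; lra. Qed.

Lemma theta10'_periodic : periodic2_on_HH theta10'.
Proof. intros tau Ht. rewrite !theta10'_line. apply Theta_line_periodic; auto; lra. Qed.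

Lemma theta00_limit : has_limit_at_ioo theta00 1.
Proof.
  eapply ioo_limit_ext; [intros; symmetry; apply theta00_line|].
  replace (RtoC 1) with (1 + 0) by ring. apply Theta_line_limit; [lra|].
  eapply ioo_limit_ext; [|exact expipi_limit].
  intros tau _. f_equal. unfold theta_exponent. replace ((-1) ^ 2 + 2 * -1 * 0)%R with 1%R by ring. ring.
Qed.

Lemma theta01_limit : has_limit_at_ioo theta01 1.
Proof.
  eapply ioo_limit_ext; [intros; symmetry; apply theta01_line|].
  replace (RtoC 1) with (1 + expipi (- (1)) * 0) by ring. apply Theta_line_limit; [lra|].
  eapply ioo_limit_ext; [|apply ioo_limit_scal, expipi_limit].
  intros tau _. cbv beta. rewrite <- expipi_plus. f_equal. unfold theta_exponent.
  replace ((-1) ^ 2 + 2 * -1 * 0)%R with 1%R by ring. rewrite RtoC_inv by lra. field.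
Qed.

Lemma theta10'_limit : has_limit_at_ioo theta10' 2.
Proof.
  eapply ioo_limit_ext; [intros; symmetry; apply theta10'_line|].
  replace (RtoC 2) with (RtoC 1 + RtoC 1) by (rewrite <- RtoC_plus; f_equal; ring).
  apply Theta_line_limit; [lra|].
  eapply ioo_limit_ext; [|apply (ioo_limit_const 1)].
  intros tau _. rewrite <- expipi_0. f_equal. unfold theta_exponent.
  replace ((-1) ^ 2 + 2 * -1 * / 2)%R with 0%R by field. ring.
Qed.

(** * Nonvanishing of the theta constants *)

Lemma ioo_limit_nonzero F l : has_limit_at_ioo F l -> l <> 0 ->
  exists Y : R, forall tau, HH tau -> (Y < Im tau)%R -> F tau <> 0.
Proof.
  intros H Hl. destruct (H (Cmod l)) as [Y HY]; [apply Cmod_gt_0; auto|].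
  exists Y. intros tau Ht Hy E. specialize (HY tau Ht Hy). rewrite E in HY.
  replace (0 - l) with (- l) in HY by ring. rewrite Cmod_opp in HY. lra.
Qed.

Lemma HH_dilate (c Y : R) tau : (1 < c)%R -> HH tau ->
  exists n, HH (c ^ n * tau) /\ (Y < Im (c ^ n * tau))%R.
Proof.
  intros Hc Ht. assert (Ht' : (0 < Im tau)%R) by exact Ht.
  destruct (Pow_x_infinity c ltac:(rewrite Rabs_pos_eq; lra) ((Rabs Y + 1) / Im tau)) as [n Hn].
  specialize (Hn n (le_n n)). rewrite Rabs_pos_eq in Hn by (apply pow_le; lra).
  exists n. rewrite <- RtoC_pow. unfold HH. ReIm.
  apply Rge_le in Hn. apply Rmult_le_compat_r with (r := Im tau) in Hn; [|lra].
  replace ((Rabs Y + 1) / Im tau * Im tau)%R with (Rabs Y + 1)%R in Hn by (field; lra).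
  pose proof (Rabs_pos Y). pose proof (Rle_abs Y). lra.
Qed.

Lemma expipi_plus_even z k : expipi (z + 2 * IZR k) = expipi z.
Proof. rewrite expipi_plus, expipi_even; ring. Qed.

(** Translation by [1/2] changes the sign of the odd terms, so they cancel; the even ones form a
    theta series at [4 tau]. *)
Lemma Theta_plus_half tau z : HH tau -> Theta z tau + Theta (z + 1 / 2) tau = 2 * Theta (2 * z) (4 * tau).
Proof.
  intros Ht. assert (H4 : HH (4 * tau)) by (unfold HH in *; ReIm; lra).
  set (B := expipi (tau + 2 * z) * Theta (2 * z + 2 * tau) (4 * tau)).
  assert (E1 : Theta z tau = Theta (2 * z) (4 * tau) + B).
  { apply (is_CseriesZ_even_odd _ _ _ _ (Theta_correct tau Ht z)).
    - eapply is_CseriesZ_ext; [|apply Theta_correct, H4].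
      intros n. unfold theta_term. f_equal. rewrite mult_IZR, RtoC_mult. ring.
    - eapply is_CseriesZ_ext; [|apply is_CseriesZ_scal, Theta_correct, H4].
      intros n. unfold theta_term. rewrite <- expipi_plus. f_equal.
      rewrite plus_IZR, mult_IZR, RtoC_plus, RtoC_mult. ring. }
  assert (E2 : Theta (z + 1 / 2) tau = Theta (2 * z) (4 * tau) + - RtoC 1 * B).
  { apply (is_CseriesZ_even_odd _ _ _ _ (Theta_correct tau Ht (z + 1 / 2))).
    - eapply is_CseriesZ_ext; [|apply Theta_correct, H4].
      intros n. unfold theta_term. rewrite <- (expipi_plus_even _ n). f_equal. rewrite mult_IZR, RtoC_mult. field.
    - eapply is_CseriesZ_ext; [|apply is_CseriesZ_scal, is_CseriesZ_scal, Theta_correct, H4].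
      intros n. unfold theta_term. rewrite <- expipi_1, <- !expipi_plus.
      rewrite <- (expipi_plus_even _ n). f_equal.
      rewrite plus_IZR, mult_IZR, RtoC_plus, RtoC_mult. field. }
  rewrite E1, E2. ring.
Qed.

(* If [Theta(., tau)] vanished identically, so would [Theta(., 4^n tau)]. *)
Lemma Theta_not_zero tau : HH tau -> ~ (forall z, Theta z tau = 0).
Proof.
  intros Ht H0.
  assert (H4 : forall n z, HH (4 ^ n * tau) -> Theta z (4 ^ n * tau) = 0).
  { induction n; intros z Hn.
    - replace (4 ^ 0 * tau) with tau by (simpl; ring). apply H0.
    - assert (Hn' : HH (4 ^ n * tau)) by (revert Hn; rewrite <- !RtoC_pow; unfold HH; ReIm; simpl; lra).
      replace (4 ^ S n * tau) with (4 * (4 ^ n * tau)) by (rewrite Cpow_S; ring).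
      transitivity (2 * Theta (2 * (z / 2)) (4 * (4 ^ n * tau)) / 2).
      + replace (2 * (z / 2)) with z by field. field.
      + rewrite <- Theta_plus_half, !IHn by auto. field. }
  destruct (ioo_limit_nonzero _ _ theta00_limit C1_nz) as [Y HY].
  destruct (HH_dilate 4 Y tau ltac:(lra) Ht) as [n [Hn HYn]].
  apply (HY _ Hn HYn). rewrite theta00_Theta. auto.
Qed.

Definition theta_nonzero (tau : C) : Prop := theta00 tau <> 0 /\ theta01 tau <> 0 /\ theta10' tau <> 0.

(** A zero of [theta00] or [theta01] at [tau] and the relation [c0 Q = c1 E P] eliminate the unknown
    factors and contradict Jacobi's identity at [2 tau]. For [theta10'], the square is [2 c0 Q], a
    product of nonzero factors. *)
Lemma theta_nonzero_halve tau : HH tau -> theta_nonzero (2 * tau) -> theta_nonzero tau.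
Proof.
  intros Ht [HP [H01 HQ]].
  destruct (theta_duplication tau Ht) as [c0 [c1 [H1 [H2 [H3 [H4 H5]]]]]]. cbv zeta in *.
  pose proof (Jacobi_identity (2 * tau) (HH_double _ Ht)) as J.
  set (P := theta00 (2 * tau)) in *. set (Q := theta10' (2 * tau)) in *.
  set (E := expipi (- tau)) in *.
  assert (HE : E <> 0) by apply expipi_neq_0.
  assert (HE2 : E * E * expipi (2 * tau) = 1).
  { unfold E. rewrite <- !expipi_plus, <- expipi_0. f_equal; ring. }
  (* [c1 = 0] would give [c0 Q = 0], hence [c0 = 0], and [Theta (., tau)] would vanish
     identically. *)
  assert (Hc1 : c1 <> 0).
  { intros E1. apply (Theta_not_zero tau Ht). apply H5; auto.
    rewrite E1, Cmult_0_l in H4. destruct (Req_dec (Cmod c0) 0) as [Z|Z]; [apply Cmod_eq_0, Z|].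
    exfalso. apply (Cmult_neq_0 c0 Q); auto. intros Z'; apply Z; rewrite Z'; apply Cmod_0. }
  assert (Hc0 : c0 <> 0).
  { intros E1. rewrite E1, Cmult_0_l in H4. symmetry in H4.
    revert H4. apply Cmult_neq_0; auto. apply Cmult_neq_0; auto. }
  (* both vanishing cases give [E P^2 = +- Q^2], hence [theta01 (2 tau) = 0] *)
  assert (Hkey : forall s : C, s * s = 1 -> E * (P * P) = s * (Q * Q) -> False).
  { intros s Hs HEP.
    assert (E4 : E * E * P ^ 4 = Q ^ 4).
    { transitivity ((E * (P * P)) * (E * (P * P))); [ring|]. rewrite HEP.
      transitivity (s * s * Q ^ 4); [ring|]. rewrite Hs; ring. }
    apply (Cpow_nz (theta01 (2 * tau)) 4 H01).
    transitivity (P ^ 4 - expipi (2 * tau) * Q ^ 4); [rewrite J; ring|].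
    rewrite <- E4. transitivity (P ^ 4 - E * E * expipi (2 * tau) * P ^ 4); [ring|]. rewrite HE2; ring. }
  assert (Hcancel : forall a b : C, c1 * a = c1 * b -> a = b).
  { intros a b Hab. transitivity (/ c1 * (c1 * a)); [field; auto|]. rewrite Hab; field; auto. }
  assert (Hstep : forall s : C, s * s = 1 -> c0 * P + s * (c1 * Q) = 0 -> False).
  { intros s Hs HPQ. apply (Hkey (- s)).
    - transitivity (s * s); [ring|exact Hs].
    - apply Hcancel. transitivity (c1 * (E * P) * P); [ring|]. rewrite <- H4.
      transitivity ((c0 * P + s * (c1 * Q)) * Q - s * c1 * (Q * Q)); [ring|]. rewrite HPQ. ring. }
  split; [|split].
  - intros Z. rewrite Z in H1. apply (Hstep 1); [ring|].
    transitivity (RtoC 0 ^ 2); [rewrite H1; ring|ring].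
  - intros Z. rewrite Z in H2. apply (Hstep (- (1))); [ring|].
    transitivity (RtoC 0 ^ 2); [rewrite H2; ring|ring].
  - intros Z. rewrite Z in H3. rewrite <- H4 in H3.
    apply (Cmult_neq_0 2 (c0 * Q) C2_neq_0); [apply Cmult_neq_0; auto|].
    transitivity (RtoC 0 ^ 2); [rewrite H3; ring|ring].
Qed.

(** For large [n] the point [2 ^ n tau] is so high that the nonzero limits 1, 1, 2 prevail; halving
    leads back to [tau]. *)
Theorem theta_nonvanishing tau : HH tau -> theta_nonzero tau.
Proof.
  intros Ht.
  destruct (ioo_limit_nonzero _ _ theta00_limit C1_nz) as [Y1 H1].
  destruct (ioo_limit_nonzero _ _ theta01_limit C1_nz) as [Y2 H2].
  destruct (ioo_limit_nonzero _ _ theta10'_limit C2_neq_0) as [Y3 H3].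
  assert (Hd : forall n sigma, HH sigma -> theta_nonzero (2 ^ n * sigma) -> theta_nonzero sigma).
  { induction n; intros sigma Hs Hn.
    - replace (2 ^ 0 * sigma) with sigma in Hn by (simpl; ring). exact Hn.
    - apply theta_nonzero_halve; auto. apply IHn; [apply HH_double, Hs|].
      replace (2 ^ n * (2 * sigma)) with (2 ^ S n * sigma) by (rewrite Cpow_S; ring). exact Hn. }
  destruct (HH_dilate 2 (Rmax Y1 (Rmax Y2 Y3)) tau ltac:(lra) Ht) as [n [Hn HY]].
  apply Rmax_Rlt in HY as [HY1 HY]. apply Rmax_Rlt in HY as [HY2 HY3].
  apply (Hd n); auto. repeat split; auto.
Qed.

(** * Logarithms of [lambda] and [1 - lambda] *)

Lemma Cderiv_path K (u v l : C) (t : R) : Cderiv K (u + t * v) l ->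
  is_derive (fun s : R => Re (K (u + s * v))) t (Re (l * v)) /\
  is_derive (fun s : R => Im (K (u + s * v))) t (Im (l * v)).
Proof.
  intros H.
  (* Real and imaginary part share the three properties used: additivity, real homogeneity, and a
     bound by the modulus. *)
  assert (W : forall proj : C -> R, (forall z w, proj (z - w) = (proj z - proj w)%R) ->
    (forall z, (Rabs (proj z) <= Cmod z)%R) -> (forall (r : R) z, proj (r * z) = (r * proj z)%R) ->
    is_derive (fun s : R => proj (K (u + s * v))) t (proj (l * v))).
  { intros proj Hm Hle Hs. apply is_derive_Reals. intros eps He.
    pose proof (Cmod_ge_0 v) as Hv.
    destruct (proj1 (Cderiv_iff _ _ _) H (eps / (2 * (1 + Cmod v)))%R) as [d [Hd D]].
    { apply Rdiv_lt_0_compat; lra. }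
    assert (Hd' : (0 < d / (1 + Cmod v))%R) by (apply Rdiv_lt_0_compat; lra).
    exists (mkposreal _ Hd'). intros h Hh0 Hh. simpl in Hh.
    assert (Ew : u + (t + h)%R * v - (u + t * v) = h * v) by (rewrite RtoC_plus; ring).
    specialize (D (u + (t + h)%R * v)). rewrite Ew, Cmod_mult, Cmod_R in D.
    pose proof (Rabs_pos_lt h Hh0) as Hhp.
    assert (Hhd : (Rabs h * Cmod v < d)%R).
    { apply Rmult_lt_compat_r with (r := (1 + Cmod v)%R) in Hh; [|lra].
      replace (d / (1 + Cmod v) * (1 + Cmod v))%R with d in Hh by (field; lra). nra. }
    specialize (D Hhd).
    set (X := K (u + (t + h)%R * v)) in *. set (X0 := K (u + t * v)) in *.
    replace ((proj X - proj X0) / h - proj (l * v)%C)%R with (proj (X - X0 - l * (h * v))%C / h)%R.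
    - unfold Rdiv. rewrite Rabs_mult, Rabs_inv.
      apply Rle_lt_trans with (Cmod (X - X0 - l * (h * v)) * / Rabs h)%R.
      + apply Rmult_le_compat_r; [left; apply Rinv_0_lt_compat; auto|apply Hle].
      + apply Rmult_lt_reg_r with (Rabs h); [auto|]. rewrite Rmult_assoc, Rinv_l, Rmult_1_r by lra.
        eapply Rle_lt_trans; [exact D|].
        replace (eps / (2 * (1 + Cmod v)) * (Rabs h * Cmod v))%R
          with (eps * Rabs h * (Cmod v / (2 * (1 + Cmod v))))%R by (field; lra).
        assert (Hq : (Cmod v / (2 * (1 + Cmod v)) < 1)%R).
        { apply Rmult_lt_reg_r with (2 * (1 + Cmod v))%R; [lra|].
          replace (Cmod v / (2 * (1 + Cmod v)) * (2 * (1 + Cmod v)))%R with (Cmod v) by (field; lra). lra. }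
        assert (0 < eps * Rabs h)%R by nra. nra.
    - replace (l * (h * v)) with (h * (l * v)) by ring. rewrite !Hm, Hs. field. exact Hh0. }
  split.
  - apply (W Re); [reflexivity|apply Re_le_Cmod|intros; apply re_scal_l].
  - apply (W Im); [reflexivity|apply Im_le_Cmod|intros; apply im_scal_l].
Qed.

Lemma zero_deriv_const_HH K : (forall tau, HH tau -> Cderiv K tau 0) ->
  forall z w, HH z -> HH w -> K z = K w.
Proof.
  intros HK z w Hz Hw.
  assert (Hseg : forall t : R, (0 <= t <= 1)%R -> HH (z + t * (w - z))).
  { intros t Ht. unfold HH in *. ReIm. nra. }
  assert (Hd : forall t : R, (0 <= t <= 1)%R ->
    is_derive (fun s : R => Re (K (z + s * (w - z)))) t 0%R /\
    is_derive (fun s : R => Im (K (z + s * (w - z)))) t 0%R).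
  { intros t Ht. pose proof (Cderiv_path K z (w - z) 0 t (HK _ (Hseg t Ht))) as H.
    rewrite Cmult_0_l in H. exact H. }
  replace z with (z + 0%R * (w - z)) by ring.
  replace w with (z + 1%R * (w - z)) at 2 by ring.
  apply C_eq.
  - apply (eq_is_derive (V := R_NormedModule) (fun s : R => Re (K (z + s * (w - z)))) 0 1); [|lra].
    intros t Ht. apply Hd, Ht.
  - apply (eq_is_derive (V := R_NormedModule) (fun s : R => Im (K (z + s * (w - z)))) 0 1); [|lra].
    intros t Ht. apply Hd, Ht.
Qed.

Lemma ioo_limit_of_const F c l : (forall tau, HH tau -> F tau = c) -> has_limit_at_ioo F l -> c = l.
Proof.
  intros E H. eapply ioo_limit_unique; [|exact H].
  eapply ioo_limit_ext; [|apply ioo_limit_const]. intros; symmetry; auto.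
Qed.

Lemma zero_deriv_limit K l : (forall tau, HH tau -> Cderiv K tau 0) -> has_limit_at_ioo K l ->
  forall tau, HH tau -> K tau = l.
Proof.
  intros HK Hl tau Ht. apply (ioo_limit_of_const K); auto.
  intros s Hs. apply zero_deriv_const_HH; auto.
Qed.

Lemma holo_mult F G : holomorphic_on_HH F -> holomorphic_on_HH G -> holomorphic_on_HH (fun t => F t * G t).
Proof. intros HF HG t Ht. destruct (HF t Ht), (HG t Ht). eexists. apply Cderiv_mult; eauto. Qed.

Lemma holo_plus F G : holomorphic_on_HH F -> holomorphic_on_HH G -> holomorphic_on_HH (fun t => F t + G t).
Proof. intros HF HG t Ht. destruct (HF t Ht), (HG t Ht). eexists. apply Cderiv_plus; eauto. Qed.

Lemma holo_minus F G : holomorphic_on_HH F -> holomorphic_on_HH G -> holomorphic_on_HH (fun t => F t - G t).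
Proof. intros HF HG t Ht. destruct (HF t Ht), (HG t Ht). eexists. apply Cderiv_minus; eauto. Qed.

Lemma holo_div F G : holomorphic_on_HH F -> holomorphic_on_HH G -> (forall t, HH t -> G t <> 0) ->
  holomorphic_on_HH (fun t => F t / G t).
Proof. intros HF HG Hn t Ht. destruct (HF t Ht), (HG t Ht). eexists. apply Cderiv_div; eauto. Qed.

Lemma holo_const c : holomorphic_on_HH (fun _ => c).
Proof. intros t _. exists (RtoC 0). apply Cderiv_const. Qed.

Lemma holo_scal c F : holomorphic_on_HH F -> holomorphic_on_HH (fun t => c * F t).
Proof. intros HF. apply holo_mult; auto using holo_const. Qed.

Lemma holo_pow F n : holomorphic_on_HH F -> holomorphic_on_HH (fun t => F t ^ n).
Proof.
  intros HF. induction n; [apply (holo_const 1)|].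
  apply (holo_mult F (fun t => F t ^ n)); auto.
Qed.

Lemma holo_exp F : holomorphic_on_HH F -> holomorphic_on_HH (fun t => Cexp (F t)).
Proof. intros HF t Ht. destruct (HF t Ht). eexists. apply Cderiv_Cexp; eauto. Qed.

Lemma holo_expipi : holomorphic_on_HH expipi.
Proof. intros t _. eexists. apply (Cderiv_expipi (fun w => w)), Cderiv_id. Qed.

(* The logarithm is the termwise primitive of the q-expansion of [F' / F]. *)
Theorem log_exists F : holomorphic_on_HH F -> periodic2_on_HH F -> has_limit_at_ioo F 1 ->
  (forall tau, HH tau -> F tau <> 0) ->
  exists L, holomorphic_on_HH L /\ periodic2_on_HH L /\ has_limit_at_ioo L 0 /\
    forall tau, HH tau -> Cexp (L tau) = F tau.
Proof.
  intros HF Hper Hlim Hnz.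
  destruct (q_expansion_limit F 1 HF Hper Hlim) as [c [Hc [Hc0 HcF]]].
  set (F' := qfull (fun n => c n * qfreq n)).
  pose proof (subexp_deriv c Hc) as Hc'.
  assert (HF' : forall tau, HH tau -> Cderiv F tau (F' tau)).
  { intros tau Ht. apply (Cderiv_ext_HH (qfull c)); auto; [intros; symmetry; auto|].
    apply Cderiv_qfull; auto. }
  destruct (q_expansion_limit (fun tau => F' tau / F tau) 0) as [d [Hd [Hd0 HdF]]].
  - apply holo_div; auto. apply qfull_holo; auto.
  - intros tau Ht. rewrite Hper by auto. unfold F'. rewrite (qfull_periodic _ tau Ht). reflexivity.
  - replace (RtoC 0) with (c O * qfreq 0 / 1) by (unfold qfreq; simpl; field).
    apply ioo_limit_div; auto using C1_nz. apply (qfull_limit _ Hc').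
  (* [F' / F] tends to 0 at [i oo], so [d 0 = 0] and its primitive has no term linear in [tau]; the
     integration constant is taken as 0. *)
  - set (e := fun n => match n with O => RtoC 0 | _ => d n / qfreq n end).
    assert (Hfr : forall n, (1 <= Cmod (qfreq (S n)))%R).
    { intros n. rewrite Cmod_qfreq, S_INR. pose proof PI2_1. unfold PI2 in *. pose proof (pos_INR n). nra. }
    assert (Hfr0 : forall n, qfreq (S n) <> 0).
    { intros n. apply Cmod_gt_0. specialize (Hfr n); lra. }
    assert (He : subexp e).
    { intros eps Hep. destruct (Hd eps Hep) as [M HM]. exists M. intros [|n].
      - simpl e. rewrite Cmod_0. eapply Rle_trans; [apply Cmod_ge_0|apply (HM O)].
      - eapply Rle_trans; [|apply HM]. simpl e. rewrite Cmod_div by auto.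
        specialize (Hfr n). pose proof (Cmod_ge_0 (d (S n))).
        apply Rmult_le_reg_r with (Cmod (qfreq (S n))); [lra|].
        replace (Cmod (d (S n)) / Cmod (qfreq (S n)) * Cmod (qfreq (S n)))%R with (Cmod (d (S n))) by (field; lra).
        nra. }
    assert (Hed : forall tau, qfull (fun n => e n * qfreq n) tau = qfull d tau).
    { intros tau. unfold qfull. apply CSeries_ext. intros [|n].
      - rewrite Hd0. simpl e. ring.
      - simpl e. field. apply Hfr0. }
    exists (qfull e). split; [apply qfull_holo, He|]. split; [intros tau Ht; apply qfull_periodic, Ht|].
    split; [apply (qfull_limit e He)|].
    intros tau Ht.
    assert (HL : forall s, HH s -> Cderiv (qfull e) s (F' s / F s)).
    { intros s Hs. eapply Cderiv_eq; [apply Cderiv_qfull; auto|]. rewrite Hed. symmetry. apply (HdF s Hs). }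
    (* This product has derivative 0, and its limit at [i oo] fixes the constant. *)
    assert (HK : F tau * Cexp (- qfull e tau) = 1).
    { apply (zero_deriv_limit (fun s => F s * Cexp (- qfull e s))); auto.
      - intros s Hs. eapply Cderiv_eq.
        + apply Cderiv_mult; [apply HF', Hs|]. apply Cderiv_Cexp, Cderiv_opp, HL, Hs.
        + cbv beta. field. apply Hnz, Hs.
      - replace (RtoC 1) with (RtoC 1 * Cexp (- (1) * 0)).
        + apply ioo_limit_mult; [exact Hlim|]. apply ioo_limit_exp.
          eapply ioo_limit_ext; [|apply ioo_limit_scal, (qfull_limit e He)].
          intros s _. cbv beta. ring.
        + replace (- (1) * 0) with (RtoC 0) by ring. rewrite Cexp_0. ring. }
    rewrite Cexp_opp in HK. pose proof (Cexp_neq_0 (qfull e tau)) as Hne.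
    transitivity (F tau * / Cexp (qfull e tau) * Cexp (qfull e tau)); [rewrite HK; ring|]. field; auto.
Qed.

(** * The lambda function in terms of theta constants *)

Lemma theta00_neq_0 tau : HH tau -> theta00 tau <> 0.
Proof. intros Ht; apply (theta_nonvanishing tau Ht). Qed.
Lemma theta01_neq_0 tau : HH tau -> theta01 tau <> 0.
Proof. intros Ht; apply (theta_nonvanishing tau Ht). Qed.
Lemma theta10'_neq_0 tau : HH tau -> theta10' tau <> 0.
Proof. intros Ht; apply (theta_nonvanishing tau Ht). Qed.

(* [lambda / (16 q)] *)
Definition lambda_red (tau : C) : C := / 16 * (theta10' tau ^ 4 / theta00 tau ^ 4).

Lemma C16_neq_0 : RtoC 16 <> 0. Proof. apply RtoC_neq; lra. Qed.

Lemma lambda_eq tau : HH tau -> lambda tau = 16 * expipi tau * lambda_red tau.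
Proof.
  intros Ht. unfold lambda, lambda_red. rewrite theta10_Theta by auto.
  replace (expipi tau) with (expipi (tau / 4) ^ 4).
  - field. apply theta00_neq_0, Ht.
  - unfold expipi. rewrite <- Cexp_INR. f_equal. simpl INR.
    replace (1 + 1 + 1 + 1)%R with 4%R by ring. field.
Qed.

Lemma one_sub_lambda_eq tau : HH tau -> 1 - lambda tau = theta01 tau ^ 4 / theta00 tau ^ 4.
Proof.
  intros Ht. rewrite lambda_eq by auto. unfold lambda_red.
  pose proof (Jacobi_identity tau Ht) as J. pose proof (theta00_neq_0 tau Ht) as Hn.
  replace (theta01 tau ^ 4) with (theta00 tau ^ 4 - expipi tau * theta10' tau ^ 4) by (rewrite J; ring).
  field; auto.
Qed.

(** [Theta_inversion] at [s = -1/tau] is evaluated at [z = 0] and [z = 1/2]. Its exponential at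
    [1/2] is exactly the factor [exp (i pi s / 4)] of [theta10], and the unknown [c] cancels in the
    quotient. *)
Lemma lambda_inversion tau : HH tau -> lambda (- (1) / tau) = 1 - lambda tau.
Proof.
  intros Ht. pose proof (HH_inv tau Ht) as Hs. rewrite one_sub_lambda_eq by auto.
  set (s := - (1) / tau) in *.
  assert (Hst : - (1) / s = tau) by (unfold s; field; apply HH_neq_0, Ht).
  destruct (Theta_inversion s Hs) as [c Hc]. rewrite Hst in Hc.
  pose proof (Hc 0) as E0. pose proof (Hc (1 / 2)) as E1.
  replace (s * (0 * 0)) with (RtoC 0) in E0 by ring. replace (s * 0) with (RtoC 0) in E0 by ring.
  rewrite expipi_0, Cmult_1_l, <- !theta00_Theta in E0.
  replace (s * (1 / 2 * (1 / 2))) with (s / 4) in E1 by (field; apply C4_neq_0).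
  replace (s * (1 / 2)) with (s / 2) in E1 by field.
  unfold lambda. rewrite theta10_Theta by auto. unfold theta10'. rewrite E1, E0.
  fold (theta01 tau). field. split; [apply theta00_neq_0, Ht|].
  intros Ec. apply (theta00_neq_0 s Hs). rewrite E0, Ec. ring.
Qed.

Lemma lambda_red_holo : holomorphic_on_HH lambda_red.
Proof.
  apply holo_scal, holo_div; try apply holo_pow; auto using theta10'_holo, theta00_holo.
  intros t Ht. apply Cpow_nz, theta00_neq_0, Ht.
Qed.

Lemma lambda_red_periodic : periodic2_on_HH lambda_red.
Proof. intros t Ht. unfold lambda_red. rewrite theta10'_periodic, theta00_periodic by auto. reflexivity. Qed.

Lemma lambda_red_limit : has_limit_at_ioo lambda_red 1.
Proof.
  replace (RtoC 1) with (/ 16 * (2 ^ 4 / 1 ^ 4)).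
  - apply ioo_limit_scal, ioo_limit_div; try apply ioo_limit_pow; auto using theta10'_limit, theta00_limit.
    apply Cpow_nz, C1_nz.
  - rewrite Cpow_1_l, <- RtoC_pow. replace (2 ^ 4)%R with 16%R by ring. field.
Qed.

Lemma lambda_red_neq_0 tau : HH tau -> lambda_red tau <> 0.
Proof.
  intros Ht. unfold lambda_red. apply Cmult_neq_0; [apply Cinv_neq_0, C16_neq_0|].
  apply Cmult_neq_0; [apply Cpow_nz, theta10'_neq_0, Ht|apply Cinv_neq_0, Cpow_nz, theta00_neq_0, Ht].
Qed.

Lemma one_sub_lambda_holo : holomorphic_on_HH (fun tau => 1 - lambda tau).
Proof.
  assert (H : holomorphic_on_HH (fun tau => theta01 tau ^ 4 / theta00 tau ^ 4)).
  { apply holo_div; try apply holo_pow; auto using theta01_holo, theta00_holo.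
    intros t Ht. apply Cpow_nz, theta00_neq_0, Ht. }
  intros tau Ht. destruct (H tau Ht) as [l Hl]. exists l.
  apply (Cderiv_ext_HH (fun tau => theta01 tau ^ 4 / theta00 tau ^ 4)); auto.
  intros; symmetry; apply one_sub_lambda_eq; auto.
Qed.

Lemma HH_plus_2 tau : HH tau -> HH (tau + 2).
Proof. unfold HH. ReIm. lra. Qed.

Lemma lambda_periodic : periodic2_on_HH lambda.
Proof.
  intros t Ht. rewrite !lambda_eq by auto using HH_plus_2.
  rewrite lambda_red_periodic, expipi_plus, expipi_2 by auto. ring.
Qed.

Lemma lambda_limit : has_limit_at_ioo lambda 0.
Proof.
  eapply ioo_limit_ext; [intros; symmetry; apply lambda_eq; auto|].
  replace (RtoC 0) with (16 * 0 * 1) by ring.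
  apply ioo_limit_mult; [apply ioo_limit_scal, expipi_limit|apply lambda_red_limit].
Qed.

Lemma one_sub_lambda_neq_0 tau : HH tau -> 1 - lambda tau <> 0.
Proof.
  intros Ht. rewrite one_sub_lambda_eq by auto.
  apply Cmult_neq_0; [apply Cpow_nz, theta01_neq_0, Ht|apply Cinv_neq_0, Cpow_nz, theta00_neq_0, Ht].
Qed.

(** * Reality on the imaginary axis and the choice of logarithms *)

Definition is_real (z : C) : Prop := Im z = 0%R.

Lemma is_real_RtoC r : is_real (RtoC r). Proof. reflexivity. Qed.

Lemma is_real_mult z w : is_real z -> is_real w -> is_real (z * w).
Proof. unfold is_real. intros H1 H2. rewrite Im_mult, H1, H2. ring. Qed.

Lemma is_real_minus z w : is_real z -> is_real w -> is_real (z - w).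
Proof. unfold is_real. intros H1 H2. rewrite Im_minus, H1, H2. ring. Qed.

Lemma is_real_inv z : is_real z -> is_real (/ z).
Proof. destruct z as [a b]; unfold is_real, Cinv; simpl; intros ->. unfold Rdiv. ring. Qed.

Lemma is_real_pow z n : is_real z -> is_real (z ^ n).
Proof. intros H. induction n; [reflexivity|apply is_real_mult; auto]. Qed.

Lemma is_real_CSeriesZ u : (forall n, is_real (u n)) -> is_real (CSeriesZ u).
Proof.
  intros H. unfold is_real, CSeriesZ, CSeries. ReIm.
  assert (Z : forall v : nat -> R, (forall n, v n = 0%R) -> Series v = 0%R).
  { intros v Hv. rewrite (Series_ext v (fun n => 0 * v n)%R) by (intros; rewrite Hv; ring).
    rewrite Series_scal_l. ring. }
  rewrite !Z; [ring|intros; apply H..].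
Qed.

Definition axis (y : R) : C := Ci * y.

Lemma is_real_expipi_axis (a y : R) : is_real (expipi (a * axis y)).
Proof.
  unfold is_real, expipi, axis, Cexp. ReIm.
  match goal with |- (_ * sin ?b)%R = _ => replace b with 0%R by ring end. rewrite sin_0; ring.
Qed.

Lemma HH_axis y : (0 < y)%R -> HH (axis y).
Proof. unfold HH, axis. ReIm. lra. Qed.

Lemma lambda_red_real y : is_real (lambda_red (axis y)).
Proof.
  unfold lambda_red. apply is_real_mult; [apply is_real_inv, is_real_RtoC|].
  apply is_real_mult; [|apply is_real_inv]; apply is_real_pow.
  - unfold theta10', Theta. apply is_real_CSeriesZ. intros n. unfold theta_term.
    replace (IZR n ^ 2 * axis y + 2 * IZR n * (axis y / 2)) with ((IZR n ^ 2 + IZR n)%R * axis y)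
      by (rewrite RtoC_plus, RtoC_pow; field).
    apply is_real_expipi_axis.
  - unfold theta00. apply is_real_CSeriesZ. intros n. rewrite <- RtoC_pow. apply is_real_expipi_axis.
Qed.

Lemma lambda_real y : (0 < y)%R -> is_real (lambda (axis y)).
Proof.
  intros Hy. rewrite lambda_eq by (apply HH_axis; auto).
  apply is_real_mult; [apply is_real_mult; [apply is_real_RtoC|]|apply lambda_red_real].
  rewrite <- (Cmult_1_l (axis y)). apply is_real_expipi_axis.
Qed.

(* [Im L] takes values in [pi Z] on the imaginary axis and tends to 0. *)
Lemma log_real L : holomorphic_on_HH L -> has_limit_at_ioo L 0 ->
  (forall y, (0 < y)%R -> is_real (Cexp (L (axis y)))) ->
  forall y, (0 < y)%R -> is_real (L (axis y)).
Proof.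
  intros HL Hlim Hreal y Hy. unfold is_real.
  (* The parameter [exp t] covers the half axis by the whole line, where the intermediate value
     theorem is stated. *)
  set (h := fun t => Im (L (axis (exp t)))).
  assert (Hsin : forall t, sin (h t) = 0%R).
  { intros t. pose proof (Hreal (exp t) (exp_pos t)) as H. unfold is_real, Cexp in H. simpl in H.
    fold (h t) in H. pose proof (exp_pos (Re (L (axis (exp t))))).
    apply Rmult_integral in H. destruct H as [H|H]; [lra|exact H]. }
  assert (Hcont : continuity h).
  { intros t. apply continuity_pt_filterlim.
    destruct (HL (axis (exp t)) (HH_axis _ (exp_pos t))) as [l Hl].
    assert (HR : rcont (fun s : R => L (0 + s * Ci)) (exp t)).
    { apply rcont_line. replace (0 + exp t * Ci) with (axis (exp t)) by (unfold axis; ring).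
      eapply Cderiv_Ccont, Hl. }
    apply (continuous_comp (fun t => exp t) (fun s => Im (L (axis s)))).
    - apply continuity_pt_filterlim, derivable_continuous_pt, derivable_pt_exp.
    - apply rcont_continuous_Im. apply (rcont_ext (fun s : R => L (0 + s * Ci))); auto.
      intros s. f_equal. unfold axis; ring. }
  replace y with (exp (ln y)) by (apply exp_ln; auto). fold (h (ln y)).
  destruct (Hlim 1%R ltac:(lra)) as [Y HY].
  set (T := ln (Rabs Y + 1)). pose proof (Rabs_pos Y). pose proof (Rle_abs Y).
  assert (HT : (Rabs (h T) < 1)%R).
  { unfold h, T. rewrite exp_ln by lra.
    specialize (HY (axis (Rabs Y + 1)) (HH_axis (Rabs Y + 1) ltac:(lra)) ltac:(unfold axis; ReIm; lra)).
    replace (L (axis (Rabs Y + 1)) - 0) with (L (axis (Rabs Y + 1))) in HY by ring.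
    eapply Rle_lt_trans; [apply Im_le_Cmod|exact HY]. }
  apply Rabs_def2 in HT.
  pose proof PI2_1 as HPI. unfold PI2 in HPI.
  assert (Hs : forall x, (0 < x < PI)%R -> sin x <> 0%R).
  { intros x Hx. apply Rgt_not_eq, sin_gt_0; lra. }
  assert (Hno : forall v, (0 < Rabs v < PI)%R -> forall t, h t <> v).
  { intros v Hv t E. pose proof (Hsin t) as S. rewrite E in S.
    unfold Rabs in Hv. destruct Rcase_abs.
    - apply (Hs (- v)%R); [lra|]. rewrite sin_neg, S; ring.
    - apply (Hs v); auto. }
  (* Nonzero values of modulus below [pi] are excluded by [sin (h t) = 0]. Since [|h T| < 1], a
     larger value would make [h] pass through 2 or -2, which are such values. *)
  destruct (Rtotal_order (h (ln y)) 0) as [Hlt|[E|Hgt]]; [|exact E|]; exfalso.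
  - destruct (Rlt_le_dec (-2) (h (ln y))).
    + apply (Hno (h (ln y))) with (ln y); [|reflexivity]. rewrite Rabs_left; lra.
    + destruct (IVT_gen h (ln y) T (-2)%R Hcont) as [x [_ Hx]].
      { rewrite Rmin_left, Rmax_right by lra. lra. }
      apply (Hno (-2)%R) with x; auto. rewrite Rabs_left; lra.
  - destruct (Rlt_le_dec (h (ln y)) 2).
    + apply (Hno (h (ln y))) with (ln y); [|reflexivity]. rewrite Rabs_pos_eq; lra.
    + destruct (IVT_gen h (ln y) T 2%R Hcont) as [x [_ Hx]].
      { rewrite Rmin_right, Rmax_left by lra. lra. }
      apply (Hno 2%R) with x; auto. rewrite Rabs_pos_eq; lra.
Qed.

Lemma Cderiv_unique f (z a b : C) : Cderiv f z a -> Cderiv f z b -> a = b.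
Proof.
  intros Ha Hb. rewrite <- (is_C_derive_unique f z a Ha). apply is_C_derive_unique, Hb.
Qed.

(** Differentiating the constant [Cexp D] gives [D' = 0]. *)
Lemma Cexp_eq_1_const D : holomorphic_on_HH D -> (forall tau, HH tau -> Cexp (D tau) = 1) ->
  forall z w, HH z -> HH w -> D z = D w.
Proof.
  intros HD H1. apply zero_deriv_const_HH. intros tau Ht.
  destruct (HD tau Ht) as [l Hl]. change (Cderiv D tau l) in Hl.
  pose proof (Cderiv_Cexp _ _ _ Hl) as E. rewrite H1 in E by auto.
  assert (El : 1 * l = 0).
  { eapply Cderiv_unique; [exact E|]. apply (Cderiv_ext_HH (fun _ => 1)); auto using Cderiv_const.
    intros; symmetry; auto. }
  rewrite Cmult_1_l in El. rewrite El in Hl. exact Hl.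
Qed.

(** The exponentials of both sides of the last relation agree by [lambda_inversion], so the sides
    differ by a constant in [2 i pi Z], which is evaluated at the fixed point [i]. *)
Theorem lambda_logarithms : exists L M : C -> C,
  holomorphic_on_HH L /\ holomorphic_on_HH M /\ periodic2_on_HH L /\ periodic2_on_HH M /\
  has_limit_at_ioo L 0 /\ has_limit_at_ioo M 0 /\
  (forall tau, HH tau -> Cexp (L tau) = lambda_red tau) /\
  (forall tau, HH tau -> Cexp (M tau) = 1 - lambda tau) /\
  (forall tau, HH tau -> ln 16 + Ci * PI * (- (1) / tau) + L (- (1) / tau) = M tau).
Proof.
  destruct (log_exists lambda_red lambda_red_holo lambda_red_periodic lambda_red_limit lambda_red_neq_0)
    as [L [HL [HLp [HLl HLe]]]].
  destruct (log_exists (fun tau => 1 - lambda tau)) as [M [HM [HMp [HMl HMe]]]].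
  { apply one_sub_lambda_holo. }
  { intros t Ht. rewrite lambda_periodic; auto. }
  { pose proof (ioo_limit_minus _ _ _ _ (ioo_limit_const 1) lambda_limit) as H.
    replace (1 - 0) with (RtoC 1) in H by ring. exact H. }
  { apply one_sub_lambda_neq_0. }
  exists L, M. repeat (split; [assumption|]).
  set (D := fun tau => ln 16 + Ci * PI * (- (1) / tau) + L (- (1) / tau) - M tau).
  assert (HD : holomorphic_on_HH D).
  { apply holo_minus; [|auto].
    assert (Hinv : holomorphic_on_HH (fun tau => - (1) / tau)).
    { apply holo_div; [apply holo_const| |apply HH_neq_0].
      intros t _. exists (RtoC 1). apply Cderiv_id. }
    apply holo_plus; [apply holo_plus; [apply holo_const|apply holo_scal, Hinv]|].
    apply (holo_comp L); auto. apply HH_inv. }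
  assert (HD1 : forall tau, HH tau -> Cexp (D tau) = 1).
  { intros tau Ht. pose proof (HH_inv tau Ht) as Hs. unfold D.
    rewrite Cexp_minus, !Cexp_plus, HLe, HMe by auto.
    rewrite <- lambda_inversion by auto. rewrite lambda_eq by auto.
    rewrite Cexp_R, exp_ln by lra. unfold expipi. field.
    split; auto using Cexp_neq_0, lambda_red_neq_0. }
  assert (Hi : HH Ci) by (unfold HH; ReIm; lra).
  assert (Eax : Ci = axis 1) by (unfold axis; ring).
  assert (Einv : - (1) / Ci = Ci).
  { unfold Cdiv. rewrite Ci_inv. apply C_eq; ReIm; ring. }
  assert (RL : is_real (L Ci)).
  { rewrite Eax. apply (log_real L HL HLl); [|lra]. intros y Hy. rewrite HLe by (apply HH_axis; auto).
    apply lambda_red_real. }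
  assert (RM : is_real (M Ci)).
  { rewrite Eax. apply (log_real M HM HMl); [|lra]. intros y Hy. rewrite HMe by (apply HH_axis; auto).
    apply is_real_minus; [apply is_real_RtoC|apply lambda_real; auto]. }
  (* At [i] the difference has no imaginary part by reality, and no real part because its
     exponential has modulus 1. *)
  assert (HDi : D Ci = 0).
  { assert (HIm : Im (D Ci) = 0%R).
    { unfold D. rewrite Einv. unfold is_real in *. ReIm. rewrite RL, RM. ring. }
    pose proof (HD1 Ci Hi) as E.
    assert (HRe : Re (D Ci) = 0%R).
    { apply (f_equal Cmod) in E. rewrite Cmod_Cexp, Cmod_1 in E.
      rewrite <- (ln_exp (Re (D Ci))), E. apply ln_1. }
    apply C_eq; [rewrite HRe|rewrite HIm]; reflexivity. }
  intros tau Ht. apply Ceq_minus. change (D tau = 0). rewrite <- HDi.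
  apply (Cexp_eq_1_const D HD HD1); auto.
Qed.

(** The bound [3 <= pi] places [Im d / (2 pi)] in the interval where [ek_eq_1_R] applies. *)
Lemma Cexp_eq_1_small d : (Cmod d <= 3)%R -> Cexp d = 1 -> d = 0.
Proof.
  intros Hd E.
  assert (HRe : Re d = 0%R).
  { assert (E' := f_equal Cmod E). rewrite Cmod_Cexp, Cmod_1 in E'.
    rewrite <- (ln_exp (Re d)), E'. apply ln_1. }
  pose proof PI2_3_2 as HPI. unfold PI2 in HPI.
  assert (HIm : (Rabs (Im d) <= 3)%R) by (eapply Rle_trans; [apply Im_le_Cmod|exact Hd]).
  apply Rabs_le_between in HIm.
  assert (HP : (0 < PI)%R) by lra.
  assert (Ht : Im d = (2 * PI * (Im d / (2 * PI)))%R) by (field; lra).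
  set (t := (Im d / (2 * PI))%R) in *.
  assert (Et : t = 0%R).
  { apply ek_eq_1_R.
    - split; apply Rmult_le_reg_r with (2 * PI)%R; lra.
    - rewrite <- E. unfold ek. f_equal. apply C_eq; ReIm; [rewrite HRe; ring|rewrite Ht; ring]. }
  apply C_eq; [exact HRe|]. rewrite Ht, Et. simpl; ring.
Qed.

(** * Powers *)

(** [G] itself witnesses that the choice in [continuation] is not void; the chosen function agrees
    with it near [i oo], and the identity theorem does the rest. *)
Lemma continuation_eq F G y0 : holomorphic_on_HH G ->
  (forall tau, HH tau -> (y0 < Im tau)%R -> G tau = F tau) ->
  forall tau, HH tau -> continuation F tau = G tau.
Proof.
  intros HG E.
  assert (S : holomorphic_on_HH (continuation F) /\ exists y1 : R, forall tau, HH tau ->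
    (y1 < Im tau)%R -> continuation F tau = F tau).
  { unfold continuation. apply epsilon_spec. exists G. split; [exact HG|]. exists y0. exact E. }
  destruct S as [HC [y1 E1]]. intros tau Ht. apply Ceq_minus.
  apply (identity_HH (fun t => continuation F t - G t) (Rmax y0 y1)); auto using holo_minus.
  intros t Ht' Hy. pose proof (Rmax_l y0 y1). pose proof (Rmax_r y0 y1).
  rewrite E1, E by (auto; lra). ring.
Qed.

(** The ratio of consecutive coefficients is at most [(|w| + j) / (j + 1) <= 1 + eps <= exp eps] as
    soon as [|w| <= eps j]; the finitely many earlier ones only enlarge the constant. *)
Lemma gbinom_subexp w : subexp (fun k => RtoC (gbinom w k)).
Proof.
  intros eps He.
  destruct (archimed_cor1 (eps / (Rabs w + 1))) as [J [HJ1 HJ2]].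
  { apply Rdiv_lt_0_compat; pose proof (Rabs_pos w); lra. }
  pose proof (Rabs_pos w) as Hw.
  assert (HJ : (Rabs w <= eps * INR J)%R).
  { assert (HJp : (0 < INR J)%R) by (apply lt_0_INR; auto).
    apply Rmult_lt_compat_r with (r := (INR J * (Rabs w + 1))%R) in HJ1; [|nra].
    replace (/ INR J * (INR J * (Rabs w + 1)))%R with (Rabs w + 1)%R in HJ1 by (field; lra).
    replace (eps / (Rabs w + 1) * (INR J * (Rabs w + 1)))%R with (eps * INR J)%R in HJ1 by (field; lra). lra. }
  assert (Hratio : forall j, (J <= j)%nat -> (Rabs (gbinom w (S j)) <= Rabs (gbinom w j) * exp eps)%R).
  { intros j Hj. apply le_INR in Hj.
    change (gbinom w (S j)) with (gbinom w j * (w - INR j) / INR (S j))%R.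
    pose proof (pos_INR j) as Hj0. rewrite S_INR.
    unfold Rdiv. rewrite !Rabs_mult, Rmult_assoc. apply Rmult_le_compat_l; [apply Rabs_pos|].
    rewrite Rabs_inv, (Rabs_pos_eq (INR j + 1)) by lra.
    apply Rmult_le_reg_r with (INR j + 1)%R; [lra|]. rewrite Rmult_assoc, Rinv_l, Rmult_1_r by lra.
    pose proof (exp_ineq1_le eps) as HE.
    apply Rle_trans with (Rabs w + INR j)%R.
    - unfold Rminus. eapply Rle_trans; [apply Rabs_triang|]. rewrite Rabs_Ropp, (Rabs_pos_eq (INR j)); lra.
    - apply Rle_trans with ((1 + eps) * (INR j + 1))%R; [nra|]. apply Rmult_le_compat_r; lra. }
  assert (Hfin : forall m, exists M : R, forall n, (n <= m)%nat -> (Rabs (gbinom w n) <= M * exp (eps * INR n))%R).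
  { induction m as [|m [M HM]].
    - exists (Rabs (gbinom w 0)). intros n Hn. replace n with O by lia.
      simpl INR. rewrite Rmult_0_r, exp_0. lra.
    - exists (Rmax M (Rabs (gbinom w (S m)))). intros n Hn.
      destruct (Nat.eq_dec n (S m)) as [->|Hne].
      + pose proof (exp_ineq1_le (eps * INR (S m))) as HE. pose proof (pos_INR (S m)).
        pose proof (Rmax_r M (Rabs (gbinom w (S m)))). pose proof (Rabs_pos (gbinom w (S m))).
        assert (1 <= exp (eps * INR (S m)))%R by nra. nra.
      + eapply Rle_trans; [apply HM; lia|]. apply Rmult_le_compat_r; [left; apply exp_pos|apply Rmax_l]. }
  destruct (Hfin J) as [M HM]. exists M.
  assert (Hall : forall k, (Rabs (gbinom w (J + k)) <= M * exp (eps * INR (J + k)))%R).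
  { induction k.
    - rewrite Nat.add_0_r. apply HM; lia.
    - rewrite Nat.add_succ_r. eapply Rle_trans; [apply Hratio; lia|].
      rewrite S_INR, Rmult_plus_distr_l, Rmult_1_r, exp_plus, <- Rmult_assoc.
      apply Rmult_le_compat_r; [left; apply exp_pos|exact IHk]. }
  intros n. rewrite Cmod_R. destruct (le_dec n J) as [Hn|Hn]; [apply HM, Hn|].
  replace n with (J + (n - J))%nat by lia. apply Hall.
Qed.

Lemma one_plus_q_neq_0 tau : HH tau -> 1 + expipi tau <> 0.
Proof.
  intros Ht E. pose proof (Cmod_expipi tau) as H. pose proof PI_RGT_0.
  replace (expipi tau) with (1 + expipi tau - 1) in H by ring. rewrite E in H.
  replace (0 - 1) with (- (1)) in H by ring. rewrite Cmod_m1 in H.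
  assert (exp (- (PI * Im tau)) < exp 0)%R; [|rewrite exp_0 in *; lra].
  apply exp_increasing. unfold HH in Ht. nra.
Qed.

(* Both sides solve [(1 + q) y' = i pi w q y], where ['] is d/dtau. *)
Lemma gbinom_qfull w l : holomorphic_on_HH l -> has_limit_at_ioo l 0 ->
  (forall tau, HH tau -> Cexp (l tau) = 1 + expipi tau) ->
  forall tau, HH tau -> qfull (fun k => RtoC (gbinom w k)) tau = Cexp (w * l tau).
Proof.
  intros Hl Hlim He.
  set (b := fun k => RtoC (gbinom w k)). pose proof (gbinom_subexp w) as Hb. fold b in Hb.
  set (B' := qfull (fun n => b n * qfreq n)).
  (* Coefficientwise this is [(k + 1) b_(k+1) = (w - k) b_k]; the term of index 0 in the
     differentiated series is 0, so the shift loses nothing. *)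
  assert (HODE : forall tau, HH tau -> (1 + expipi tau) * B' tau = w * (Ci * PI) * expipi tau * qfull b tau).
  { intros tau Ht.
    pose proof (qfull_correct _ (subexp_deriv b Hb) tau Ht) as H1.
    pose proof (is_Cseries_tail _ _ H1) as H2. cbv beta in H2.
    pose proof (is_Cseries_minus _ _ _ _
      (is_Cseries_scal (w * (Ci * PI) * expipi tau) _ _ (qfull_correct b Hb tau Ht))
      (is_Cseries_scal (expipi tau) _ _ H1)) as H3. cbv beta in H3.
    assert (E : B' tau - b O * qfreq 0 * expipi (INR 0 * tau) =
      w * (Ci * PI) * expipi tau * qfull b tau - expipi tau * B' tau).
    { eapply is_Cseries_unique; [exact H2|]. eapply is_Cseries_ext; [|exact H3].
      intros n. cbv beta. unfold b, qfreq.
      change (gbinom w (S n)) with (gbinom w n * (w - INR n) / INR (S n))%R.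
      rewrite S_INR. replace ((INR n + 1)%R * tau) with (INR n * tau + tau) by (rewrite RtoC_plus; ring).
      rewrite expipi_plus.
      pose proof (pos_INR n). rewrite RtoC_div, RtoC_mult, RtoC_minus by lra.
      field. apply RtoC_neq. lra. }
    replace (b O * qfreq 0 * expipi (INR 0 * tau)) with (RtoC 0) in E by (unfold qfreq; simpl INR; ring).
    transitivity (B' tau - 0 + expipi tau * B' tau); [ring|]. rewrite E. ring. }
  assert (Hd : forall tau, HH tau -> Cderiv l tau (expipi tau * (Ci * PI) / (1 + expipi tau))).
  { intros tau Ht. assert (Hex : exists m : C, Cderiv l tau m) by exact (Hl tau Ht). destruct Hex as [m Hm].
    eapply Cderiv_eq; [exact Hm|].
    assert (E : Cexp (l tau) * m = 0 + expipi tau * (Ci * PI * 1)).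
    { apply (Cderiv_unique (fun t => Cexp (l t)) tau); [apply Cderiv_Cexp, Hm|].
      apply (Cderiv_ext_HH (fun t => 1 + expipi t)); auto; [intros; symmetry; auto|].
      apply Cderiv_plus; [apply Cderiv_const|apply (Cderiv_expipi (fun t => t)), Cderiv_id]. }
    rewrite He in E by auto. pose proof (one_plus_q_neq_0 tau Ht).
    transitivity ((1 + expipi tau) * m / (1 + expipi tau)); [field; auto|]. rewrite E. field; auto. }
  intros tau Ht.
  assert (HK : qfull b tau * Cexp (- (w * l tau)) = 1).
  { apply (zero_deriv_limit (fun t => qfull b t * Cexp (- (w * l t)))); auto.
    - intros t Ht'. eapply Cderiv_eq.
      + apply Cderiv_mult; [apply Cderiv_qfull; auto|].
        apply Cderiv_Cexp, Cderiv_opp, Cderiv_scal, Hd, Ht'.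
      + cbv beta. fold B'. pose proof (one_plus_q_neq_0 t Ht').
        transitivity (Cexp (- (w * l t)) / (1 + expipi t) *
          ((1 + expipi t) * B' t - w * (Ci * PI) * expipi t * qfull b t)); [field; auto|].
        rewrite HODE by auto. ring.
    - replace (RtoC 1) with (b O * Cexp (- w * 0)).
      + apply ioo_limit_mult; [apply qfull_limit, Hb|]. apply ioo_limit_exp.
        eapply ioo_limit_ext; [|apply (ioo_limit_scal (- w)), Hlim]. intros; cbv beta; ring.
      + replace (- w * 0) with (RtoC 0) by ring. rewrite Cexp_0. unfold b; simpl. ring. }
  rewrite Cexp_opp in HK. pose proof (Cexp_neq_0 (w * l tau)).
  transitivity (qfull b tau * / Cexp (w * l tau) * Cexp (w * l tau)); [field; auto|]. rewrite HK; ring.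
Qed.

(** A small [z <> 0] is [exp (i pi s)] with [s] high, so [gbinom_qfull] applies at [s]. The
    logarithms [l s] and [e] of [1 + z] both have modulus below 1 and therefore coincide. The value
    [z = 0] is not such an exponential and is treated apart. *)
Lemma binomial_series_exp w : exists r : R, (0 < r)%R /\ forall z e : C,
  (Cmod z < r)%R -> (Cmod e < 1)%R -> Cexp e = 1 + z -> binomial_series w z = Cexp (w * e).
Proof.
  destruct (log_exists (fun t => 1 + expipi t)) as [l [Hl [_ [Hlim He]]]].
  { apply holo_plus; [apply holo_const|apply holo_expipi]. }
  { intros t _. rewrite expipi_plus, expipi_2, Cmult_1_r. reflexivity. }
  { pose proof (ioo_limit_plus _ _ _ _ (ioo_limit_const 1) expipi_limit) as H.
    rewrite Cplus_0_r in H. exact H. }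
  { apply one_plus_q_neq_0. }
  destruct (Hlim 1%R ltac:(lra)) as [Y HY].
  exists (exp (- (PI * (Rabs Y + 1)))). split; [apply exp_pos|].
  intros z e Hz He1 Hez.
  destruct (Req_dec (Cmod z) 0) as [E|E].
  - apply Cmod_eq_0 in E. subst z. rewrite Cplus_0_r in Hez.
    assert (E0 : e = 0) by (apply Cexp_eq_1_small; auto; lra).
    rewrite E0, Cmult_0_r, Cexp_0. unfold binomial_series. apply CSeries_unique.
    replace (RtoC 1) with (gbinom w 0 * 0 ^ 0 + 0) by (simpl; ring).
    apply (is_Cseries_cons (fun k => gbinom w k * 0 ^ k)).
    eapply is_Cseries_ext; [|apply is_Cseries_0]. intros n. simpl. ring.
  - destruct (Cexp_surj z) as [z0 Hz0].
    { intros E'; apply E; rewrite E'; apply Cmod_0. }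
    assert (HPI : RtoC PI <> 0) by (apply RtoC_neq, PI_neq0).
    pose proof PI_RGT_0.
    set (s := z0 / (Ci * PI)).
    assert (Es : expipi s = z).
    { unfold expipi, s. rewrite <- Hz0. f_equal. field. split; auto. apply Ci_nz. }
    rewrite <- Es, Cmod_expipi in Hz. apply exp_lt_inv in Hz.
    pose proof (Rabs_pos Y). pose proof (Rle_abs Y).
    assert (Hs1 : (Rabs Y + 1 < Im s)%R) by nra.
    assert (Hs : HH s) by (unfold HH; lra).
    specialize (HY s Hs ltac:(lra)). replace (l s - 0) with (l s) in HY by ring.
    assert (El : l s = e).
    { apply Ceq_minus, Cexp_eq_1_small.
      - eapply Rle_trans; [apply Cmod_triangle_minus|lra].
      - rewrite Cexp_minus, He, Es, <- Hez by auto. field. apply Cexp_neq_0. }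
    rewrite <- El, <- (gbinom_qfull w l Hl Hlim He s Hs).
    unfold binomial_series, qfull. apply CSeries_ext. intros k. f_equal.
    rewrite <- Es. unfold expipi. rewrite <- Cexp_INR. f_equal; ring.
Qed.

Lemma binomial_continuation w F L : holomorphic_on_HH L -> has_limit_at_ioo L 0 ->
  has_limit_at_ioo F 0 -> (forall tau, HH tau -> Cexp (L tau) = 1 + F tau) ->
  forall tau, HH tau -> continuation (fun t => binomial_series w (F t)) tau = Cexp (w * L tau).
Proof.
  intros HL HLl HFl He.
  destruct (binomial_series_exp w) as [r [Hr Hb]].
  destruct (HLl 1%R ltac:(lra)) as [Y1 H1]. destruct (HFl r Hr) as [Y2 H2].
  apply (continuation_eq _ _ (Rmax Y1 Y2)).
  - apply holo_exp, holo_scal, HL.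
  - intros tau Ht Hy. pose proof (Rmax_l Y1 Y2). pose proof (Rmax_r Y1 Y2). symmetry. apply Hb.
    + replace (F tau) with (F tau - 0) by ring. apply H2; auto; lra.
    + replace (L tau) with (L tau - 0) by ring. apply H1; auto; lra.
    + apply He, Ht.
Qed.

Lemma lambda_hat_spec tau : HH tau -> is_series (qterm lambda_hat tau) (lambda tau).
Proof.
  revert tau. unfold lambda_hat. apply epsilon_spec.
  assert (HL : holomorphic_on_HH lambda).
  { intros tau Ht. destruct (holo_minus _ _ (holo_const 1) one_sub_lambda_holo tau Ht) as [l Hl].
    exists l. apply (Cderiv_ext (fun tau => 1 - (1 - lambda tau))); [intros; ring|exact Hl]. }
  destruct (q_expansion_limit lambda 0 HL lambda_periodic lambda_limit) as [c [Hc [Hc0 E]]].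
  exists c. intros tau Ht. rewrite E by auto.
  pose proof (is_Cseries_tail _ _ (qfull_correct c Hc tau Ht)) as H. cbv beta in H.
  rewrite Hc0 in H. replace (qfull c tau - _) with (qfull c tau) in H by ring. exact H.
Qed.

(** Dividing the series of [lambda] by [exp (i pi tau)] gives [16 lambda_red]; its limit at [i oo]
    yields the coefficient [lambda_hat 1 = 16]. *)
Lemma lambda_hat_qseries tau : HH tau ->
  / 16 * qseries (fun n => lambda_hat (S n)) tau = lambda_red tau - 1.
Proof.
  assert (Hs : subexp lambda_hat).
  { apply converges_subexp. intros t Ht. exists (lambda t). apply lambda_hat_spec, Ht. }
  set (c := fun n => lambda_hat (S n)).
  assert (Hc : subexp c).
  { intros eps He. destruct (Hs eps He) as [M HM]. exists (M * exp eps)%R. intros n.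
    eapply Rle_trans; [apply HM|]. right. rewrite S_INR, Rmult_assoc, <- exp_plus. do 2 f_equal. ring. }
  assert (E : forall t, HH t -> qfull c t = 16 * lambda_red t).
  { intros t Ht. pose proof (is_Cseries_scal (expipi t) _ _ (qfull_correct c Hc t Ht)) as H.
    assert (E : expipi t * qfull c t = lambda t).
    { eapply is_Cseries_unique; [exact H|]. eapply is_Cseries_ext; [|apply (lambda_hat_spec t Ht)].
      intros n. cbv beta. unfold qterm, c. rewrite S_INR.
      replace ((INR n + 1)%R * t) with (INR n * t + t) by (rewrite RtoC_plus; ring).
      rewrite expipi_plus. ring. }
    apply (expipi_cancel t). rewrite E, lambda_eq by auto. ring. }
  assert (Hc0 : c O = 16).
  { apply (ioo_limit_unique (qfull c)); [apply qfull_limit, Hc|].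
    eapply ioo_limit_ext; [intros; symmetry; apply E; auto|].
    pose proof (ioo_limit_scal 16 _ _ lambda_red_limit) as H. rewrite Cmult_1_r in H. exact H. }
  intros Ht. pose proof (qfull_split c Hc tau Ht) as Hq. rewrite E, Hc0 in Hq by auto.
  replace (qseries c tau) with (16 + qseries c tau - 16) by ring. rewrite Hq. field.
Qed.

(** [L] and [M] serve all exponents [w] at once, so products and inverses of powers reduce to sums
    of exponents. *)
Lemma lambda_powers : exists L M : C -> C,
  holomorphic_on_HH L /\ holomorphic_on_HH M /\ periodic2_on_HH L /\ periodic2_on_HH M /\
  has_limit_at_ioo L 0 /\ has_limit_at_ioo M 0 /\
  (forall w tau, HH tau -> lambda_pow w tau = Rpower 16 w * expipi (w * tau) * Cexp (w * L tau)) /\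
  (forall w tau, HH tau -> one_sub_lambda_pow w tau = Cexp (w * M tau)) /\
  (forall w tau, HH tau -> lambda_pow w (- (1) / tau) = one_sub_lambda_pow w tau).
Proof.
  destruct lambda_logarithms as [L [M [HL [HM [HLp [HMp [HLl [HMl [HLe [HMe Hinv]]]]]]]]]].
  exists L, M. do 6 (split; [assumption|]).
  assert (H1 : forall w tau, HH tau -> lambda_pow w tau = Rpower 16 w * expipi (w * tau) * Cexp (w * L tau)).
  { intros w tau Ht. unfold lambda_pow. f_equal.
    assert (Hlim : has_limit_at_ioo (fun t => / 16 * qseries (fun n => lambda_hat (S n)) t) 0).
    { eapply ioo_limit_ext; [intros; symmetry; apply lambda_hat_qseries; auto|].
      pose proof (ioo_limit_minus _ _ _ _ lambda_red_limit (ioo_limit_const 1)) as H.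
      replace (1 - 1) with (RtoC 0) in H by ring. exact H. }
    apply (binomial_continuation w (fun t => / 16 * qseries (fun n => lambda_hat (S n)) t)); auto.
    intros t Ht'. rewrite lambda_hat_qseries, HLe by auto. ring. }
  assert (H2 : forall w tau, HH tau -> one_sub_lambda_pow w tau = Cexp (w * M tau)).
  { intros w tau Ht. unfold one_sub_lambda_pow.
    apply (binomial_continuation w (fun t => - lambda t)); auto.
    pose proof (ioo_limit_scal (- (1)) _ _ lambda_limit) as H. rewrite Cmult_0_r in H.
    eapply ioo_limit_ext; [|exact H]. intros; cbv beta; ring. }
  split; [exact H1|]. split; [exact H2|].
  intros w tau Ht. rewrite H1, H2 by auto using HH_inv. rewrite <- Hinv by auto.
  unfold Rpower. rewrite <- Cexp_R. unfold expipi. rewrite <- !Cexp_plus. f_equal.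
  rewrite RtoC_mult. ring.
Qed.

(** * Transfer between the two expansions *)

Lemma qfull_exp_mult L M (u v : R) (k : C) t : holomorphic_on_HH L -> holomorphic_on_HH M ->
  periodic2_on_HH L -> periodic2_on_HH M -> has_limit_at_ioo L 0 -> has_limit_at_ioo M 0 -> subexp t ->
  exists a, subexp a /\ a O = k * t O /\
    forall tau, HH tau -> qfull a tau = k * Cexp (u * L tau) * Cexp (v * M tau) * qfull t tau.
Proof.
  intros HL HM HLp HMp HLl HMl Ht.
  destruct (q_expansion_limit (fun tau => k * Cexp (u * L tau) * Cexp (v * M tau) * qfull t tau) (k * t O))
    as [a [Ha [Ha0 E]]].
  - apply holo_mult; [|apply qfull_holo, Ht].
    apply holo_mult; [apply holo_scal|]; apply holo_exp, holo_scal; auto.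
  - intros tau Hh. rewrite HLp, HMp, qfull_periodic by auto. reflexivity.
  - assert (HLe : has_limit_at_ioo (fun tau => Cexp (u * L tau)) 1).
    { rewrite <- Cexp_0. apply ioo_limit_exp.
      pose proof (ioo_limit_scal u _ _ HLl) as H. rewrite Cmult_0_r in H. exact H. }
    assert (HMe : has_limit_at_ioo (fun tau => Cexp (v * M tau)) 1).
    { rewrite <- Cexp_0. apply ioo_limit_exp.
      pose proof (ioo_limit_scal v _ _ HMl) as H. rewrite Cmult_0_r in H. exact H. }
    pose proof (ioo_limit_mult _ _ _ _ (ioo_limit_mult _ _ _ _ (ioo_limit_scal k _ _ HLe) HMe)
      (qfull_limit t Ht)) as H.
    rewrite !Cmult_1_r in H. exact H.
  - exists a. split; [exact Ha|]. split; [exact Ha0|]. intros tau Hh. symmetry. apply (E tau Hh).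
Qed.

(** [qseries] starts at exponent 1 and [qfull] at 0. With constant term 0 the two agree, and
    multiplication keeps the constant term 0. *)
Definition drop_0 (t : nat -> C) (n : nat) : C := match n with O => 0 | _ => t n end.

Lemma drop_0_subexp t : subexp t -> subexp (drop_0 t).
Proof.
  intros H eps He. destruct (H eps He) as [M HM]. exists M. intros [|n]; [|apply (HM (S n))].
  simpl drop_0. rewrite Cmod_0. eapply Rle_trans; [apply Cmod_ge_0|apply (HM O)].
Qed.

Lemma qseries_drop_0 t tau : subexp t -> HH tau -> qseries t tau = qfull (drop_0 t) tau.
Proof.
  intros Hs Ht. rewrite <- (qfull_split (drop_0 t)) by (auto using drop_0_subexp).
  simpl. rewrite Cplus_0_l. reflexivity.
Qed.

Theorem proposition3p10p1 (w1 w2 : R) (f g : C -> C)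
    (hf : holomorphic_on_HH f) (hg : holomorphic_on_HH g)
    (hfg : forall tau, HH tau ->
       g tau = lambda_pow (- w1) tau * lambda_pow (- w2) (- (1) / tau) * f tau) :
  (forall ta tb : nat -> C, hyperbolic_expansion g ta tb ->
     exists a b : nat -> C,
       skewed_hyperbolic_expansion w1 w2 f a b /\
       subexponential a /\ subexponential b /\
       subexponential ta /\ subexponential tb /\
       expansions_related w1 w2 a b ta tb) /\
  (forall a b : nat -> C, skewed_hyperbolic_expansion w1 w2 f a b ->
     exists ta tb : nat -> C,
       hyperbolic_expansion g ta tb /\
       subexponential a /\ subexponential b /\
       subexponential ta /\ subexponential tb /\
       expansions_related w1 w2 a b ta tb).
Proof.
  destruct lambda_powers as [L [M [HL [HM [HLp [HMp [HLl [HMl [Hlam [Hone Hinv]]]]]]]]]].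
  assert (Hinvol : forall tau, HH tau -> - (1) / (- (1) / tau) = tau).
  { intros tau Ht. field. apply HH_neq_0, Ht. }
  assert (HR : forall w, RtoC (Rpower 16 (- w)) * Rpower 16 w = 1).
  { intros w. rewrite <- RtoC_mult, <- Rpower_plus, Rplus_opp_l, Rpower_O by lra. reflexivity. }
  assert (HE : forall (w : R) z, Cexp ((- w)%R * z) * Cexp (w * z) = 1).
  { intros w z. rewrite RtoC_opp, <- Cexp_plus, <- Cexp_0. f_equal; ring. }
  assert (Hpow : forall w tau, HH tau -> lambda_pow (- w) tau * lambda_pow w tau = 1).
  { intros w tau Ht. rewrite !Hlam by auto.
    transitivity (RtoC (Rpower 16 (- w)) * Rpower 16 w * (expipi (- (w * tau)) * expipi (w * tau)) *
      (Cexp ((- w)%R * L tau) * Cexp (w * L tau))).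
    - rewrite RtoC_opp. replace (- w * tau) with (- (w * tau)) by ring. ring.
    - rewrite HR, HE, expipi_opp. ring. }
  assert (Hinv' : forall w tau, HH tau -> one_sub_lambda_pow w (- (1) / tau) = lambda_pow w tau).
  { intros w tau Ht. rewrite <- Hinv by (apply HH_inv, Ht). rewrite Hinvol; auto. }
  assert (Hred : forall (w : R) tau, HH tau ->
    expipi (- (w * tau)) * lambda_pow w tau = Rpower 16 w * Cexp (w * L tau)).
  { intros w tau Ht. rewrite Hlam by auto.
    transitivity (expipi (- (w * tau)) * expipi (w * tau) * (Rpower 16 w * Cexp (w * L tau))); [ring|].
    rewrite expipi_opp; ring. }
  assert (Hskew : forall (w : R) tau, HH tau ->
    expipi (w * tau) * (Rpower 16 w * Cexp (w * L tau)) = lambda_pow w tau).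
  { intros w tau Ht. rewrite Hlam by auto. ring. }
  assert (Hfg : forall tau, HH tau -> f tau = lambda_pow w1 tau * one_sub_lambda_pow w2 tau * g tau).
  { intros tau Ht. rewrite hfg by auto. rewrite <- (Hinv w2 tau) by auto.
    transitivity ((lambda_pow (- w1) tau * lambda_pow w1 tau) *
      (lambda_pow (- w2) (- (1) / tau) * lambda_pow w2 (- (1) / tau)) * f tau); [|ring].
    rewrite !Hpow by auto using HH_inv. ring. }
  (* The algebra common to both directions: the coefficient relations imply that the skewed sum is
     the multiplier times the ordinary sum, because at [-1/tau] the powers of [lambda] and
     [1 - lambda] change places. *)
  assert (Hexp : forall a b ta tb : nat -> C, subexp a -> subexp b -> subexp ta -> subexp tb ->
    (forall tau, HH tau -> qfull a tau = Rpower 16 w1 * Cexp (w1 * L tau) * Cexp (w2 * M tau) * qfull ta tau) ->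
    (forall tau, HH tau -> qseries b tau = Rpower 16 w2 * Cexp (w2 * L tau) * Cexp (w1 * M tau) * qseries tb tau) ->
    a O = Rpower 16 w1 * ta O ->
    expansions_related w1 w2 a b ta tb /\
    forall tau, HH tau ->
      expipi (w1 * tau) * (a O + qseries a tau) + expipi (- (w2 / tau)) * qseries b (- (1) / tau) =
      lambda_pow w1 tau * one_sub_lambda_pow w2 tau * (ta O + qseries ta tau + qseries tb (- (1) / tau))).
  { intros a b ta tb Ha Hb Hta Htb Ea Eb E0. split; [split; [|split; [|exact E0]]|].
    - intros tau Ht. rewrite !qfull_split, Hred, Hone, Ea by auto. ring.
    - intros tau Ht. rewrite Hred, Hone, Eb by auto. ring.
    - intros tau Ht. pose proof (HH_inv tau Ht) as Hs.
      rewrite !qfull_split, Ea, Eb by auto. rewrite <- !Hone by auto. rewrite Hinv' by auto.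
      replace (- (w2 / tau)) with (w2 * (- (1) / tau)) by (field; apply HH_neq_0, Ht).
      transitivity (expipi (w1 * tau) * (Rpower 16 w1 * Cexp (w1 * L tau)) * one_sub_lambda_pow w2 tau * qfull ta tau +
        expipi (w2 * (- (1) / tau)) * (Rpower 16 w2 * Cexp (w2 * L (- (1) / tau))) * lambda_pow w1 tau *
        qseries tb (- (1) / tau)); [ring|].
      rewrite !Hskew, Hinv by auto. ring. }
  split.
  - intros ta tb [Cta [Ctb Eg]].
    pose proof (converges_subexp _ Cta) as Hta. pose proof (converges_subexp _ Ctb) as Htb.
    destruct (qfull_exp_mult L M w1 w2 (Rpower 16 w1) ta) as [a [Ha [Ha0 Ea]]]; auto.
    destruct (qfull_exp_mult L M w2 w1 (Rpower 16 w2) (drop_0 tb)) as [b [Hb [Hb0 Eb]]]; auto using drop_0_subexp.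
    simpl in Hb0. rewrite Cmult_0_r in Hb0.
    destruct (Hexp a b ta tb) as [Hrel Hsum]; auto.
    { intros tau Ht. rewrite (qseries_drop_0 tb), <- Eb, <- qfull_split, Hb0 by auto. ring. }
    exists a, b.
    split; [|repeat (split; [solve [auto using subexp_subexponential]|]); exact Hrel].
    split; [|split]; auto using subexp_converges.
    intros tau Ht. rewrite Hsum, Hfg, Eg by auto. reflexivity.
  - intros a b [Ca [Cb Ef]].
    pose proof (converges_subexp _ Ca) as Ha. pose proof (converges_subexp _ Cb) as Hb.
    (* The inverse multipliers have opposite exponents, so the same lemma produces the ordinary
       coefficients. *)
    destruct (qfull_exp_mult L M (- w1) (- w2) (Rpower 16 (- w1)) a) as [ta [Hta [Hta0 Eta]]]; auto.
    destruct (qfull_exp_mult L M (- w2) (- w1) (Rpower 16 (- w2)) (drop_0 b)) as [tb [Htb [Htb0 Etb]]]; auto using drop_0_subexp.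
    simpl in Htb0. rewrite Cmult_0_r in Htb0.
    assert (Hcancel : forall (u v : R) tau (x : C),
      Rpower 16 u * Cexp (u * L tau) * Cexp (v * M tau) *
      (Rpower 16 (- u) * Cexp ((- u)%R * L tau) * Cexp ((- v)%R * M tau) * x) = x).
    { intros u v tau x.
      transitivity (RtoC (Rpower 16 (- u)) * Rpower 16 u * (Cexp ((- u)%R * L tau) * Cexp (u * L tau)) *
        (Cexp ((- v)%R * M tau) * Cexp (v * M tau)) * x); [ring|].
      rewrite HR, !HE. ring. }
    destruct (Hexp a b ta tb) as [Hrel Hsum]; auto.
    { intros tau Ht. rewrite Eta by auto. symmetry. apply Hcancel. }
    { intros tau Ht. rewrite (qseries_drop_0 b) by auto.
      replace (qseries tb tau) with (qfull tb tau) by (rewrite <- qfull_split, Htb0 by auto; ring).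
      rewrite Etb by auto. symmetry. apply Hcancel. }
    { rewrite Hta0. transitivity (RtoC (Rpower 16 (- w1)) * Rpower 16 w1 * a O); [rewrite HR; ring|ring]. }
    exists ta, tb.
    split; [|repeat (split; [solve [auto using subexp_subexponential]|]); exact Hrel].
    split; [|split]; auto using subexp_converges.
    intros tau Ht. rewrite hfg, Ef, Hsum by auto. rewrite <- (Hinv w2) by auto.
    transitivity ((lambda_pow (- w1) tau * lambda_pow w1 tau) *
      (lambda_pow (- w2) (- (1) / tau) * lambda_pow w2 (- (1) / tau)) *
      (ta O + qseries ta tau + qseries tb (- (1) / tau))); [ring|].
    rewrite !Hpow by auto using HH_inv. ring.
Qed.
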